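(* Let $S$ be a set with $n=|S|$ elements and let $\oplus,\odot: S\times S\to S$ be binary operations given by their Cayley tables. There is a randomized algorithm running in time $O(n^{\omega})$ that decides, with high probability, whether $a\odot(b\oplus c)=(a\odot b)\oplus(a\odot c)$ holds for all $a,b,c\in S$. Moreover, if for some constant $\epsilon>0$ there is an algorithm solving this decision task in time $O(n^{\omega-\epsilon})$, then the Triangle Detection Hypothesis fails.
   Context: $\omega$ denotes the exponent of square matrix multiplication. Computation is in the word-RAM model with $O(\log n)$-bit words. ''With high probability'' means success probability at least $1-n^{-c}$ for an arbitrarily large constant $c$. Triangle Detection Hypothesis: for no constant $\epsilon>0$ is there an algorithm that decides in time $O(n^{\omega-\epsilon})$ whether a given $n$-vertex graph contains a triangle (three pairwise adjacent vertices). *)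

(* Defs.v *)
From HB Require Import structures.
From Stdlib Require PeanoNat.
From mathcomp Require Import all_boot all_order all_algebra.
From mathcomp Require Import classical_sets reals exp.

Set Implicit Arguments.
Unset Strict Implicit.
Unset Printing Implicit Defensive.

Import Order.TTheory GRing.Theory Num.Theory.

Local Open Scope ring_scope.

(* The word RAM. Words are the naturals below 2 ^ w; registers and memory     *)
(* cells hold words, and memory is addressed by words. A finite program uses  *)
(* only finitely many of the registers.                                       *)

Inductive binop :=
  Opadd | Opsub | Opmul | Opdiv | Opmod | Opand | Opor | Opxor | Opshl | Opshr.

Inductive instr :=
  | Const of nat & nat           (* Const r c    : r := c                     *)
  | Op of binop & nat & nat & nat (* Op o r s t   : r := s o t               *)
  | Read of nat & nat            (* Read r s     : r := mem[s]                *)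
  | Write of nat & nat           (* Write r s    : mem[r] := s                *)
  | Rand of nat                  (* Rand r       : r := uniformly random word *)
  | Jlt of nat & nat & nat       (* Jlt r s l    : if r < s goto l            *)
  | Jeq of nat & nat & nat.      (* Jeq r s l    : if r = s goto l            *)

Definition program := seq instr.

Definition is_rand (i : instr) : bool := if i is Rand _ then true else false.

Definition coin_free (P : program) : bool := ~~ has is_rand P.

(* [coins] lists the random words that have not been drawn yet. *)
Record state := State {
  pc : nat;
  reg : nat -> nat;
  memory : nat -> nat;
  coins : seq nat
}.

Definition upd (f : nat -> nat) (a v : nat) : nat -> nat :=
  fun i => if i == a then v else f i.

(* Arithmetic is modulo 2 ^ w; x / 0 = 0 and x mod 0 = x. *)
Definition eval_op (w : nat) (o : binop) (x y : nat) : nat :=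
  (match o with
   | Opadd => (x + y) %% 2 ^ w
   | Opsub => (x + (2 ^ w - y)) %% 2 ^ w
   | Opmul => (x * y) %% 2 ^ w
   | Opdiv => x %/ y
   | Opmod => x %% y
   | Opand => PeanoNat.Nat.land x y
   | Opor  => PeanoNat.Nat.lor x y
   | Opxor => PeanoNat.Nat.lxor x y
   | Opshl => (x * 2 ^ y) %% 2 ^ w
   | Opshr => x %/ 2 ^ y
   end)%N.

Definition exec (w : nat) (i : instr) (s : state) : state :=
  let: State p r m u := s in
  match i with
  | Const a c => State p.+1 (upd r a (c %% 2 ^ w)%N) m u
  | Op o a b c => State p.+1 (upd r a (eval_op w o (r b) (r c))) m u
  | Read a b => State p.+1 (upd r a (m (r b))) m u
  | Write a b => State p.+1 r (upd m (r a) (r b)) u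
  | Rand a => State p.+1 (upd r a (head 0%N u)) m (behead u)
  | Jlt a b l => State (if (r a < r b)%N then l else p.+1) r m u
  | Jeq a b l => State (if r a == r b then l else p.+1) r m u
  end.

(* A program halts by leaving its code. *)
Definition halted (P : program) (s : state) : bool := (size P <= pc s)%N.

Definition step (w : nat) (P : program) (s : state) : state :=
  if halted P s then s else exec w (nth (Const 0%N 0%N) P (pc s)) s.

Definition init (w : nat) (input u : seq nat) : state :=
  State 0%N (fun _ => 0%N) (fun i => nth 0 input i %% 2 ^ w)%N u.

Definition run (w : nat) (P : program) (T : nat) (input u : seq nat) : state :=
  iter T (step w P) (init w input u).

Definition accepts (s : state) : bool := reg s 0%N != 0%N.

(* Words of O(log n) bits: the constant k belongs to the algorithm. *)
Definition word_size (k n : nat) : nat := (k * (trunc_log 2 n).+1)%N.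

Record problem := Problem {
  instance : nat -> Type;
  encode : forall n, instance n -> seq nat;
  answer : forall n, instance n -> bool
}.

Section Complexity.
Variable R : realType.

Definition det_decidable_in (D : problem) (tau : R) : Prop :=
  exists (P : program) (k : nat) (C : R), coin_free P /\
    forall n (x : instance D n), (0 < n)%N ->
    exists2 T : nat, T%:R <= C * n%:R `^ tau &
      let s := run (word_size k n) P T (encode x) [::] in
      halted P s /\ accepts s = answer x.

(* A run of T steps draws at most T random words, so T uniform words suffice. *)
Definition success_prob (w : nat) (P : program) (T : nat) (input : seq nat)
    (b : bool) : R :=
  #|[pred u : T.-tuple 'I_(2 ^ w)%N |
      accepts (run w P T input [seq val i | i <- u]) == b]|%:R
  / #|{: T.-tuple 'I_(2 ^ w)%N}|%:R.

(* The time bound holds for every outcome of the coins; the error is at most  *)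
(* n ^ - c, for c an arbitrary constant on which the algorithm may depend.    *)
Definition rand_decidable_in (D : problem) (tau : R) : Prop :=
  forall c : R, exists (P : program) (k : nat) (C : R),
    forall n (x : instance D n), (0 < n)%N ->
    exists2 T : nat, T%:R <= C * n%:R `^ tau &
      let w := word_size k n in
      (forall u : T.-tuple 'I_(2 ^ w)%N,
        halted P (run w P T (encode x) [seq val i | i <- u])) /\
      1 - n%:R `^ (- c) <= success_prob w P T (encode x) (answer x).

Inductive algorithm_kind := Deterministic | Randomized.

Definition decidable_in (K : algorithm_kind) (D : problem) (tau : R) : Prop :=
  match K with
  | Deterministic => det_decidable_in D tau
  | Randomized => rand_decidable_in D tau
  end.

(* Two's complement. *)
Definition word_of_int (w : nat) (z : int) : nat := `|(z %% (2 ^ w)%N%:Z)%Z|%N.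

Definition int_of_word (w x : nat) : int :=
  if (x < 2 ^ w.-1)%N then x%:Z else x%:Z - (2 ^ w)%N%:Z.

Definition encode_mx (w n : nat) (A : 'M[int]_n) : seq nat :=
  [seq word_of_int w (A i j) | i <- enum 'I_n, j <- enum 'I_n].

(* Exact product of integer matrices with entries of O(log n) bits. Cell 0    *)
(* holds n, followed by A, B and then the product, each in row-major order.   *)
Definition matmul_in (tau : R) : Prop :=
  forall e : nat, exists (P : program) (k : nat) (C : R), coin_free P /\
    forall n (A B : 'M[int]_n), (0 < n)%N ->
    (forall i j, `|A i j| <= (n ^ e)%N%:Z) ->
    (forall i j, `|B i j| <= (n ^ e)%N%:Z) ->
    exists2 T : nat, T%:R <= C * n%:R `^ tau &
      let w := word_size k n in
      let s := run w P T (n :: encode_mx w A ++ encode_mx w B) [::] in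
      halted P s /\
      forall i j : 'I_n,
        int_of_word w (memory s (1 + 2 * n ^ 2 + i * n + j)%N) = (A *m B) i j.

(* The exponent of matrix multiplication in the word-RAM model. It is an      *)
(* infimum, so [matmul_in omega] need not hold.                               *)
Definition omega : R := inf [set tau : R | matmul_in tau]%classic.

End Complexity.

(* A set of n elements with two binary operations; S is taken to be 'I_n,     *)
(* so that Cayley tables can be written as words.                             *)
Record bimagma (n : nat) := Bimagma {
  oplus : 'I_n -> 'I_n -> 'I_n;
  odot : 'I_n -> 'I_n -> 'I_n
}.

Definition cayley_table (n : nat) (f : 'I_n -> 'I_n -> 'I_n) : seq nat :=
  [seq val (f a b) | a <- enum 'I_n, b <- enum 'I_n].

Definition distributivity : problem :=
  @Problem bimagma
    (fun n S => n :: cayley_table (oplus S) ++ cayley_table (odot S))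
    (fun n S => [forall a, forall b, forall c,
       odot S a (oplus S b c) == oplus S (odot S a b) (odot S a c)]).

Record sgraph (n : nat) := SGraph {
  adj : rel 'I_n;
  adj_sym : symmetric adj;
  adj_irrefl : irreflexive adj
}.

Definition triangle_detection : problem :=
  @Problem sgraph
    (fun n G => n :: [seq nat_of_bool (adj G x y)
                     | x <- enum 'I_n, y <- enum 'I_n])
    (fun n G => [exists x, exists y, exists z,
       [&& adj G x y, adj G y z & adj G x z]]).

Definition triangle_hypothesis (R : realType) (K : algorithm_kind) : Prop :=
  ~ exists2 eps : R, 0 < eps &
      decidable_in K triangle_detection (omega R - eps).

(* Main.v *)
(* Upper bound. Draw vectors y, z, r with entries below q, polynomially large *)
(* in n, and compare for every a the sums over b, c of                        *)
(*   y b * z c * r (a . (b + c))  and  y b * z c * r ((a . b) + (a . c)).     *)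
(* Grouping the former by the value of b + c takes quadratic time. In the     *)
(* latter, put Y a s for the sum of the y b with a . b = s and R s t for      *)
(* r (s + t): it is the sum over c of z c * (Y *m R) a (a . c), so a single   *)
(* integer matrix product gives it for all a. If the law fails at a, b, c,    *)
(* the difference of the two sums is a trilinear form in y, z, r with a       *)
(* nonzero coefficient, hence vanishes with probability at most 3 / q.        *)
(*                                                                            *)
(* Lower bound. A graph on the vertices V gives the operations on V and two   *)
(* further points o, e with x . y = y and x + y = e on edges, and o           *)
(* elsewhere. Then x . (y + z) = o always, and (x . y) + (x . z) = e exactly  *)
(* on the triangles. The hypothetical algorithm for distributivity is run on  *)
(* these tables, whose entries are computed on demand from the graph.         *)
(*                                                                            *)
(* Both directions run a given program inside another one, with a larger word *)
(* size and a private part of the memory.                                     *)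

Require Import Defs.
From HB Require Import structures.
From Stdlib Require Import PeanoNat.
From mathcomp Require Import all_boot all_order all_algebra zify ring lra.
From mathcomp Require Import classical_sets reals exp.

Set Implicit Arguments.
Unset Strict Implicit.
Unset Printing Implicit Defensive.

Import Order.TTheory GRing.Theory Num.Theory.
Local Open Scope nat_scope.

(** * A structured language and its compilation *)

(** Upper bound. For fixed a, the two sides of the law, weighted by y b * z c and evaluated by r,
    are [left_sum] and [right_sum]. If the law holds they agree for every draw ([checker_answer]).
    If it fails at a, b, c, their difference is affine in y b, the slope is affine in z c, and the
    slope of that is affine in r at a . (b + c) with slope 1. Counting roots one coin at a time
    ([card_roots_affine], [card_unsound]) leaves a fraction of at most 3 / q of bad draws, which is
    below n ^ - c when q is a large enough power of n. All work apart from the matrix product is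
    quadratic and is absorbed because [omega] is at least 2 ([matmul_in_ge2], [omega_ge2]). So every
    exponent of matrix multiplication is one for the decision task ([distributivity_randomized]),
    and exponents close to the infimum give every omega + delta.

    Lower bound. The gadget of a graph on n vertices has n + 2 points and is distributive exactly
    when the graph has no triangle ([gadget_answer]). Its tables are computed on demand, so the
    overhead is a constant factor per step plus linear time. The linear term is harmless once the
    saving eps is capped at 1, because omega - 1 is at least 1. For randomized algorithms, reducing
    long words to short ones maps uniform coins to uniform coins ([card_reduce]), hence the success
    probability is unchanged.

    Machine model. Programs are written in a small while language with a cost semantics; [compP] and
    [tot_run] turn time-bounded triples [tot] into runs of the RAM. [simulatorP] executes an
    arbitrary program with w-bit words inside a machine with W-bit words: arithmetic is reduced
    modulo 2 ^ w ([eval_op_mod]), and an oracle supplies the initial content of the simulated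
    memory, which therefore never has to be copied or cleared. *)

Inductive expr :=
  | Var of nat
  | Cst of nat
  | Bin of binop & expr & expr
  | Deref of expr.

Inductive cmd :=
  | Skip
  | Asg of nat & expr
  | Sto of expr & expr
  | Rnd of nat
  | Seq of cmd & cmd
  | IfLt of expr & expr & cmd & cmd
  | IfEq of expr & expr & cmd & cmd
  | While of expr & expr & cmd.

Record config := Config {
  env : nat -> nat;
  heap : nat -> nat;
  rnd : seq nat
}.

Fixpoint ev (w : nat) (s : config) (e : expr) : nat :=
  match e with
  | Var x => env s x
  | Cst c => c %% 2 ^ w
  | Bin o a b => eval_op w o (ev w s a) (ev w s b)
  | Deref a => heap s (ev w s a)
  end.

Definition assign (s : config) (x v : nat) : config :=
  Config (upd (env s) x v) (heap s) (rnd s).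

Definition store (s : config) (a v : nat) : config :=
  Config (env s) (upd (heap s) a v) (rnd s).

Definition draw (s : config) (x : nat) : config :=
  Config (upd (env s) x (head 0 (rnd s))) (heap s) (behead (rnd s)).

(* Variable x lives in register 2x, the d-th temporary in register 2d + 1.    *)
Fixpoint comp_expr (d : nat) (e : expr) : seq instr :=
  match e with
  | Var x => [:: Op Opor d.*2.+1 x.*2 x.*2]
  | Cst c => [:: Const d.*2.+1 c]
  | Bin o a b => comp_expr d a ++ comp_expr d.+1 b
                 ++ [:: Op o d.*2.+1 d.*2.+1 d.+1.*2.+1]
  | Deref a => comp_expr d a ++ [:: Read d.*2.+1 d.*2.+1]
  end.

Fixpoint size_expr (e : expr) : nat :=
  match e with
  | Var _ | Cst _ => 1
  | Bin _ a b => size_expr a + size_expr b + 1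
  | Deref a => size_expr a + 1
  end.

Fixpoint size_cmd (c : cmd) : nat :=
  match c with
  | Skip => 0
  | Asg _ e => size_expr e + 1
  | Sto a e => size_expr a + size_expr e + 1
  | Rnd _ => 1
  | Seq c1 c2 => size_cmd c1 + size_cmd c2
  | IfLt a b c1 c2 | IfEq a b c1 c2 =>
      size_expr a + size_expr b + 1 + size_cmd c2 + 1 + size_cmd c1
  | While a b c => size_expr a + size_expr b + 2 + size_cmd c + 1
  end.

(** Jump targets are absolute, hence the offset [o]. A move is the disjunction of a register with
    itself, and [Jeq 0 0] is an unconditional jump. A successful test jumps, so the code of the
    negative branch comes first. *)
Fixpoint comp (o : nat) (c : cmd) : seq instr :=
  match c with
  | Skip => [::]
  | Asg x e => comp_expr 0 e ++ [:: Op Opor x.*2 1 1]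
  | Sto a e => comp_expr 0 a ++ comp_expr 1 e ++ [:: Write 1 3]
  | Rnd x => [:: Rand x.*2]
  | Seq c1 c2 => comp o c1 ++ comp (o + size_cmd c1) c2
  | IfLt a b c1 c2 =>
      let o2 := o + size_expr a + size_expr b + 1 in
      let o1 := o2 + size_cmd c2 + 1 in
      comp_expr 0 a ++ comp_expr 1 b ++ Jlt 1 3 o1 :: comp o2 c2
      ++ Jeq 0 0 (o1 + size_cmd c1) :: comp o1 c1
  | IfEq a b c1 c2 =>
      let o2 := o + size_expr a + size_expr b + 1 in
      let o1 := o2 + size_cmd c2 + 1 in
      comp_expr 0 a ++ comp_expr 1 b ++ Jeq 1 3 o1 :: comp o2 c2
      ++ Jeq 0 0 (o1 + size_cmd c1) :: comp o1 c1
  | While a b c =>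
      let o1 := o + size_expr a + size_expr b + 2 in
      comp_expr 0 a ++ comp_expr 1 b ++ Jlt 1 3 o1
      :: Jeq 0 0 (o1 + size_cmd c + 1) :: comp o1 c ++ [:: Jeq 0 0 o]
  end.

Lemma size_comp_expr d e : size (comp_expr d e) = size_expr e.
Proof.
elim: e d => //= [o a IHa b IHb|a IHa] d; rewrite !size_cat /= ?IHa ?IHb //.
by rewrite addnA.
Qed.

Lemma size_comp o c : size (comp o c) = size_cmd c.
Proof.
elim: c o => //= [x e|a e|c1 IH1 c2 IH2|a b c1 IH1 c2 IH2|a b c1 IH1 c2 IH2
  |a b c IH] o; rewrite ?size_cat /= ?size_cat /= ?size_comp_expr ?IH1 ?IH2 ?IH;
  rewrite /=; lia.
Qed.

(** The cost is the exact number of machine steps of the compiled code, including the jumps that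
    leave a negative branch or close a loop. *)
Inductive exe (w : nat) : cmd -> config -> nat -> config -> Prop :=
  | exe_skip s : exe w Skip s 0 s
  | exe_asg s x e : exe w (Asg x e) s (size_expr e + 1) (assign s x (ev w s e))
  | exe_sto s a e : exe w (Sto a e) s (size_expr a + size_expr e + 1)
                        (store s (ev w s a) (ev w s e))
  | exe_rnd s x : exe w (Rnd x) s 1 (draw s x)
  | exe_seq s c1 c2 t1 s1 t2 s2 :
      exe w c1 s t1 s1 -> exe w c2 s1 t2 s2 -> exe w (Seq c1 c2) s (t1 + t2) s2
  | exe_iflt_t s a b c1 c2 t s' : ev w s a < ev w s b -> exe w c1 s t s' ->
      exe w (IfLt a b c1 c2) s (size_expr a + size_expr b + 1 + t) s'
  | exe_iflt_f s a b c1 c2 t s' : ~~ (ev w s a < ev w s b) -> exe w c2 s t s' ->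
      exe w (IfLt a b c1 c2) s (size_expr a + size_expr b + 1 + t + 1) s'
  | exe_ifeq_t s a b c1 c2 t s' : ev w s a == ev w s b -> exe w c1 s t s' ->
      exe w (IfEq a b c1 c2) s (size_expr a + size_expr b + 1 + t) s'
  | exe_ifeq_f s a b c1 c2 t s' : ev w s a != ev w s b -> exe w c2 s t s' ->
      exe w (IfEq a b c1 c2) s (size_expr a + size_expr b + 1 + t + 1) s'
  | exe_while_f s a b c : ~~ (ev w s a < ev w s b) ->
      exe w (While a b c) s (size_expr a + size_expr b + 2) s
  | exe_while_t s a b c t s1 t' s2 : ev w s a < ev w s b ->
      exe w c s t s1 -> exe w (While a b c) s1 t' s2 ->
      exe w (While a b c) s (size_expr a + size_expr b + 1 + t + 1 + t') s2.

Definition code_at (Q : program) (o : nat) (c : seq instr) : Prop :=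
  take (size c) (drop o Q) = c.

Lemma code_at_cat Q o c1 c2 :
  code_at Q o (c1 ++ c2) -> code_at Q o c1 /\ code_at Q (o + size c1) c2.
Proof.
rewrite /code_at size_cat takeD drop_drop => H.
have sz : size (take (size c1) (drop o Q)) = size c1.
  have := congr1 size H; rewrite !size_cat !size_take !size_drop.
  by case: ltnP; case: ltnP; lia.
move: (congr1 (take (size c1)) H) (congr1 (drop (size c1)) H).
rewrite -{1 4}sz !take_size_cat ?drop_size_cat // => -> H2; split=> //.
by rewrite addnC.
Qed.

Lemma code_at_cons Q o i c :
  code_at Q o (i :: c) -> [/\ o < size Q, nth (Const 0 0) Q o = i &
                            code_at Q o.+1 c].
Proof.
rewrite -[i :: c]/([:: i] ++ c) => /code_at_cat[]; rewrite addn1 => H1 H2.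
move: H1; rewrite /code_at /=.
have [lt|ge] := ltnP o (size Q); last by rewrite drop_oversize.
by rewrite (drop_nth (Const 0 0) lt) /= take0 => -[->].
Qed.


(** Odd registers are unconstrained: they hold temporaries. *)
Definition represents (o : nat) (s : config) (q : state) : Prop :=
  [/\ pc q = o, (forall x, reg q x.*2 = env s x), memory q = heap s
    & coins q = rnd s].

Lemma double_eqS x d : (x.*2 == d.*2.+1) = false.
Proof. lia. Qed.

Lemma stepE w Q q : pc q < size Q ->
  step w Q q = exec w (nth (Const 0 0) Q (pc q)) q.
Proof. by move=> lt; rewrite /step /halted leqNgt lt. Qed.

Lemma iter_plus (T : Type) (f : T -> T) a b x :
  iter (a + b) f x = iter b f (iter a f x).
Proof. by rewrite addnC iterD. Qed.

(** Temporaries below [d] must survive, because the left operand of a binary operation waits in one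
    of them while the right operand is computed. *)
Lemma comp_exprP w Q e : forall d o s q, code_at Q o (comp_expr d e) ->
  represents o s q ->
  exists q', [/\ iter (size_expr e) (step w Q) q = q',
     represents (o + size_expr e) s q', reg q' d.*2.+1 = ev w s e &
     forall d', d' < d -> reg q' d'.*2.+1 = reg q d'.*2.+1].
Proof.
have one_step c d v o s q : o < size Q -> nth (Const 0 0) Q o = c ->
  represents o s q ->
  exec w c q = State (pc q).+1 (upd (reg q) d.*2.+1 v) (memory q) (coins q) ->
  [/\ represents (o + 1) s (step w Q q), reg (step w Q q) d.*2.+1 = v &
     forall d', d' < d -> reg (step w Q q) d'.*2.+1 = reg q d'.*2.+1].
  move=> lt nthE [pcE regE memE cE] ex.
  rewrite stepE pcE // nthE ex /represents /= /upd eqxx pcE addn1.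
  split=> // [|d' ld]; first by split=> // x; rewrite double_eqS.
  by case: eqP => //; lia.
elim: e => [x|c|p a IHa b IHb|a IHa] d o s q /=.
- case/code_at_cons=> lt nthE _ rep.
  have [|R V F] := one_step _ d (env s x) _ _ _ lt nthE rep.
    by case: q rep => pq rq mq uq [_ /= regE _ _]; rewrite Nat.lor_diag regE.
  by eexists; split; [reflexivity|exact: R|exact: V|exact: F].
- case/code_at_cons=> lt nthE _ rep.
  have [|R V F] := one_step _ d (c %% 2 ^ w) _ _ _ lt nthE rep.
    by case: q rep.
  by eexists; split; [reflexivity|exact: R|exact: V|exact: F].
- case/code_at_cat=> Ca /code_at_cat[Cb].
  rewrite !size_comp_expr in Cb * => /code_at_cons[lt nthE _] rep.
  have [q1 [E1 R1 V1 F1]] := IHa _ _ _ _ Ca rep.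
  have [q2 [E2 R2 V2 F2]] := IHb _ _ _ _ Cb R1.
  have [|R V F] := one_step _ d (eval_op w p (ev w s a) (ev w s b)) _ _ _ lt nthE R2.
    by rewrite -V1 -(F2 d) // -V2; case: (q2).
  eexists; split; first by rewrite !iter_plus E1 E2.
  + by rewrite !addnA.
  + exact: V.
  + by move=> d' ld; rewrite F // F2 ?F1 // ltnW.
- case/code_at_cat=> Ca.
  rewrite !size_comp_expr => /code_at_cons[lt nthE _] rep.
  have [q1 [E1 R1 V1 F1]] := IHa _ _ _ _ Ca rep.
  have [|R V F] := one_step _ d (heap s (ev w s a)) _ _ _ lt nthE R1.
    by case: R1 => _ _ <- _; rewrite -V1; case: (q1).
  eexists; split; first by rewrite !iter_plus E1.
  + by rewrite !addnA.
  + exact: V.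
  + by move=> d' ld; rewrite F // F1.
Qed.

Lemma comp_expr2P w Q a b o s q : code_at Q o (comp_expr 0 a ++ comp_expr 1 b) ->
  represents o s q ->
  exists q', [/\ iter (size_expr a + size_expr b) (step w Q) q = q',
     represents (o + (size_expr a + size_expr b)) s q', reg q' 1 = ev w s a &
     reg q' 3 = ev w s b].
Proof.
case/code_at_cat=> Ca; rewrite size_comp_expr => Cb rep.
have [q1 [E1 R1 V1 F1]] := comp_exprP w Ca rep.
have [q2 [E2 R2 V2 F2]] := comp_exprP w Cb R1.
exists q2; rewrite addnA; split=> //; first by rewrite iter_plus E1.
by rewrite (F2 0).
Qed.

Lemma represents_jump w Q o s q i l : represents o s q -> o < size Q ->
  nth (Const 0 0) Q o = i ->
  exec w i q = State l (reg q) (memory q) (coins q) ->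
  represents l s (step w Q q).
Proof.
move=> [pcE regE memE cE] lt nthE ex.
by rewrite stepE pcE // nthE ex.
Qed.

Lemma comp_testP w Q a b i l o s q c :
  code_at Q o (comp_expr 0 a ++ comp_expr 1 b ++ i :: c) -> represents o s q ->
  (forall r m u, r 1 = ev w s a -> r 3 = ev w s b ->
     let p := o + (size_expr a + size_expr b) in
     exec w i (State p r m u) = State l r m u) ->
  represents l s (iter (size_expr a + size_expr b + 1) (step w Q) q).
Proof.
rewrite catA => /code_at_cat[C]; rewrite size_cat !size_comp_expr.
case/code_at_cons=> lt nthE _ /(comp_expr2P w C)[q' [E R Va Ve]] ex.
rewrite addn1 iterS E; apply: (represents_jump R lt nthE).
by case: (q') R Va Ve => p r m u [/= -> _ _ _]; apply: ex.
Qed.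

(** Induction on the execution, not on the command, so that the remaining rounds of a loop are
    covered by the induction hypothesis. *)
Lemma compP w Q c s t s' : exe w c s t s' -> forall o q,
  code_at Q o (comp o c) -> represents o s q ->
  represents (o + size_cmd c) s' (iter t (step w Q) q).
Proof.
have goto o l c' s0 q : code_at Q o (Jeq 0 0 l :: c') -> represents o s0 q ->
    represents l s0 (step w Q q).
  move=> /code_at_cons[lt nthE _] r; apply: represents_jump r lt nthE _.
  by case: (q) => pq rq mq uq /=; rewrite eqxx.
have rest o a b i c' : code_at Q o (comp_expr 0 a ++ comp_expr 1 b ++ i :: c') ->
    code_at Q (o + size_expr a + size_expr b + 1) c'.
  rewrite catA => /code_at_cat[_]; rewrite size_cat !size_comp_expr.
  by case/code_at_cons=> _ _; rewrite addn1 addnA.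
have branch1 o a b i c1 c2 l (o2 := o + size_expr a + size_expr b + 1)
    (o1 := o2 + size_cmd c2 + 1) :
    code_at Q o (comp_expr 0 a ++ comp_expr 1 b ++ i :: comp o2 c2 ++
                 Jeq 0 0 l :: comp o1 c1) ->
    code_at Q o1 (comp o1 c1).
  move=> /rest/code_at_cat[_]; rewrite size_comp.
  by case/code_at_cons => _ _; rewrite -addn1.
have branch2 o a b i c1 c2 l (o2 := o + size_expr a + size_expr b + 1)
    (o1 := o2 + size_cmd c2 + 1) :
    code_at Q o (comp_expr 0 a ++ comp_expr 1 b ++ i :: comp o2 c2 ++
                 Jeq 0 0 l :: comp o1 c1) ->
    code_at Q o2 (comp o2 c2) /\
    code_at Q (o2 + size_cmd c2) (Jeq 0 0 l :: comp o1 c1).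
  by move=> /rest/code_at_cat; rewrite size_comp.
elim=> {c s t s'}.
- by move=> s o q _ r; rewrite addn0.
- move=> s x e o q /code_at_cat[C]; rewrite size_comp_expr => /code_at_cons[lt nthE _].
  move=> /(comp_exprP w C)[q' [E [pcE regE memE cE] V _]].
  rewrite addn1 iterS E stepE pcE // nthE.
  case: q' {E} pcE regE memE cE V => pq rq mq uq /= -> regE -> -> V.
  rewrite /represents /=; split=> //; first lia.
  move=> x'; rewrite /upd V Nat.lor_diag regE.
  by rewrite -!muln2 eqn_mul2r.
- move=> s a e o q; rewrite /= catA => /code_at_cat[C].
  rewrite size_cat !size_comp_expr => /code_at_cons[lt nthE _].
  move=> /(comp_expr2P w C)[q' [E [pcE regE memE cE] Va Ve]].
  rewrite addn1 iterS E stepE pcE // nthE.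
  case: q' {E} pcE regE memE cE Va Ve => pq rq mq uq /= -> regE -> -> Va Ve.
  by rewrite /represents /= Va Ve; split=> //; lia.
- move=> s x o q /code_at_cons[lt nthE _] [pcE regE memE cE].
  rewrite /= stepE pcE // nthE.
  case: q pcE regE memE cE => pq rq mq uq /= -> regE -> ->.
  rewrite /represents /=; split=> //; first lia.
  by move=> x'; rewrite /upd regE -!muln2 eqn_mul2r.
- move=> s c1 c2 t1 s1 t2 s2 _ IH1 _ IH2 o q /code_at_cat[C1].
  rewrite size_comp => C2 /(IH1 _ _ C1) /(IH2 _ _ C2).
  by rewrite /= addnA iter_plus.
- move=> s a b c1 c2 t s' ab _ IH o q /= C rep.
  rewrite iter_plus !addnA; apply: IH; first exact: branch1 C.
  by apply: comp_testP C rep _ => r m u /= -> ->; rewrite ab.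
- move=> s a b c1 c2 t s' ab _ IH o q /= C rep.
  have [C2 C1] := branch2 _ _ _ _ _ _ _ C.
  rewrite 2!iter_plus !addnA; apply: goto C1 _; apply: IH => //.
  by apply: comp_testP C rep _ => r m u /= -> ->; rewrite (negbTE ab) addn1 addnA.
- move=> s a b c1 c2 t s' ab _ IH o q /= C rep.
  rewrite iter_plus !addnA; apply: IH; first exact: branch1 C.
  by apply: comp_testP C rep _ => r m u /= -> ->; rewrite ab.
- move=> s a b c1 c2 t s' ab _ IH o q /= C rep.
  have [C2 C1] := branch2 _ _ _ _ _ _ _ C.
  rewrite 2!iter_plus !addnA; apply: goto C1 _; apply: IH => //.
  by apply: comp_testP C rep _ => r m u /= -> ->; rewrite (negbTE ab) addn1 addnA.
- move=> s a b c ab o q /= C rep.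
  have e2 : size_expr a + size_expr b + 2 = size_expr a + size_expr b + 1 + 1.
    by lia.
  rewrite [X in iter X]e2 iter_plus !addnA.
  apply: goto (rest _ _ _ _ _ C) _.
  by apply: comp_testP C rep _ => r m u /= -> ->; rewrite (negbTE ab) addn1 addnA.
- move=> s a b c t s1 t' s2 ab _ IH1 _ IH2 o q /= C rep.
  have := rest _ _ _ _ _ C => /code_at_cons[_ _]; rewrite -addn1 -addnA.
  case/code_at_cat => C1; rewrite size_comp => C2.
  rewrite 3!iter_plus; apply: IH2 => //; apply: goto C2 _; apply: IH1 => //.
  apply: comp_testP C rep _ => r m u /= -> ->.
  by rewrite ab addnA.
Qed.

(** * Total correctness with time bounds *)

Definition initial (m : nat -> nat) (u : seq nat) : config :=
  Config (fun _ => 0) m u.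

Definition tot (w : nat) (c : cmd) (s : config) (t : nat)
    (post : config -> Prop) : Prop :=
  exists t' s', [/\ t' <= t, exe w c s t' s' & post s'].

Lemma halted_step w P q : halted P q -> step w P q = q.
Proof. by rewrite /step => ->. Qed.

Lemma halted_iter w P q t : halted P q -> iter t (step w P) q = q.
Proof. by move=> h; elim: t => //= t ->; apply: halted_step. Qed.

(** A halted state is a fixed point of [step], so running for any [T] beyond the actual time gives
    the same final state. *)
Lemma tot_run w c t T post input u :
  tot w c (initial (fun i => nth 0 input i %% 2 ^ w) u) t post -> t <= T ->
  let q := run w (comp 0 c) T input u in
  halted (comp 0 c) q /\
  exists s, [/\ post s, reg q 0 = env s 0 & memory q = heap s].
Proof.
move=> [t' [s [le_t' /compP ex ps]]] le_tT q.
have [|//|pcE regE memE cE] := ex (comp 0 c) 0 (init w input u).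
  by rewrite /code_at drop0 take_size.
have ht : halted (comp 0 c) (iter t' (step w (comp 0 c)) (init w input u)).
  by rewrite /halted pcE size_comp.
have <- : iter t' (step w (comp 0 c)) (init w input u) = q.
  by rewrite /q /run -(subnKC (leq_trans le_t' le_tT)) iter_plus (halted_iter _ _ ht).
by split=> //; exists s; rewrite -(regE 0).
Qed.

Fixpoint draw_free (c : cmd) : bool :=
  match c with
  | Rnd _ => false
  | Seq c1 c2 | IfLt _ _ c1 c2 | IfEq _ _ c1 c2 => draw_free c1 && draw_free c2
  | While _ _ c => draw_free c
  | _ => true
  end.

Lemma coin_free_comp o c : coin_free (comp o c) = draw_free c.
Proof.
have E d e : has is_rand (comp_expr d e) = false.
  by elim: e d => //= [p a IHa b IHb|a IHa] d; rewrite !has_cat ?IHa ?IHb.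
rewrite /coin_free.
elim: c o => //= [x e|a e|c1 IH1 c2 IH2|a b c1 IH1 c2 IH2|a b c1 IH1 c2 IH2
  |a b c IH] o; rewrite ?has_cat /= ?has_cat /= ?E //= ?orbF ?negb_or ?IH1 ?IH2 ?IH //.
all: by rewrite andbC.
Qed.

Fixpoint loop_free (c : cmd) : bool :=
  match c with
  | Seq c1 c2 | IfLt _ _ c1 c2 | IfEq _ _ c1 c2 => loop_free c1 && loop_free c2
  | While _ _ _ => false
  | _ => true
  end.

(* Loops are skipped, so this is meaningful for loop-free commands only. *)
Fixpoint effect (w : nat) (c : cmd) (s : config) : config :=
  match c with
  | Skip | While _ _ _ => s
  | Asg x e => assign s x (ev w s e)
  | Sto a e => store s (ev w s a) (ev w s e)
  | Rnd x => draw s x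
  | Seq c1 c2 => effect w c2 (effect w c1 s)
  | IfLt a b c1 c2 =>
      if ev w s a < ev w s b then effect w c1 s else effect w c2 s
  | IfEq a b c1 c2 =>
      if ev w s a == ev w s b then effect w c1 s else effect w c2 s
  end.

(** Without loops every instruction is executed at most once, so the length of the code bounds the
    time. *)
Lemma tot_effect w c s (post : config -> Prop) :
  loop_free c -> post (effect w c s) -> tot w c s (size_cmd c) post.
Proof.
move=> lf ps.
suff [t le_t ex] : exists2 t, t <= size_cmd c & exe w c s t (effect w c s).
  by exists t, (effect w c s).
elim: c s lf {ps} => //=.
- by move=> s _; exists 0 => //; constructor.
- by move=> x e s _; eexists; last constructor.
- by move=> a e s _; eexists; last constructor.
- by move=> x s _; eexists; last constructor.
- move=> c1 IH1 c2 IH2 s /andP[/(IH1 s)[t1 l1 e1] /(IH2 (effect w c1 s))[t2 l2 e2]].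
  by exists (t1 + t2); [apply: leq_add | apply: exe_seq e1 e2].
- move=> a b c1 IH1 c2 IH2 s /andP[/(IH1 s)[t1 l1 e1] /(IH2 s)[t2 l2 e2]].
  case: ifPn => ab.
    by exists (size_expr a + size_expr b + 1 + t1); [lia | apply: exe_iflt_t].
  by exists (size_expr a + size_expr b + 1 + t2 + 1); [lia | apply: exe_iflt_f].
- move=> a b c1 IH1 c2 IH2 s /andP[/(IH1 s)[t1 l1 e1] /(IH2 s)[t2 l2 e2]].
  case: ifPn => ab.
    by exists (size_expr a + size_expr b + 1 + t1); [lia | apply: exe_ifeq_t].
  by exists (size_expr a + size_expr b + 1 + t2 + 1); [lia | apply: exe_ifeq_f].
Qed.

Lemma tot_weaken w c s t t' (post post' : config -> Prop) :
  tot w c s t post -> t <= t' -> (forall s', post s' -> post' s') ->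
  tot w c s t' post'.
Proof.
move=> [t0 [s0 [le0 ex0 p0]]] le_t imp.
by exists t0, s0; split; [exact: leq_trans le0 le_t | | exact: imp].
Qed.

Lemma tot_leq w c s t t' post : tot w c s t post -> t <= t' -> tot w c s t' post.
Proof. by move=> h le; apply: tot_weaken h le _. Qed.

Lemma tot_seq w c1 c2 s t1 t2 (mid post : config -> Prop) :
  tot w c1 s t1 mid -> (forall s', mid s' -> tot w c2 s' t2 post) ->
  tot w (Seq c1 c2) s (t1 + t2) post.
Proof.
move=> [t [s1 [le1 ex1 /[swap] H /H[t' [s2 [le2 ex2 p2]]]]]].
by exists (t + t'), s2; split; [exact: leq_add | exact: exe_seq ex1 ex2 |].
Qed.

Lemma tot_iflt w a b c1 c2 s t post :
  (ev w s a < ev w s b -> tot w c1 s t post) ->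
  (ev w s b <= ev w s a -> tot w c2 s t post) ->
  tot w (IfLt a b c1 c2) s (size_expr a + size_expr b + 2 + t) post.
Proof.
move=> H1 H2; have [ab|ab] := ltnP (ev w s a) (ev w s b).
  have [t' [s' [le ex p]]] := H1 ab.
  exists (size_expr a + size_expr b + 1 + t'), s'; split=> //; first lia.
  exact: exe_iflt_t.
have [t' [s' [le ex p]]] := H2 ab.
exists (size_expr a + size_expr b + 1 + t' + 1), s'; split=> //; first lia.
by apply: exe_iflt_f ex; rewrite -leqNgt.
Qed.

Lemma tot_while w a b c s t n (I : nat -> config -> Prop) :
  I 0 s ->
  (forall i s', i < n -> I i s' ->
     ev w s' a < ev w s' b /\ tot w c s' t (I i.+1)) ->
  (forall s', I n s' -> ev w s' b <= ev w s' a) ->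
  tot w (While a b c) s
    (n * (size_expr a + size_expr b + t + 2) + (size_expr a + size_expr b + 2))
    (I n).
Proof.
move=> I0 body exit.
suff main k : k <= n -> forall s', I (n - k) s' ->
  tot w (While a b c) s'
    (k * (size_expr a + size_expr b + t + 2) + (size_expr a + size_expr b + 2))
    (I n).
  by apply: main; rewrite ?subnn.
elim: k => [|k IH] le_k s' Ik.
  rewrite subn0 in Ik.
  eexists; exists s'; split; [|apply: exe_while_f; rewrite -leqNgt; exact: exit|] => //.
have [|lt [t1 [s1 [le1 ex1 I1]]]] := body (n - k.+1) s' _ Ik; first lia.
have [||t2 [s2 [le2 ex2 p2]]] := IH _ s1; first lia.
  by move: I1; congr (I _ _); lia.
eexists; exists s2; split; [|exact: exe_while_t lt ex1 ex2|] => //.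
by rewrite mulSn; lia.
Qed.

Definition For (x y : nat) (c : cmd) : cmd :=
  Seq (Asg x (Cst 0))
      (While (Var x) (Var y) (Seq c (Asg x (Bin Opadd (Var x) (Cst 1))))).

(** The bound [y] is read after the assignment to the counter, which spares a separate hypothesis
    that the two variables differ. The counter must not wrap around, whence n < 2 ^ w. *)
Lemma tot_for w x y c s t n (I : nat -> config -> Prop) :
  n < 2 ^ w -> I 0 (assign s x 0) -> env (assign s x 0) y = n ->
  (forall i s', i < n -> I i s' -> env s' x = i -> env s' y = n ->
     tot w c s' t (fun s1 => [/\ env s1 x = i, env (assign s1 x i.+1) y = n
                               & I i.+1 (assign s1 x i.+1)])) ->
  tot w (For x y c) s (n * (t + 8) + 6) (fun s1 => I n s1 /\ env s1 x = n).
Proof.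
move=> n_lt I0 ny body.
pose J i s1 := [/\ I i s1, env s1 x = i & env s1 y = n].
have -> : n * (t + 8) + 6 = 2 + (n * (1 + 1 + (t + 4) + 2) + (1 + 1 + 2)) by lia.
have J0 : J 0 (assign s x 0) by split=> //=; rewrite /upd eqxx.
apply: (tot_seq (mid := J 0)).
  by apply: tot_effect => //=; rewrite mod0n.
move=> s0 {}J0; apply: (tot_weaken (t := n * (1 + 1 + (t + 4) + 2) + (1 + 1 + 2))
  (post := J n)) => // [|s1 [? ? _] //].
apply: tot_while J0 _ _ => [i s1 lt_i [Ii xi yi]|s1 [_ xi yi]] /=; last by rewrite xi yi.
split; first by rewrite xi yi.
apply: tot_seq (body i s1 lt_i Ii xi yi) _ => s2 [x2 y2 I2].
apply: tot_effect => //=.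
have e : (env s2 x + 1 %% 2 ^ w) %% 2 ^ w = i.+1.
  by rewrite modnDmr x2 modn_small; lia.
by rewrite e; split=> //; rewrite /= /upd eqxx.
Qed.

(** * Simulating a RAM program *)

Lemma land_ones x w : Nat.land x (Nat.ones w) = x %% 2 ^ w.
Proof.
have -> : 2 ^ w = Nat.pow 2 w by elim: w => //= w IH; rewrite expnS IH; lia.
have p0 : Nat.pow 2 w <> 0 by apply: Nat.pow_nonzero.
rewrite Nat.land_ones [in RHS](Nat.div_mod x _ p0).
have /ssrnat.ltP lt := Nat.mod_upper_bound x _ p0.
by rewrite multE plusE mulnC modnMDl modn_small.
Qed.

Lemma land_small x w : x < 2 ^ w -> Nat.land x (Nat.ones w) = x.
Proof. by move=> lt; rewrite land_ones modn_small. Qed.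

Lemma ltn_exp2_land x w : Nat.land x (Nat.ones w) = x -> x < 2 ^ w.
Proof. by rewrite land_ones => <-; rewrite ltn_mod expn_gt0. Qed.

(** Being below 2 ^ w amounts to being fixed by the mask [Nat.ones w], which reduces the bitwise
    operations to Boolean identities. *)
Lemma eval_op_lt w o x y : x < 2 ^ w -> y < 2 ^ w -> eval_op w o x y < 2 ^ w.
Proof.
move=> lx ly; have e0 : 0 < 2 ^ w by rewrite expn_gt0.
case: o => /=; rewrite ?ltn_mod //.
- exact: leq_ltn_trans (leq_div _ _) lx.
- exact: leq_ltn_trans (leq_mod _ _) lx.
- by apply: ltn_exp2_land; rewrite -Nat.land_assoc land_small.
- by apply: ltn_exp2_land; rewrite Nat.land_lor_distr_l !land_small.
- apply: ltn_exp2_land; apply: Nat.bits_inj => i.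
  rewrite -{2}(land_small lx) -{2}(land_small ly) !(Nat.land_spec, Nat.lxor_spec).
  by do 3!case: (Nat.testbit _ _).
- exact: leq_ltn_trans (leq_div _ _) lx.
Qed.

(** Since 2 ^ w divides 2 ^ W, sums, products and left shifts may be reduced twice, and the 2 ^ W
    added in a subtraction is congruent to 2 ^ w. The other operations give the same small value at
    both widths. *)
Lemma eval_op_mod w W o x y : w <= W -> x < 2 ^ w -> y < 2 ^ w ->
  eval_op W o x y %% 2 ^ w = eval_op w o x y.
Proof.
move=> le_wW lx ly; have dvd : 2 ^ w %| 2 ^ W by apply: dvdn_exp2l.
have := eval_op_lt o lx ly; case: o => /= lt; rewrite ?(modn_dvdm _ dvd) //;
  try exact: modn_small.
have [k E] := dvdnP dvd; rewrite E; have : 0 < k by case: k E lx {lt} => // /eqP; rewrite expn_eq0.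
case: k {E} => // k _; rewrite mulSn.
have -> : x + (2 ^ w + k * 2 ^ w - y) = k * 2 ^ w + (x + (2 ^ w - y)) by lia.
by rewrite modnMDl.
Qed.

(* Variables below 20 belong to the simulating program: 3 holds 2 ^ w, 4 the  *)
(* base of the simulated memory, 5 the simulated program counter, 6 and 7 the *)
(* address and the value of a simulated read.                                 *)
HB.lock Definition vreg (r : nat) : nat := 20 + r.

Lemma upd_eq f a v : upd f a v a = v.
Proof. by rewrite /upd eqxx. Qed.

Lemma upd_vreg f r v x : x < 20 -> upd f (vreg r) v x = f x.
Proof. by rewrite /upd vreg.unlock; case: eqP => //; lia. Qed.

Lemma upd_low f r v x : x < 20 -> upd f x v (vreg r) = f (vreg r).
Proof. by rewrite /upd vreg.unlock; case: eqP => //; lia. Qed.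

Lemma upd_vreg2 f r v r' : upd f (vreg r) v (vreg r') = if r' == r then v else f (vreg r').
Proof. by rewrite /upd vreg.unlock eqn_add2l. Qed.

Section Simulation.

Variables (w W : nat) (P : program) (oracle : cmd) (input : nat -> nat).
Variables (B lim : nat) (env0 mem0 : nat -> nat).

(* A written cell a holds its value plus one at address B + a; the content of *)
(* an unwritten one is left to the oracle.                                    *)
Definition fetch : cmd :=
  Seq (Asg 7 (Deref (Bin Opadd (Var 4) (Var 6))))
      (IfEq (Var 7) (Cst 0)
        (Seq oracle (Asg 7 (Bin Opmod (Var 7) (Var 3))))
        (Asg 7 (Bin Opsub (Var 7) (Cst 1)))).

Definition advance : cmd := Asg 5 (Bin Opadd (Var 5) (Cst 1)).

(** Every target from [size P] on means halting; clamping it there makes the constant fit into a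
    word. *)
Definition jump (l : nat) : cmd := Asg 5 (Cst (minn l (size P))).

Definition simulate_instr (i : instr) : cmd :=
  match i with
  | Const a c => Seq (Asg (vreg a) (Bin Opmod (Cst c) (Var 3))) advance
  | Op o a b c =>
      Seq (Asg (vreg a) (Bin Opmod (Bin o (Var (vreg b)) (Var (vreg c))) (Var 3)))
          advance
  | Read a b =>
      Seq (Asg 6 (Var (vreg b))) (Seq fetch (Seq (Asg (vreg a) (Var 7)) advance))
  | Write a b =>
      Seq (Sto (Bin Opadd (Var 4) (Var (vreg a)))
               (Bin Opadd (Var (vreg b)) (Cst 1))) advance
  | Rand a =>
      Seq (Rnd (vreg a))
          (Seq (Asg (vreg a) (Bin Opmod (Var (vreg a)) (Var 3))) advance)
  | Jlt a b l => IfLt (Var (vreg a)) (Var (vreg b)) (jump l) advance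
  | Jeq a b l => IfEq (Var (vreg a)) (Var (vreg b)) (jump l) advance
  end.

(** The simulated program is fixed, so a linear chain of tests on its counter costs only a constant
    per step. *)
Fixpoint dispatch (j : nat) (Q : program) : cmd :=
  if Q is i :: Q' then
    IfEq (Var 5) (Cst j) (simulate_instr i) (dispatch j.+1 Q')
  else Skip.

Definition simulator : cmd := While (Var 5) (Cst (size P)) (dispatch 0 P).

Definition framed (s : config) : Prop :=
  (forall x, x < 20 -> x \notin [:: 5; 6; 7] -> env s x = env0 x) /\
  (forall a, a < B -> heap s a = mem0 a).

Definition cell (m : nat -> nat) (a : nat) : nat :=
  if m (B + a) == 0 then input a else (m (B + a)).-1.

(** Memory is compared below [lim] only, which covers every w-bit address once 2 ^ w <= lim. For a
    coin-free program the coins are not compared, since the simulating program may have coins of its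
    own left. *)
Record simulates (q : state) (s : config) : Prop := Simulates {
  sim_pc : env s 5 = minn (pc q) (size P);
  sim_reg : forall r, env s (vreg r) = reg q r;
  sim_mem : forall a, a < lim -> cell (heap s) a = memory q a;
  sim_rnd : coin_free P \/ coins q = [seq x %% 2 ^ w | x <- rnd s];
  sim_wreg : forall r, reg q r < 2 ^ w;
  sim_wmem : forall a, memory q a < 2 ^ w;
  sim_frame : framed s
}.

Hypotheses (lt_wW : w < W) (le_limW : B + lim <= 2 ^ W).
Hypotheses (env0_3 : env0 3 = 2 ^ w) (env0_4 : env0 4 = B).
Hypothesis oracleP : forall s, framed s -> env s 6 < lim ->
  let s' := effect W oracle s in
  [/\ env s' 7 %% 2 ^ w = input (env s 6), forall x, x != 7 -> env s' x = env s x,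
      heap s' = heap s & rnd s' = rnd s].

Lemma fetchP s : framed s -> env s 6 < lim -> (forall a, a < lim -> heap s (B + a) <= 2 ^ w) ->
  let s' := effect W fetch s in
  [/\ env s' 7 = cell (heap s) (env s 6), forall x, x != 7 -> env s' x = env s x,
      heap s' = heap s & rnd s' = rnd s].
Proof.
move=> fr lt6 small /=; have [fe fm] := fr.
have e3 : env s 3 = 2 ^ w by rewrite fe.
have e4 : env s 4 = B by rewrite fe.
have m4 : (env s 4 + env s 6) %% 2 ^ W = B + env s 6.
  by rewrite e4 modn_small //; lia.
set s1 := assign s 7 _.
have fr1 : framed s1.
  split=> // x lx nx; rewrite /= /upd; case: eqP nx => [->//|_]; exact: fe.
rewrite m4 mod0n /upd /= /cell.
have pW := expn_gt0 2 W; have wW : 2 ^ w < 2 ^ W by rewrite ltn_exp2l.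
case: ifPn => nz.
  have [|o7 ox om orr] := oracleP fr1; first by rewrite /=.
  have e3' : env (effect W oracle s1) 3 = 2 ^ w by rewrite ox.
  split=> /=; rewrite ?om ?orr //; first by rewrite /upd /= e3' o7.
  by move=> x nx; rewrite /upd (negbTE nx) ox // /= /upd (negbTE nx).
split=> //=; last by move=> x nx; rewrite /s1 /= /upd (negbTE nx).
have h := small _ lt6.
rewrite /upd /= (modn_small (_ : 1 < 2 ^ W)); last first.
  by have := ltn_exp2l 0 W (isT : 1 < 2); rewrite expn0; lia.
have -> : heap s (B + env s 6) + (2 ^ W - 1) = 2 ^ W + (heap s (B + env s 6)).-1 by lia.
by rewrite modnDl modn_small //; lia.
Qed.

Hypotheses (le_wlim : 2 ^ w <= lim) (lt_PW : size P < 2 ^ W).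
Hypothesis oracle_loop_free : loop_free oracle.

Lemma dispatchP s i : env s 5 < size P ->
  effect W (dispatch 0 P) s = effect W (simulate_instr (nth i P (env s 5))) s.
Proof.
suff main Q j : j + size Q <= size P -> j <= env s 5 < j + size Q ->
    effect W (dispatch j Q) s = effect W (simulate_instr (nth i Q (env s 5 - j))) s.
  by move=> lt; rewrite (main P 0) ?subn0 ?leq0n.
elim: Q j => [|i' Q IH] j /=; first by lia.
move=> le_j /andP[le lt]; rewrite (modn_small (_ : j < 2 ^ W)); last lia.
case: eqP => [<-|ne]; first by rewrite subnn.
rewrite IH; [|lia|lia].
by have -> : env s 5 - j = (env s 5 - j.+1).+1 by lia.
Qed.

Lemma loop_free_dispatch j Q : loop_free (dispatch j Q).
Proof.
by elim: Q j => //= i Q IH j; rewrite IH andbT; case: i => //= *; rewrite oracle_loop_free.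
Qed.

Lemma expW_gt1 : 1 < 2 ^ W.
Proof. by have := ltn_exp2l 0 W (isT : 1 < 2); rewrite expn0; lia. Qed.

Lemma simulates_step q s : simulates q s -> ~~ halted P q ->
  simulates (step w P q) (effect W (dispatch 0 P) s).
Proof.
move=> sim; rewrite /step => /[dup] nh /negbTE ->.
rewrite /halted -ltnNge in nh; have := sim_pc sim.
rewrite (minn_idPl (ltnW nh)) => pcE.
rewrite (dispatchP (Const 0 0)) pcE //.
have := erefl (nth (Const 0 0) P (pc q)); move: {2}(nth _ _ _) => i iP; rewrite iP.
have nr a : i = Rand a -> coin_free P = false.
  move=> iR; apply/negbTE; rewrite negbK; apply/(has_nthP (Const 0 0)).
  by exists (pc q) => //; rewrite iP iR.
have W1 := expW_gt1; have wW : 2 ^ w < 2 ^ W by rewrite ltn_exp2l.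
have [fe fm] := sim_frame sim.
have e3 : env s 3 = 2 ^ w by rewrite fe.
have e4 : env s 4 = B by rewrite fe.
have dvd : 2 ^ w %| 2 ^ W by apply/dvdn_exp2l/ltnW.
have pcS : (pc q + 1 %% 2 ^ W) %% 2 ^ W = (pc q).+1.
  by rewrite (modn_small W1) addn1 modn_small //; lia.
have jumpP l : minn l (size P) %% 2 ^ W = minn l (size P).
  by rewrite modn_small //; lia.
have fr5 x v f : x \notin [:: 5; 6; 7] -> upd f 5 v x = f x :> nat.
  by rewrite !inE /upd; case: eqP.
case: sim => _ sreg smem srnd wreg wmem _.
case: q nh pcE iP pcS sreg smem srnd wreg wmem => pq rq mq uq /= nh pcE iP pcS sreg smem srnd wreg wmem.
have upd_words f a v : v < 2 ^ w -> (forall r, f r < 2 ^ w) -> forall r, upd f a v r < 2 ^ w.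
  by move=> lv lf r; rewrite /upd; case: eqP.
have pc1 : pq.+1 = minn pq.+1 (size P) by apply/esym/minn_idPl.
have mod_lt x : x %% 2 ^ w < 2 ^ w by rewrite ltn_mod expn_gt0.
have l5 f v r : upd f 5 v (vreg r) = f (vreg r) by apply: upd_low.
have ne7 r : vreg r != 7 by rewrite vreg.unlock.
have l6 f v r : upd f 6 v (vreg r) = f (vreg r) by apply: upd_low.
case: i iP nr => [a c|o a b c|a b|a b|a|a b l|a b l] iP nr /=.
- split=> //=.
  + by rewrite ?upd_eq upd_vreg // pcE pcS.
  + move=> r; rewrite l5 upd_vreg2 e3 (modn_dvdm _ dvd) /upd.
    by case: eqP.
  + exact: upd_words.
  + by split=> // x lx nx; rewrite /= fr5 // upd_vreg // fe.
- split=> //=.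
  + by rewrite ?upd_eq upd_vreg // pcE pcS.
  + move=> r; rewrite l5 upd_vreg2 e3 !sreg (eval_op_mod _ (ltnW lt_wW)) // /upd.
  + by apply: upd_words => //; apply: eval_op_lt.
  + by split=> // x lx nx; rewrite /= fr5 // upd_vreg // fe.
- set s1 := assign s 6 _.
  have fr1 : framed s1.
    by split=> // x lx nx; rewrite /= /upd; case: eqP nx => [->//|_]; exact: fe.
  have e5 : env s1 5 = pq by rewrite /s1 /= /upd /=.
  have e6 : env s1 6 = rq b by rewrite /s1 /= ?upd_eq sreg.
  have lt6 : env s1 6 < lim by rewrite e6; apply: leq_trans (wreg _) _.
  have small a' : a' < lim -> heap s1 (B + a') <= 2 ^ w.
    move=> la; have := wmem a'; rewrite -smem // /cell.
    by case: eqP => [E|_]; rewrite /s1 /= ?E; lia.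
  have [f7 fx fh fu] := fetchP fr1 lt6 small.
  move: f7 fx fh fu; set s2 := effect W fetch s1.
  rewrite e6 smem; last by rewrite -e6.
  move=> f7 fx fh fu; split=> //=.
  + by rewrite ?upd_eq upd_vreg // fx // e5 pcS.
  + move=> r; rewrite l5 upd_vreg2 f7 /upd; case: eqP => // _.
    by rewrite fx ?ne7 // /s1 /= l6 sreg.
  + by rewrite fh.
  + by rewrite fu.
  + exact: upd_words.
  + split=> [x lx nx|x lx]; last by rewrite fh fm.
    rewrite /= fr5 // upd_vreg // fx; last by apply: contra nx => /eqP->.
    by case: fr1 => ->.
- have pcS1 : (pq + 1) %% 2 ^ W = pq.+1 by rewrite -[in RHS]pcS (modn_small W1).
  rewrite e4 !sreg (modn_small W1).
  have lta := leq_trans (wreg a) le_wlim.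
  rewrite (modn_small (_ : B + rq a < 2 ^ W)); last lia.
  have ltb := wreg b.
  rewrite (modn_small (_ : rq b + 1 < 2 ^ W)); last lia.
  split=> //=.
  + by rewrite ?upd_eq pcE pcS1.
  + by move=> r; rewrite upd_low.
  + move=> a' la; rewrite /cell /upd eqn_add2l; case: (a' == rq a).
      by rewrite addn1.
    exact: smem.
  + exact: upd_words.
  + split=> [x lx nx|x lx]; first by rewrite /= fr5 // fe.
    by rewrite /= /upd; case: eqP => [|_]; [lia | rewrite fm].
- have {}srnd : uq = [seq x %% 2 ^ w | x <- rnd s].
    by case: srnd => //; rewrite (nr a).
  have hE : head 0 uq = head 0 (rnd s) %% 2 ^ w.
    by rewrite srnd; case: (rnd s) => //=; rewrite mod0n.
  have hlt : head 0 uq < 2 ^ w by rewrite hE.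
  split=> //=.
  + by rewrite ?upd_eq !upd_vreg // pcE pcS.
  + move=> r; rewrite l5 upd_vreg2 upd_eq upd_vreg // e3 -hE upd_vreg2 sreg /upd.
    by case: (r == a).
  + by right; rewrite srnd behead_map.
  + exact: upd_words.
  + by split=> // x lx nx; rewrite /= fr5 // !upd_vreg // fe.
- rewrite !sreg; case: ifP => _; split=> //=; rewrite ?upd_eq ?jumpP ?pcE ?pcS //;
    try (by move=> r; rewrite upd_low);
    by split=> // x lx nx; rewrite /= fr5 // fe.
- rewrite !sreg; case: ifP => _; split=> //=; rewrite ?upd_eq ?jumpP ?pcE ?pcS //;
    try (by move=> r; rewrite upd_low);
    by split=> // x lx nx; rewrite /= fr5 // fe.
Qed.

Lemma simulatorP q s T : simulates q s -> halted P (iter T (step w P) q) ->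
  tot W simulator s (T * (size_cmd (dispatch 0 P) + 4) + 4)
    (simulates (iter T (step w P) q)).
Proof.
move=> sim hT; have ex : exists t, halted P (iter t (step w P) q) by exists T.
(* The simulating loop stops at the first halting time, which may come before [T]. *)
case: (ex_minnP ex) => t ht min_t; have le_tT := min_t _ hT.
have -> : iter T (step w P) q = iter t (step w P) q.
  by rewrite -(subnKC le_tT) iter_plus halted_iter.
pose I i := simulates (iter i (step w P) q).
apply: (@tot_weaken W simulator s
  (t * (1 + 1 + size_cmd (dispatch 0 P) + 2) + (1 + 1 + 2)) _ (I t)) => //; last first.
  by rewrite leq_add // leq_mul //; lia.
have szP : size P %% 2 ^ W = size P by rewrite modn_small.
apply: (tot_while (I := I)) => // [i s' lt_i Ii|s' It] /=; rewrite szP.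
  have nh : ~~ halted P (iter i (step w P) q).
    by apply/negP => /min_t; rewrite leqNgt lt_i.
  split; last first.
    apply: tot_effect; first exact: loop_free_dispatch.
    exact: simulates_step Ii nh.
  by rewrite (sim_pc Ii); move: nh; rewrite /halted; lia.
by rewrite (sim_pc It); move: ht; rewrite /halted; lia.
Qed.

End Simulation.

(** * The exponent is at least two *)

Lemma flat_lt n a b : a < n -> b < n -> a * n + b < n ^ 2.
Proof. by move=> la lb; rewrite expnS expn1; nia. Qed.

(** Only [Write] changes the memory, and it changes one cell. *)
Lemma nonzero_step w P s c N :
  #|[set i : 'I_N | memory (step w P s) (c + i) != 0]| <=
  #|[set i : 'I_N | memory s (c + i) != 0]|.+1.
Proof.
have [a sub] : exists a, forall x, memory (step w P s) x != 0 ->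
    x = a \/ memory s x != 0.
  rewrite /step; case: ifP => _; first by exists 0; right.
  case: s => p r m u; case: (nth _ _ _) => [? ?|? ? ? ?|? ?|x y|?|? ? ?|? ? ?] /=;
    try by exists 0; right.
  exists (r x) => z; rewrite /upd; have [->|_] := eqVneq z (r x); first by left.
  by right.
pose S := [set i : 'I_N | c + i == a].
have S1 : #|S| <= 1.
  apply/card_le1_eqP => i j; rewrite !inE => /eqP ia /eqP ja.
  by apply: val_inj; apply/eqP; rewrite -(eqn_add2l c) ia ja.
set A := [set i | memory s _ != 0].
set A' := [set i | memory (step _ _ _) _ != 0].
have /subset_leq_card : A' \subset A :|: S.
  by apply/fintype.subsetP => i; rewrite !inE => /sub[->|->]; rewrite ?eqxx ?orbT.
move/leq_trans; apply; apply: leq_trans (leq_card_setU A S).1 _.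
by rewrite -addn1 leq_add2l.
Qed.

Lemma nonzero_run w P T input u c N : size input <= c ->
  #|[set i : 'I_N | memory (run w P T input u) (c + i) != 0]| <= T.
Proof.
move=> le; rewrite /run; elim: T => [|T IH].
  rewrite leqn0 cards_eq0; apply/eqP/setP => i; rewrite !inE /=.
  by rewrite nth_default ?mod0n //; apply: leq_trans (leq_addr _ _).
exact: leq_trans (nonzero_step _ _ _ _ _) _.
Qed.

Lemma size_encode_mx w n (A : 'M[int]_n) : size (encode_mx w A) = n ^ 2.
Proof. by rewrite size_allpairs size_enum_ord expnS expn1. Qed.

Local Open Scope ring_scope.

Lemma powR_natr_unbounded (R : realType) (d C : R) : 0 < d ->
  exists2 n : nat, (0 < n)%N & C < n%:R `^ d.
Proof.
move=> d0; pose C' := Num.max C 1; pose x := C' `^ d^-1.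
exists (Num.truncn x).+1 => //.
have C'1 : 1 <= C' by rewrite le_max lexx orbT.
have C'0 : 0 <= C' by apply: le_trans C'1.
apply: (@le_lt_trans _ _ C'); first by rewrite le_max lexx.
have -> : C' = x `^ d by rewrite /x -powRrM mulVf ?lt0r_neq0 // powRr1.
rewrite gt0_ltr_powR // ?inE ?nnegrE ?powR_ge0 ?ler0n //.
exact: truncnS_gt.
Qed.

(* The product of two all-ones matrices fills n ^ 2 cells with nonzero words, *)
(* while a step changes a single cell.                                        *)
Lemma matmul_in_ge2 (R : realType) (tau : R) : matmul_in tau -> 2 <= tau.
Proof.
move=> /(_ 0%N)[P [k [C [_ mm]]]]; rewrite leNgt; apply/negP => lt2.
have d0 : 0 < 2 - tau by rewrite subr_gt0.
have [n n0 ltC] := powR_natr_unbounded C d0.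
have one_le i j : `|(const_mx 1 : 'M[int]_n) i j| <= (n ^ 0)%N%:Z.
  by rewrite mxE.
have [T leT [_ prod]] := mm n _ _ n0 one_le one_le.
suff leT2 : (n ^ 2 <= T)%N.
  have nR : (0 : R) < n%:R by rewrite ltr0n.
  have : (n ^ 2)%:R <= C * n%:R `^ tau :> R by apply: le_trans leT; rewrite ler_nat.
  apply/negP; rewrite -ltNge natrX -powR_mulrn ?ler0n //.
  rewrite -[2%:R](subrK tau) powRD ?(gt_eqF nR) ?implybT //.
  by rewrite ltr_pM2r ?powR_gt0.
set input := (X in run _ _ _ X) in prod.
have sz : (size input <= 1 + 2 * n ^ 2)%N.
  by rewrite /= size_cat !size_encode_mx; lia.
rewrite -[X in (X <= _)%N]card_ord -cardsT.
apply: leq_trans (nonzero_run (word_size k n) P T [::] (n ^ 2) sz).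
apply/subset_leq_card/fintype.subsetP => i _; rewrite inE; apply/negP => /eqP z.
have lta : (i %/ n < n)%N by rewrite ltn_divLR // -expnSr; case: (i) => //.
have ltb : (i %% n < n)%N by rewrite ltn_mod.
have := prod (Ordinal lta) (Ordinal ltb).
rewrite /= -addnA -divn_eq z /int_of_word expn_gt0 /= mxE.
under eq_bigr do rewrite !mxE mulr1.
rewrite sumr_const card_ord => /eqP.
by rewrite eq_sym -[_ *+ n]/(n%:R) pnatr_eq0; case: (n) n0.
Qed.

(** * Naive matrix multiplication *)

Local Open Scope nat_scope.

Arguments ev : simpl never.

(** Evaluation in the naturals, without wraparound. The predicate [fits] collects the conditions
    under which it agrees with [ev]; it excludes the bitwise operations, whose value here is a dummy
    0. *)
Fixpoint nev (s : config) (e : expr) : nat :=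
  match e with
  | Var x => env s x
  | Cst c => c
  | Bin Opadd a b => nev s a + nev s b
  | Bin Opsub a b => nev s a - nev s b
  | Bin Opmul a b => nev s a * nev s b
  | Bin Opdiv a b => nev s a %/ nev s b
  | Bin Opmod a b => nev s a %% nev s b
  | Bin _ _ _ => 0
  | Deref a => heap s (nev s a)
  end.

Fixpoint fits (w : nat) (s : config) (e : expr) : Prop :=
  match e with
  | Var _ => True
  | Cst c => c < 2 ^ w
  | Bin Opadd a b => [/\ fits w s a, fits w s b & nev s a + nev s b < 2 ^ w]
  | Bin Opsub a b => [/\ fits w s a, fits w s b & nev s b <= nev s a < 2 ^ w]
  | Bin Opmul a b => [/\ fits w s a, fits w s b & nev s a * nev s b < 2 ^ w]
  | Bin Opdiv a b | Bin Opmod a b => fits w s a /\ fits w s b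
  | Bin _ _ _ => False
  | Deref a => fits w s a
  end.

Lemma ev_nev w s e : fits w s e -> ev w s e = nev s e.
Proof.
elim: e => //= [c|o a IHa b IHb|a IHa].
- exact: modn_small.
- rewrite /ev -!/(ev _ _ _); case: o => //=.
  + by case=> /IHa-> /IHb-> lt; rewrite modn_small.
  + case=> /IHa-> /IHb-> /andP[le lt]; have -> : nev s a + (2 ^ w - nev s b) = 2 ^ w + (nev s a - nev s b) by lia.
    by rewrite modnDl modn_small //; lia.
  + by case=> /IHa-> /IHb-> lt; rewrite modn_small.
  + by case=> /IHa-> /IHb->.
  + by case=> /IHa-> /IHb->.
- by move/IHa; rewrite /ev -/(ev _ _ _) => ->.
Qed.

Lemma nth_allpairs (S T U : Type) (f : S -> T -> U) x0 y0 z0 s t a b :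
  a < size s -> b < size t ->
  nth z0 [seq f x y | x <- s, y <- t] (a * size t + b) = f (nth x0 s a) (nth y0 t b).
Proof.
move=> + lb; elim: s a => //= x s IH [|a] la; rewrite nth_cat size_map.
  by rewrite mul0n lb (nth_map y0).
rewrite mulSn -addnA ltnNge leq_addr /= addKn; exact: IH.
Qed.

Lemma nth_table (U : Type) n (f : 'I_n -> 'I_n -> U) z0 (i j : 'I_n) :
  nth z0 [seq f x y | x <- enum 'I_n, y <- enum 'I_n] (i * n + j) = f i j.
Proof.
have -> : i * n + j = i * size (enum 'I_n) + j by rewrite size_enum_ord.
by rewrite (nth_allpairs f i j) ?size_enum_ord // !nth_ord_enum.
Qed.

Lemma size_table (U : Type) n (f : 'I_n -> 'I_n -> U) :
  size [seq f x y | x <- enum 'I_n, y <- enum 'I_n] = n ^ 2.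
Proof. by rewrite size_allpairs size_enum_ord expnS expn1. Qed.

(** Because 2 ^ (trunc_log 2 n + 1) is at least n + 1. *)
Lemma ltn_exp_word_size n j k : j <= k -> n.+1 ^ j <= 2 ^ word_size k n.
Proof.
move=> le; rewrite /word_size mulnC expnM.
apply: (@leq_trans ((2 ^ (trunc_log 2 n).+1) ^ j)).
  by case: j {le} => // j; rewrite leq_exp2r //; apply: trunc_log_ltn.
by rewrite leq_pexp2l // expn_gt0.
Qed.

(** Variables 1 and 12 hold n and n * n, variable 9 the row-major position of the entry, 10 the
    summation index and 11 the accumulator. *)
Definition naive_dot : cmd :=
  Asg 11 (Bin Opadd (Var 11)
    (Bin Opmul
      (Deref (Bin Opadd (Bin Opadd (Cst 1) (Bin Opmul (Bin Opdiv (Var 9) (Var 1)) (Var 1)))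
                      (Var 10)))
      (Deref (Bin Opadd (Bin Opadd (Bin Opadd (Cst 1) (Var 12)) (Bin Opmul (Var 10) (Var 1)))
                      (Bin Opmod (Var 9) (Var 1)))))).

Definition naive_entry : cmd :=
  Seq (Asg 11 (Cst 0))
 (Seq (For 10 1 naive_dot)
      (Sto (Bin Opadd (Bin Opadd (Cst 1) (Bin Opmul (Cst 2) (Var 12))) (Var 9)) (Var 11))).

Definition naive_matmul : cmd :=
  Seq (Asg 1 (Deref (Cst 0)))
 (Seq (Asg 12 (Bin Opmul (Var 1) (Var 1)))
      (For 9 12 naive_entry)).

Definition dot (m : nat -> nat) n k q : nat :=
  \sum_(j < k) m (1 + q %/ n * n + j) * m (1 + n * n + j * n + q %% n).

Lemma ev_bin w s o a b : ev w s (Bin o a b) = eval_op w o (ev w s a) (ev w s b).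
Proof. by []. Qed.

(** The left-hand side is the difference of two consecutive cubes; it bounds all addresses in
    use. *)
Lemma cube_bound n w : n.+1 ^ 3 <= 2 ^ w -> 0 < n -> 3 * (n * n) + 3 * n + 1 < 2 ^ w.
Proof. by rewrite !expnS expn0 => big n0; nia. Qed.

Lemma naive_dotP w n q k s : 0 < n -> n.+1 ^ 3 <= 2 ^ w -> q < n * n -> k < n ->
  env s 1 = n -> env s 12 = n * n -> env s 9 = q -> env s 10 = k ->
  effect w naive_dot s =
  assign s 11 ((env s 11 + heap s (1 + q %/ n * n + k) *
     heap s (1 + n * n + k * n + q %% n)) %% 2 ^ w).
Proof.
move=> n0 big lq lk e1 e12 e9 e10 /=; congr assign.
have l1 : q %/ n < n by rewrite ltn_divLR.
have l2 : q %% n < n by rewrite ltn_mod.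
have h1 : q %/ n * n + n <= n * n by rewrite addnC -mulSn leq_mul2r l1 orbT.
have h2 : k * n + n <= n * n by rewrite addnC -mulSn leq_mul2r lk orbT.
have h3 := cube_bound big n0.
(* The outer sum and product may wrap around; only the addresses must not. *)
do 2!rewrite ev_bin; rewrite !ev_nev /= ?e1 ?e9 ?e10 ?e12 ?modnDmr //.
  by repeat split; nia.
by repeat split; nia.
Qed.

Lemma naive_entryP w n m q s : 0 < n -> n.+1 ^ 3 <= 2 ^ w -> q < n * n ->
  env s 1 = n -> env s 12 = n * n -> env s 9 = q ->
  (forall a, a < 1 + 2 * (n * n) -> heap s a = m a) ->
  tot w naive_entry s (n * 60 + 60) (fun s' =>
   [/\ env s' 1 = n, env s' 12 = n * n, env s' 9 = q &
      heap s' = upd (heap s) (1 + 2 * (n * n) + q) (dot m n n q %% 2 ^ w)]).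
Proof.
move=> n0 big lq e1 e12 e9 hm; have h3 := cube_bound big n0.
pose I k s' := [/\ env s' 1 = n, env s' 12 = n * n, env s' 9 = q,
   heap s' = heap s & env s' 11 = dot m n k q %% 2 ^ w].
apply: (@tot_leq _ _ _ (2 + (n * (size_cmd naive_dot + 8) + 6 + 9))); last by rewrite /=; lia.
apply: (tot_seq (mid := I 0)).
  by apply: tot_effect => //; split=> //=; rewrite /dot big_ord0.
move=> s0 I0; apply: (tot_seq (mid := I n)).
  apply: (@tot_weaken _ _ _ _ _ (fun s1 => I n s1 /\ env s1 10 = n) _ _ (leqnn _));
    last by move=> s1 [].
  apply: tot_for => //; [by lia|by case: I0|].
  move=> k s1 lk [f1 f12 f9 fh f11] f10 _.
  apply: tot_effect => //; rewrite (naive_dotP n0 big lq lk) //.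
  split=> //=; split=> //=; rewrite /upd /= f11 modnDml /dot big_ord_recr /= fh.
  by rewrite !hm //; nia.
move=> s1 [f1 f12 f9 fh f11]; apply: tot_effect => //=.
rewrite !ev_nev //= ?f9 ?f12; last by repeat split; nia.
by rewrite fh f11.
Qed.


Lemma naive_matmulP w n m u : 0 < n -> n.+1 ^ 3 <= 2 ^ w -> m 0 = n ->
  tot w naive_matmul (initial m u) (200 * n ^ 3) (fun s => forall q, q < n * n ->
    heap s (1 + 2 * (n * n) + q) = dot m n n q %% 2 ^ w).
Proof.
move=> n0 big m0; have h3 := cube_bound big n0.
pose I q s := [/\ env s 1 = n, env s 12 = n * n,
   forall a, a < 1 + 2 * (n * n) -> heap s a = m a &
   forall q', q' < q -> heap s (1 + 2 * (n * n) + q') = dot m n n q' %% 2 ^ w].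
apply: (@tot_leq _ _ _ (3 + (4 + (n * n * ((n * 60 + 60) + 8) + 6)))); last first.
  by rewrite !expnS expn0; nia.
apply: (tot_seq (mid := fun s => env s 1 = n /\ heap s = m)).
  by apply: tot_effect => //=; split=> //=; rewrite /upd /= ev_nev /= ?m0 ?expn_gt0.
move=> s1 [e1 hm].
apply: (tot_seq (mid := fun s => [/\ env s 1 = n, env s 12 = n * n & heap s = m])).
  apply: tot_effect => //=; split=> //=; rewrite /upd /= ev_nev //= e1 //.
  by split=> //; nia.
move=> s2 [f1 f12 fh].
apply: (@tot_weaken _ _ _ _ _ (fun s1 => I (n * n) s1 /\ env s1 9 = n * n) _ _ (leqnn _));
    last by move=> s3 [[]].
apply: tot_for => //; [by nia|by split=> //= a _; rewrite fh|].
move=> q s3 lq [g1 g12 ga gq] g9 _.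
apply: (tot_weaken (naive_entryP n0 big lq g1 g12 g9 ga)) => // s4 [k1 k12 k9 kh].
split=> //; split=> //= a; rewrite kh /upd.
  by move=> la; case: eqP => [|_]; [lia | exact: ga].
by move=> la; case: eqP => [|ne]; [move/eqP; rewrite eqn_add2l => /eqP-> | apply: gq; lia].
Qed.

(** * Two's complement and the cubic algorithm *)

Local Open Scope ring_scope.

(** The size bounds leave 0 and 2 ^ w as the only possible differences of [x] and [z], and the top
    bit of [x] tells which one occurs. *)
Lemma int_of_wordE w (x : nat) (z : int) : (0 < w)%N -> (x < 2 ^ w)%N ->
  ((2 ^ w)%N%:Z %| x%:Z - z)%Z -> `|z| < (2 ^ w.-1)%N%:Z -> int_of_word w x = z.
Proof.
case: w => // w _; rewrite /int_of_word /= expnS => lx /dvdzP[q E] lz.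
have p0 := expn_gt0 2 w.
move: (2 ^ w)%N lx E lz p0 => N lx E lz p0.
case: ltnP => lt.
  have : q = 0 by nia.
  by nia.
have : q = 1 by nia.
by nia.
Qed.

Lemma word_of_int_mod w z : (word_of_int w z)%:Z = (z %% (2 ^ w)%N%:Z)%Z.
Proof.
by rewrite /word_of_int gez0_abs // modz_ge0 // -lt0n expn_gt0.
Qed.

Lemma word_of_int_lt w z : (word_of_int w z < 2 ^ w)%N.
Proof. by rewrite -ltz_nat word_of_int_mod ltz_pmod // ltz_nat expn_gt0. Qed.

Lemma dvdz_word_of_int w z : ((2 ^ w)%N%:Z %| (word_of_int w z)%:Z - z)%Z.
Proof. by rewrite word_of_int_mod -eqz_mod_dvd modz_mod. Qed.

Lemma word_of_nat w (x : nat) : word_of_int w x%:Z = (x %% 2 ^ w)%N.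
Proof. by apply/eqP; rewrite -eqz_nat word_of_int_mod modz_nat. Qed.

Section MatrixInput.
Variables (w n : nat) (A B : 'M[int]_n).
Let input := n :: encode_mx w A ++ encode_mx w B.

Lemma nth_input_left (i k : 'I_n) :
  nth 0%N input (1 + i * n + k) = word_of_int w (A i k).
Proof.
rewrite -addnA add1n /= nth_cat size_table flat_lt ?ltn_ord //.
exact: nth_table.
Qed.

Lemma nth_input_right (k j : 'I_n) :
  nth 0%N input (1 + n * n + k * n + j) = word_of_int w (B k j).
Proof.
rewrite -!addnA add1n /= nth_cat size_table expnS expn1 ltnNge leq_addr /= addKn.
exact: nth_table.
Qed.

Lemma nth_input_over a : (1 + 2 * n ^ 2 <= a)%N -> nth 0%N input a = 0%N.
Proof. by move=> le; rewrite nth_default //= size_cat !size_table; lia. Qed.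

End MatrixInput.

(** Two's complement respects sums and products modulo 2 ^ w, so signs need no separate
    treatment. *)
Lemma dot_mulmx w n (A B : 'M[int]_n) (m : nat -> nat) (i j : 'I_n) :
  (forall a, m a = nth 0%N (n :: encode_mx w A ++ encode_mx w B) a %% 2 ^ w)%N ->
  ((2 ^ w)%N%:Z %| (dot m n n (i * n + j))%:Z - (A *m B) i j)%Z.
Proof.
move=> mE; have n0 : (0 < n)%N by apply: leq_ltn_trans (ltn_ord i).
have [q r] : ((i * n + j) %/ n = i /\ (i * n + j) %% n = j)%N.
  by rewrite divnMDl // divn_small // addn0 modnMDl modn_small.
rewrite /dot q r mxE -natz natr_sum -sumrB; apply: (big_ind (fun z => (_ %| z)%Z)) => [|x y|k _]; first exact: dvdz0.
  exact: rpredD.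
rewrite natz !mE nth_input_left nth_input_right !modn_small ?word_of_int_lt //.
have /dvdzP[a Ea] := dvdz_word_of_int w (A i k).
have /dvdzP[b Eb] := dvdz_word_of_int w (B k j).
apply/dvdzP; exists (a * (word_of_int w (B k j))%:Z + A i k * b).
rewrite PoszM; move: Ea Eb; move: (word_of_int w (A i k))%:Z (word_of_int w (B k j))%:Z => x y.
move=> Ea Eb.
have -> : x * y - A i k * B k j = (x - A i k) * y + A i k * (y - B k j) by ring.
by rewrite Ea Eb; ring.
Qed.

Lemma norm_mulmx_le n e (A B : 'M[int]_n) :
  (forall i j, `|A i j| <= (n ^ e)%N%:Z) -> (forall i j, `|B i j| <= (n ^ e)%N%:Z) ->
  forall i j, `|(A *m B) i j| <= (n ^ (2 * e + 1))%N%:Z.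
Proof.
move=> lA lB i j; rewrite mxE; apply: le_trans (ler_norm_sum _ _ _) _.
apply: (@le_trans _ _ (\sum_(k < n) (n ^ e * n ^ e)%N%:Z)).
  by apply: ler_sum => k _; rewrite normrM PoszM ler_pM.
rewrite sumr_const card_ord -mulr_natr natz -PoszM lez_nat.
by rewrite addn1 expnS mul2n -addnn expnD mulnC.
Qed.

Lemma matmul_in3 (R : realType) : matmul_in (3%:R : R).
Proof.
(* A word must hold an entry of size up to n ^ (2 * e + 1) together with its sign, and addresses up
   to (n + 1) ^ 3. *)
move=> e; exists (comp 0 naive_matmul), (2 * e + 6)%N, 200%:R.
split; first by rewrite coin_free_comp.
move=> n A B n0 lA lB; exists (200 * n ^ 3)%N.
  by rewrite powR_mulrn ?ler0n // natrM natrX.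
move=> w s.
have big : (n.+1 ^ 3 <= 2 ^ w)%N by apply: ltn_exp_word_size; lia.
have h3 := cube_bound big n0.
pose input := n :: encode_mx w A ++ encode_mx w B.
have m0 : (nth 0 input 0 %% 2 ^ w = n)%N by rewrite modn_small //=; lia.
have [ht [s' [prod _ memE]]] := tot_run (@naive_matmulP w n
  (fun a => nth 0 input a %% 2 ^ w)%N [::] n0 big m0) (leqnn _).
split=> // i j.
rewrite memE; have lq : (i * n + j < n * n)%N by rewrite mulnn flat_lt.
have -> : (1 + 2 * n ^ 2 + i * n + j = 1 + 2 * (n * n) + (i * n + j))%N.
  by rewrite -mulnn !addnA.
apply: int_of_wordE; rewrite ?prod ?ltn_mod ?expn_gt0 //.
- by rewrite /w /word_size; lia.
- have := @dot_mulmx w n A B (fun a => nth 0%N input a %% 2 ^ w)%N i j (fun a => erefl) => /dvdzP[a Ea].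
  rewrite {1}(divn_eq (dot _ n n (i * n + j)) (2 ^ w)) in Ea.
  apply/dvdzP; exists (a - (dot (fun a => nth 0%N input a %% 2 ^ w)%N n n (i * n + j)
                            %/ 2 ^ w)%N%:Z).
  by rewrite mulrBl -Ea PoszD PoszM; ring.
apply: le_lt_trans (norm_mulmx_le lA lB i j) _; rewrite ltz_nat.
have big2 := ltn_exp_word_size n (leqnn (2 * e + 5)).
apply: (@leq_trans (2 ^ word_size (2 * e + 5) n)%N); last first.
  by rewrite leq_pexp2l // /w /word_size; nia.
apply: leq_trans big2; apply: (@leq_ltn_trans (n ^ (2 * e + 5))%N).
  by rewrite leq_pexp2l //; lia.
by rewrite ltn_exp2r //; lia.
Qed.

(** This makes [omega] a genuine infimum: the cubic algorithm shows that the set is inhabited, the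
    size of the output bounds it from below. *)
Lemma has_inf_matmul_in (R : realType) : has_inf [set tau : R | matmul_in tau]%classic.
Proof.
split; first by exists 3%:R; exact: matmul_in3.
by exists 2 => tau /matmul_in_ge2.
Qed.

Lemma omega_ge2 (R : realType) : 2 <= omega R.
Proof.
apply: lb_le_inf; first by exists 3%:R; exact: matmul_in3.
by move=> tau /matmul_in_ge2.
Qed.

(** * Powers of two *)

Local Open Scope nat_scope.

(** No instruction yields a word size, so 2 ^ w is computed as the k-th power of the power of two
    found here ([exp2_word_size]). *)
Definition next_pow2 (x : nat) : cmd :=
  Seq (Asg 2 (Cst 1))
      (While (Var 2) (Bin Opadd (Var x) (Cst 1)) (Asg 2 (Bin Opmul (Cst 2) (Var 2)))).

Definition modifies_only (x : nat) (s s' : config) : Prop :=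
  [/\ forall y, y != x -> env s' y = env s y, heap s' = heap s & rnd s' = rnd s].

Lemma modifies_only_assign x s v : modifies_only x s (assign s x v).
Proof. by split=> // y /negbTE ne; rewrite /= /upd ne. Qed.

Lemma modifies_only_trans x s1 s2 s3 :
  modifies_only x s1 s2 -> modifies_only x s2 s3 -> modifies_only x s1 s3.
Proof.
move=> [e1 h1 r1] [e2 h2 r2]; split=> [y ne||]; [by rewrite e2 ?e1 | by rewrite h2 | by rewrite r2].
Qed.

Lemma next_pow2P w x N s : x != 2 -> env s x = N -> 0 < N ->
  2 ^ (trunc_log 2 N).+1 < 2 ^ w ->
  tot w (next_pow2 x) s (N * 10 + 10) (fun s' =>
    env s' 2 = 2 ^ (trunc_log 2 N).+1 /\ modifies_only 2 s s').
Proof.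
move=> nx ex N0 big; set L := trunc_log 2 N in big *.
have logP : 2 ^ L <= N by apply: trunc_logP.
have ltN : N < 2 ^ L.+1 by apply: trunc_log_ltn.
(* The loop makes only L + 1 rounds; bounding them by N is crude but sufficient. *)
have leLN : L < N by apply: leq_trans logP; apply: ltn_expl.
pose I i s' := env s' 2 = 2 ^ i /\ modifies_only 2 s s'.
have w1 : 2 < 2 ^ w by move: big; rewrite expnS; have := expn_gt0 2 L; lia.
apply: (@tot_leq _ _ _ (2 + (L.+1 * (1 + 3 + 4 + 2) + (1 + 3 + 2)))); last lia.
apply: (tot_seq (mid := I 0)).
  apply: tot_effect => //=; rewrite ev_nev /= ?expn0; last lia.
  by split; [rewrite /= /upd | exact: modifies_only_assign].
move=> s0 I0; apply: (tot_while (I := I)) => // [i s' lt_i [e2 mo]|s' [e2 [mo _ _]]].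
- have le_i : 2 ^ i <= 2 ^ L by rewrite leq_exp2l //.
  have ex' : env s' x = N by case: mo => ->.
  split.
    by rewrite !ev_nev //= ?e2 ex'; [lia | split=> //; lia].
  apply: tot_effect => //=.
  rewrite ev_nev /= e2.
    split; first by rewrite /= /upd expnS.
    exact: modifies_only_trans mo (modifies_only_assign _ _ _).
  by split=> //; rewrite -expnS; apply: leq_ltn_trans big; rewrite leq_exp2l.
- by rewrite !ev_nev //= ?e2 mo // ex; [lia | split=> //; lia].
Qed.

Fixpoint power (y k : nat) : cmd :=
  if k is k'.+1 then Seq (power y k') (Asg y (Bin Opmul (Var y) (Var 2)))
  else Asg y (Cst 1).

Lemma loop_free_power y k : loop_free (power y k).
Proof. by elim: k => //= k ->. Qed.

Lemma powerP w y k p s : y != 2 -> env s 2 = p -> 1 < p -> p ^ k < 2 ^ w ->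
  let s' := effect w (power y k) s in
  env s' y = p ^ k /\ modifies_only y s s'.
Proof.
move=> ny e2 p1; elim: k => [|k IH] big /=.
  split; last exact: modifies_only_assign.
  by rewrite /= /upd eqxx ev_nev.
have [|ek mo] := IH; first by apply: leq_ltn_trans big; rewrite leq_pexp2l // ltnW.
split; last exact: modifies_only_trans mo (modifies_only_assign _ _ _).
rewrite /= upd_eq ev_nev /= ek; case: (mo) => -> //; rewrite ?e2 ?expnSr //; try lia.
by rewrite -expnSr.
Qed.

(** * From triangles to distributivity *)

Section TriangleGadget.
Variables (n : nat) (G : sgraph n).

Definition adjacent (x y : nat) : bool :=
  if (insub x : option 'I_n, insub y : option 'I_n) is (Some i, Some j)
  then adj G i j else false.

(* Vertices are 0 ... n - 1; n is absorbing and n + 1 witnesses an edge. The  *)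
(* left-hand side of the law is always n, while the right-hand side is n + 1  *)
(* exactly on the triangles.                                                  *)
Definition gadget : bimagma n.+2 :=
  Bimagma (fun x y => if adjacent x y then ord_max else inord n)
          (fun x y => if adjacent x y then y else inord n).

Lemma adjacent_lt x y : adjacent x y -> x < n /\ y < n.
Proof. by rewrite /adjacent; case: insubP => // i -> _; case: insubP => // j ->. Qed.

Lemma adjacentE (i j : 'I_n) : adjacent i j = adj G i j.
Proof.
rewrite /adjacent; case: insubP => [i' _ /val_inj->|]; last by rewrite ltn_ord.
by case: insubP => [j' _ /val_inj->|]; last by rewrite ltn_ord.
Qed.

Lemma adjacent_over x y : n <= y -> adjacent x y = false.
Proof. by move=> le; apply/negP => /adjacent_lt[_]; rewrite ltnNge le. Qed.

Lemma gadget_answer :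
  @answer distributivity _ gadget = ~~ @answer triangle_detection _ G.
Proof.
apply/idP/idP => /=.
  move/forallP=> D; apply/negP => /existsP[x /existsP[y /existsP[z /and3P[xy yz xz]]]].
  pose f (i : 'I_n) : 'I_n.+2 := inord i.
  have fE i : f i = i :> nat by rewrite inordK //; have := ltn_ord i; lia.
  have := D (f x) => /forallP/(_ (f y))/forallP/(_ (f z))/eqP /=.
  rewrite !fE !adjacentE xy xz yz /= !fE adjacentE yz adjacent_over //.
  by move/(congr1 val); rewrite /= inordK //; lia.
move=> nt; apply/forallP => a; apply/forallP => b; apply/forallP => c /=.
(* The sum of b and c is one of the two extra points, which are adjacent to nothing, so the
   left-hand side is n. *)
rewrite (adjacent_over a); last by case: ifP => _ //=; rewrite inordK.
case: ifP => // bc; case/negP: nt; move: bc.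
case: ifP => ab; last first.
  by move/adjacent_lt; rewrite inordK // ltnn; case.
case: ifP => ac; last by rewrite adjacent_over // inordK.
have [la lb] := adjacent_lt ab; have [_ lc] := adjacent_lt ac.
move=> bc; apply/existsP; exists (Ordinal la); apply/existsP; exists (Ordinal lb).
by apply/existsP; exists (Ordinal lc); rewrite -!adjacentE /= ab ac bc.
Qed.

Let N := n.+2.
(** Here q is a position in the two concatenated tables. Since N divides N * N, the column is q mod
    N in both of them. *)
Definition gadget_entry (q : nat) : nat :=
  if adjacent (q %% (N * N) %/ N) (q %% N) then
    if q < N * N then n + 1 else q %% N
  else n.

Lemma encode_gadget q :
  nth 0 (@encode distributivity _ gadget) q.+1 =
  if q < 2 * (N * N) then gadget_entry q else 0.
Proof.
have N0 : 0 < N by [].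
have main (f : 'I_N -> 'I_N -> 'I_N) r : r < N * N -> exists i j : 'I_N,
    [/\ i = r %/ N :> nat, j = r %% N :> nat & nth 0 (cayley_table f) r = f i j].
  move=> lr; have li : r %/ N < N by rewrite ltn_divLR.
  have lj : r %% N < N by rewrite ltn_mod.
  exists (Ordinal li), (Ordinal lj); split=> //.
  by rewrite {1}(divn_eq r N) (nth_table (fun a b => val (f a b)) 0 (Ordinal li) (Ordinal lj)).
rewrite /= nth_cat size_table -mulnn -/N /gadget_entry.
have [lq|le] := ltnP q (N * N).
  have -> : q < 2 * (N * N) by lia.
  have [i [j [iE jE ->]]] := main (oplus gadget) q lq.
  by rewrite (modn_small lq) -iE -jE /=; case: ifP => _ /=; rewrite ?addn1 ?inordK.
case: ltnP => lt; last by rewrite nth_default // size_table -mulnn -/N; lia.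
have lq : q - N * N < N * N by lia.
have [i [j [iE jE ->]]] := main (odot gadget) _ lq.
have qE : q = N * N + (q - N * N) by lia.
rewrite [in X in adjacent X]qE modnDl (modn_small lq) -iE.
have -> : q %% N = j by rewrite qE -modnDml modnMl jE.
by rewrite /=; case: ifP => _ //; rewrite inordK.
Qed.

End TriangleGadget.

(* The tables of the gadget are never written down, which could dominate the  *)
(* running time if omega = 2: this answers a read from the adjacency matrix.  *)
(* Variables 1, 8 and 9 hold n, n + 2 and (n + 2) ^ 2.                        *)
Definition gadget_row : expr := Bin Opdiv (Bin Opmod (Var 7) (Var 9)) (Var 8).
Definition gadget_col : expr := Bin Opmod (Var 7) (Var 8).

Definition gadget_cell : expr :=
  Deref (Bin Opadd (Bin Opadd (Cst 1) (Bin Opmul gadget_row (Var 1))) gadget_col).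

Definition gadget_lookup : cmd :=
  IfLt gadget_row (Var 1)
    (IfLt gadget_col (Var 1)
      (IfEq gadget_cell (Cst 0)
        (Asg 7 (Var 1))
        (IfLt (Var 7) (Var 9)
          (Asg 7 (Bin Opadd (Var 1) (Cst 1)))
          (Asg 7 gadget_col)))
      (Asg 7 (Var 1)))
    (Asg 7 (Var 1)).

Definition gadget_oracle : cmd :=
  IfEq (Var 6) (Cst 0) (Asg 7 (Var 8))
    (Seq (Asg 7 (Bin Opsub (Var 6) (Cst 1)))
         (IfLt (Var 7) (Bin Opmul (Cst 2) (Var 9)) gadget_lookup (Asg 7 (Cst 0)))).

Lemma effect_iflt w a b c1 c2 s : effect w (IfLt a b c1 c2) s =
  if ev w s a < ev w s b then effect w c1 s else effect w c2 s.
Proof. by []. Qed.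

Lemma effect_ifeq w a b c1 c2 s : effect w (IfEq a b c1 c2) s =
  if ev w s a == ev w s b then effect w c1 s else effect w c2 s.
Proof. by []. Qed.

Lemma effect_seq w c1 c2 s :
  effect w (Seq c1 c2) s = effect w c2 (effect w c1 s).
Proof. by []. Qed.

Lemma effect_asg w x e s : effect w (Asg x e) s = assign s x (ev w s e).
Proof. by []. Qed.

Section GadgetOracle.
Variables (n W : nat) (G : sgraph n) (s : config).
Let N := n.+2.
Hypotheses (big : 4 * (N * N) < 2 ^ W).
Hypotheses (e1 : env s 1 = n) (e8 : env s 8 = N) (e9 : env s 9 = N * N).
Hypothesis graph : forall i j : 'I_n, heap s (1 + i * n + j) = adj G i j.

Lemma gadget_lookupP : env s 7 < 2 * (N * N) ->
  effect W gadget_lookup s = assign s 7 (gadget_entry G (env s 7)).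
Proof.
move=> lt7; have NN : N * N = n * n + 4 * n + 4 by rewrite /N; lia.
have rowE : ev W s gadget_row = env s 7 %% (N * N) %/ N.
  by rewrite ev_nev //= e8 e9.
have colE : ev W s gadget_col = env s 7 %% N by rewrite ev_nev //= e8.
have varE x : ev W s (Var x) = env s x by [].
rewrite /gadget_lookup; set row := gadget_row in rowE *; set col := gadget_col in colE *.
rewrite /= rowE colE !varE e1 e9 /gadget_entry -/N.
set x := _ %/ N; set y := _ %% N.
have [lx|lx] := ltnP x n; last first.
  rewrite ifN //; apply/negP => /adjacent_lt[]; rewrite -/N -/x; lia.
have [ly|ly] := ltnP y n; last first.
  rewrite ifN //; apply/negP => /adjacent_lt[_]; rewrite -/N -/y; lia.
have cellE : ev W s gadget_cell = adjacent G x y.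
  rewrite ev_nev /=.
    rewrite e8 e9 e1 -/x -/y.
    by have := graph (Ordinal lx) (Ordinal ly); rewrite -adjacentE.
  rewrite e8 e9 e1 -/x -/y.
  have : x * n + n <= n * n by rewrite addnC -mulSn leq_mul2r lx orbT.
  by repeat split; lia.
rewrite cellE ev_nev ?mod0n; last by rewrite /= expn_gt0.
rewrite /= eqb0; case: (adjacent G x y) => //=.
by case: ltnP => _ //; rewrite ev_nev //= ?e1 //; split=> //; lia.
Qed.

End GadgetOracle.

Lemma gadget_oracleP n W (G : sgraph n) s (N := n.+2) : 4 * (N * N) < 2 ^ W ->
  env s 1 = n -> env s 8 = N -> env s 9 = N * N ->
  (forall i j : 'I_n, heap s (1 + i * n + j) = adj G i j) -> env s 6 < 2 ^ W ->
  let s' := effect W gadget_oracle s in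
  env s' 7 = nth 0 (@encode distributivity _ (gadget G)) (env s 6) /\
  modifies_only 7 s s'.
Proof.
move=> big e1 e8 e9 graph lt6; have NN : N * N = n * n + 4 * n + 4 by rewrite /N; lia.
rewrite effect_ifeq effect_seq effect_iflt !effect_asg [ev W s (Cst 0)]ev_nev; last by rewrite /= expn_gt0.
have [e6|n6] := eqVneq (ev W s (Var 6)) (nev s (Cst 0)).
  rewrite [env s 6]e6; split; last exact: modifies_only_assign.
  by rewrite /= /upd /= ev_nev.
have {}n6 : env s 6 != 0 by [].
have [q qE] : exists q, env s 6 = q.+1 by exists (env s 6).-1; rewrite prednK ?lt0n.
rewrite [ev W s (Bin _ _ _)]ev_nev; last by split=> //=; lia.
rewrite qE encode_gadget [nev _ _]/= qE subn1; set s1 := assign s 7 _.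
have mo1 : modifies_only 7 s s1 by exact: modifies_only_assign.
have -> : ev W s1 (Var 7) = q by [].
rewrite ev_nev; last by split=> //=; rewrite /upd /= ?e9; lia.
rewrite [nev _ _](_ : _ = 2 * (N * N)); last by rewrite /= /upd /= e9.
case: ltnP => lq.
  rewrite (gadget_lookupP (G := G)) //.
  by split=> //; exact: modifies_only_trans mo1 (modifies_only_assign _ _ _).
split; last exact: modifies_only_trans mo1 (modifies_only_assign _ _ _).
by rewrite /= /upd /= ev_nev //= expn_gt0.
Qed.

(** With p the power of two above n + 2, the simulated modulus is p ^ k, and the simulated memory
    starts at p ^ (k + 3), beyond the adjacency matrix. The final test negates the simulated
    answer. *)
Definition triangle_program (P : program) (k : nat) : cmd :=
  Seq (Asg 1 (Deref (Cst 0)))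
 (Seq (Asg 8 (Bin Opadd (Var 1) (Cst 2)))
 (Seq (Asg 9 (Bin Opmul (Var 8) (Var 8)))
 (Seq (next_pow2 8)
 (Seq (power 3 k)
 (Seq (power 4 (k + 3))
 (Seq (simulator P gadget_oracle)
      (IfEq (Var (vreg 0)) (Cst 0) (Asg 0 (Cst 1)) (Asg 0 (Cst 0))))))))).

(** The word size of the simulating machine depends on n, that of the simulated one on n + 2. *)
Lemma trunc_log2_add2 n : 0 < n -> (trunc_log 2 n.+2).+1 <= 3 * (trunc_log 2 n).+1.
Proof.
move=> n0; have lt := @trunc_log_ltn 2 n isT.
have le : 2 ^ trunc_log 2 n.+2 <= n.+2 by apply: trunc_logP.
suff : trunc_log 2 n.+2 < (trunc_log 2 n).+1 + 2 by lia.
by rewrite -(ltn_exp2l _ _ (isT : 1 < 2)) expnD; lia.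
Qed.

Lemma exp2_word_size k n : 2 ^ word_size k n = (2 ^ (trunc_log 2 n).+1) ^ k.
Proof. by rewrite /word_size mulnC expnM. Qed.

(** In the word size, the factor 3 is that of [trunc_log2_add2], k + 6 leaves room for the simulated
    memory, and [size P] lets the simulated program counter fit. *)
Lemma triangle_programP P k n (G : sgraph n) T u
    (W := word_size (3 * (k + 6) + size P) n) (w := word_size k n.+2)
    (q := run w P T (@encode distributivity _ (gadget G)) [seq x %% 2 ^ w | x <- u]) :
  0 < n -> halted P q ->
  tot W (triangle_program P k)
    (initial (fun i => nth 0 (@encode triangle_detection _ G) i %% 2 ^ W) u)
    (T * (size_cmd (dispatch P gadget_oracle 0 P) + 4) + n * 10 +
     (size_cmd (power 3 k) + size_cmd (power 4 (k + 3)) + 60))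
    (fun s => (env s 0 != 0) = ~~ accepts q).
Proof.
move=> n0 hq; set N := n.+2; set p := 2 ^ (trunc_log 2 N).+1.
have ltNp : N < p by apply: trunc_log_ltn.
have wE : 2 ^ w = p ^ k by rewrite exp2_word_size.
have bigW : p ^ (k + 6) * 2 ^ size P <= 2 ^ W.
  rewrite /p -expnM -expnD leq_pexp2l // /W /word_size.
  by have := trunc_log2_add2 n0; rewrite -/N; nia.
have ltPW : size P < 2 ^ W.
  apply: leq_trans bigW; apply: leq_trans (ltn_expl _ (isT : 1 < 2)) _.
  by rewrite leq_pmull // expn_gt0; lia.
have pW : p ^ (k + 6) <= 2 ^ W by apply: leq_trans bigW; rewrite leq_pmulr // expn_gt0.
have p1 : 1 < p by lia.
have le_p i j : i <= j -> p ^ i <= p ^ j by move=> le; rewrite leq_pexp2l //; lia.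
have p4W : p ^ 6 <= 2 ^ W by apply: leq_trans pW; apply: le_p; lia.
have NN : N * N < p ^ 2 by rewrite expnS expn1; nia.
have NN4 : 4 * (N * N) < p ^ 4 by move: NN; rewrite !expnS expn0; nia.
have NNW : 4 * (N * N) < 2 ^ W.
  by apply: leq_trans NN4 _; apply: leq_trans (le_p 4 6 isT) _.
set m := fun i => nth 0 _ i %% 2 ^ W; pose s0 := initial m u.
have mE : forall i j : 'I_n, m (1 + i * n + j) = adj G i j.
  move=> i j; rewrite /m -addnA add1n /= (nth_table (fun x y => nat_of_bool (adj G x y))).
  by rewrite modn_small //; case: adj; lia.
have m0 : m 0 = n by rewrite /m /= modn_small //; nia.
have mbig a : p ^ 3 <= a -> m a = 0.
  move=> le; rewrite /m nth_default ?mod0n //= size_table.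
  apply: leq_trans le; rewrite !expnS expn0; nia.
pose base s := [/\ env s 1 = n, env s 8 = N, env s 9 = N * N, heap s = m & rnd s = u]
   /\ (env s 5 = 0 /\ forall r, env s (vreg r) = 0).
pose t := T * (size_cmd (dispatch P gadget_oracle 0 P) + 4) + 4.
apply: (@tot_leq _ _ _ (3 + (4 + (4 + ((N * 10 + 10) + (size_cmd (power 3 k) +
   (size_cmd (power 4 (k + 3)) + (t + size_cmd (IfEq (Var (vreg 0)) (Cst 0) (Asg 0 (Cst 1)) (Asg 0 (Cst 0)))))))))));
  last by rewrite /t /N /=; lia.
have vne r x : x < 20 -> vreg r != x by rewrite vreg.unlock; lia.
apply: (tot_seq (mid := fun s => s = assign s0 1 n)).
  by apply: tot_effect => //=; rewrite ev_nev /= ?m0 ?expn_gt0.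
move=> _ ->; apply: (tot_seq (mid := fun s => s = assign (assign s0 1 n) 8 N)).
  by apply: tot_effect => //=; rewrite ev_nev /= /upd /= ?addn2 //; split=> //; nia.
move=> _ ->; apply: (tot_seq (mid := base)).
  apply: tot_effect => //=; rewrite ev_nev /= /upd /=; last by split=> //; nia.
  by split=> //=; split=> // r; rewrite /= !upd_low.
have base_mo x s s' : x \in [:: 2; 3; 4] -> modifies_only x s s' -> base s -> base s'.
  move=> xin [e h r] [[b1 b8 b9 bh br] [b5 bv]].
  have ne y : (y < 2) || (4 < y) -> y != x.
    by move: xin; rewrite !inE => /or3P[]/eqP->; lia.
  split; first by split; rewrite ?e ?h ?r ?ne.
  split=> [|r']; rewrite e ?ne //.
  by rewrite vreg.unlock; lia.
move=> s1 b1; apply: (tot_seq (mid := fun s => base s /\ env s 2 = p)).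
  apply: (tot_weaken (next_pow2P (x := 8) (N := N) isT _ _ _)) => //.
  - by case: b1 => -[].
  - by apply: leq_trans p4W; rewrite -[X in X < _]expn1 ltn_exp2l.
  - by move=> s [e2 mo]; split=> //; apply: base_mo mo b1.
move=> s2 [b2 e2]; apply: (tot_seq (mid := fun s => [/\ base s, env s 2 = p & env s 3 = p ^ k])).
  apply: tot_effect; first exact: loop_free_power.
  have [|e3 mo] := @powerP W 3 k p s2 isT e2 p1.
    by apply: leq_trans pW; rewrite ltn_exp2l //; lia.
  by split=> //; [apply: base_mo mo b2 | case: mo => ->].
move=> s3 [b3 e32 e33]; apply: (tot_seq (mid := fun s => [/\ base s, env s 3 = p ^ k & env s 4 = p ^ (k + 3)])).
  apply: tot_effect; first exact: loop_free_power.
  have [|e4 mo] := @powerP W 4 (k + 3) p s3 isT e32 p1.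
    by apply: leq_trans pW; rewrite ltn_exp2l //; lia.
  by split=> //; [apply: base_mo mo b3 | case: mo => ->].
move=> s4 [[[b1' b8 b9 bh br] [b5 bv]] e3 e4].
pose inp := @encode distributivity _ (gadget G).
pose input a := nth 0 inp a %% 2 ^ w.
pose q0 := init w inp [seq x %% 2 ^ w | x <- u].
pose simq := simulates w P input (p ^ (k + 3)) (2 ^ w) (env s4) (heap s4).
apply: (tot_seq (mid := simq (iter T (step w P) q0))).
  have le3 := le_p 3 (k + 3) (leq_addl _ _).
  apply: simulatorP hq => //.
  - by rewrite -(ltn_exp2l _ _ (isT : 1 < 2)) wE; apply: leq_trans pW; rewrite ltn_exp2l //; lia.
  - rewrite wE; apply: leq_trans pW; apply: (@leq_trans (2 * p ^ (k + 3))).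
      by rewrite mul2n -addnn leq_add2l le_p // leq_addr.
    by apply: leq_trans (leq_mul p1 (leqnn _)) _; rewrite -expnS le_p //; lia.
  - by rewrite e3 wE.
  - move=> s [fe fm] lt6 s'.
    have [|||||v [e h r]] := @gadget_oracleP n W G s NNW.
    + by rewrite fe.
    + by rewrite fe.
    + by rewrite fe.
    + move=> i j; rewrite fm ?bh ?mE //; apply: leq_trans le3.
      by apply: leq_trans (le_p 2 3 isT); have := flat_lt (ltn_ord i) (ltn_ord j); nia.
    + apply: leq_trans lt6 _; rewrite wE; apply: leq_trans pW; apply: le_p; lia.
    by split=> //; rewrite v.
  - split=> //=; rewrite ?b5 ?min0n //.
    + move=> a _; rewrite /cell bh mbig //; apply: leq_trans le3 _; exact: leq_addr.
    + by right; rewrite br.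
    + by move=> r; rewrite expn_gt0.
    + by move=> a; rewrite ltn_mod expn_gt0.
move=> s5 sim; apply: tot_effect => //.
rewrite effect_ifeq /accepts !ev_nev /= ?expn_gt0 // (sim_reg sim).
by rewrite /q /run -/q0 negbK; case: ifP => _; rewrite /= /upd /= ev_nev /= ?expn_gt0 //; lia.
Qed.

(** * Counting coins *)

(** A step draws at most one coin, so runs whose coins agree in j places still agree in j - t places
    after t steps. *)
Lemma run_take w P T input u :
  [/\ pc (run w P T input u) = pc (run w P T input (take T u)),
      reg (run w P T input u) = reg (run w P T input (take T u)) &
      memory (run w P T input u) = memory (run w P T input (take T u))].
Proof.
pose sim j q q' := [/\ pc q = pc q', reg q = reg q', memory q = memory q' &
  forall i, i < j -> nth 0 (coins q) i = nth 0 (coins q') i].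
suff main t j q q' : t <= j -> sim j q q' ->
    sim (j - t) (iter t (step w P) q) (iter t (step w P) q').
  have [||? ? ? _] := main T T (init w input u) (init w input (take T u)) => //.
  by split=> // i lt; rewrite nth_take.
elim: t => [|t IH] lt sm; first by rewrite subn0.
have {IH} := IH (ltnW lt) sm; rewrite !iterS.
move: (iter t _ q) (iter t _ q') => {sm}q {}q'.
have -> : j - t = (j - t.+1).+1 by lia.
move: (j - t.+1) => {lt}j [].
case: q q' => p r m us [p' r' m' us'] /= <- <- <- eq_us.
rewrite /step /halted /=; case: ifP => _.
  by split=> //= i lt; apply: eq_us; apply: ltnW.
have eq_us' i : i < j -> nth 0 us i = nth 0 us' i by move=> lt; apply: eq_us; apply: ltnW.
case: (nth _ _ _) => [a c|o a b c|a b|a b|a|a b l|a b l] //=; split=> //=.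
  by rewrite -!nth0 eq_us.
by move=> i lt; rewrite !nth_behead eq_us.
Qed.

Section FiberCounting.
Variables (m M T U : nat).
Hypotheses (m0 : 0 < m) (dvd_mM : m %| M) (M0 : 0 < M) (le_TU : T <= U).

Definition reduce (u : U.-tuple 'I_M) : T.-tuple 'I_m :=
  [tuple Ordinal (ltn_pmod (tnth u (widen_ord le_TU k)) m0) | k < T].

Lemma reduceE (u : U.-tuple 'I_M) :
  [seq val i | i <- reduce u] = take T [seq x %% m | x <- [seq val i | i <- u]].
Proof.
apply: (@eq_from_nth _ 0) => [|k].
  by rewrite size_map size_tuple size_takel ?size_map ?size_tuple.
rewrite size_map size_tuple => lt.
have ltU : k < U by apply: leq_trans le_TU.
rewrite nth_take // -map_comp.
rewrite (nth_map (Ordinal (ltn_pmod 0 m0))) ?size_tuple //.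
rewrite (nth_map (Ordinal M0)) ?size_tuple //=.
have /= <- := tnth_nth (Ordinal (ltn_pmod 0 m0)) (reduce u) (Ordinal lt).
by rewrite tnth_mktuple /= (tnth_nth (Ordinal M0)).
Qed.

(* Exchanging residues maps one fiber injectively into the other. *)
Lemma card_fiber_leq (v v' : T.-tuple 'I_m) :
  #|[pred u | reduce u == v]| <= #|[pred u | reduce u == v']|.
Proof.
(* As m divides M, the block of m consecutive numbers around x lies entirely below M. *)
have shift_lt (x : 'I_M) (y : 'I_m) : x - x %% m + y < M.
  have [D ME] := dvdnP dvd_mM; have := divn_eq x m.
  have : x %/ m < D by rewrite ltn_divLR // -ME.
  have := ltn_ord y; move=> ly lD xE; suff : x - x %% m + y < D * m by rewrite -ME.
  have : (x %/ m).+1 * m <= D * m by rewrite leq_mul2r lD orbT.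
  rewrite mulSn; move: xE ly; move: (nat_of_ord x) (nat_of_ord y) => a b.
  move: (a %% m) (a %/ m * m) => r c; lia.
pose g (u : U.-tuple 'I_M) : U.-tuple 'I_M := [tuple
  if (insub (val k) : option 'I_T) is Some k'
  then Ordinal (shift_lt (tnth u k) (tnth v' k')) else tnth u k | k < U].
have gE u (k : 'I_U) (lt : k < T) :
    tnth (g u) k = tnth u k - tnth u k %% m + tnth v' (Ordinal lt) :> nat.
  by rewrite tnth_mktuple (insubT (fun i => i < T) lt).
have gE' u (k : 'I_U) : T <= k -> tnth (g u) k = tnth u k.
  by move=> le; rewrite tnth_mktuple insubF // ltnNge le.
rewrite -(card_in_image (f := g)); last first.
  move=> u1 u2; rewrite !inE => /eqP r1 /eqP r2 eg; apply/eq_from_tnth => k.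
  have [lt|le] := ltnP k T; last by rewrite -(gE' u1) // -(gE' u2) // eg.
  apply: val_inj; have := congr1 (fun u => val (tnth u k)) eg; rewrite /= !(gE _ _ lt).
  have := congr1 (fun v => val (tnth v (Ordinal lt))) (etrans r1 (esym r2)).
  rewrite /= !tnth_mktuple /= (_ : widen_ord _ _ = k); last exact: val_inj.
  move: (nat_of_ord (tnth u1 k)) (nat_of_ord (tnth u2 k)) (nat_of_ord (tnth v' _)) => a b c.
  have := leq_mod a m; have := leq_mod b m; move: (a %% m) (b %% m) => r r'; lia.
apply/subset_leq_card/fintype.subsetP => z /fintype.imageP[u _ ->{z}]; rewrite inE.
apply/eqP/eq_from_tnth => k; apply: val_inj; rewrite tnth_mktuple /=.
rewrite (gE u (widen_ord le_TU k) (ltn_ord k)).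
have -> : Ordinal (ltn_ord k) = k by apply: val_inj.
set x := tnth u _; have xE := divn_eq x m.
rewrite {1}xE addnK.
by rewrite modnMDl modn_small.
Qed.

(** All fibers of [reduce] have equal size, so it maps uniform coins to uniform coins. The identity
    equates two probabilities after clearing denominators. *)
Lemma card_reduce (Q : pred (T.-tuple 'I_m)) :
  #|[pred u | Q (reduce u)]| * m ^ T = #|Q| * M ^ U.
Proof.
pose F := #|[pred u | reduce u == [tuple Ordinal m0 | k < T]]|.
have fiber v : #|[pred u | reduce u == v]| = F.
  by apply/eqP; rewrite eqn_leq !card_fiber_leq.
have card_pre (A : pred (T.-tuple 'I_m)) : #|[pred u | A (reduce u)]| = #|A| * F.
  rewrite -!sum1_card (partition_big reduce A) //= big_distrl /=.
  apply: eq_bigr => v Av; rewrite mul1n -(fiber v) -sum1_card.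
  by apply: eq_bigl => u; rewrite !inE /=; case: eqP => [->|]; rewrite ?Av // andbF.
have total : M ^ U = m ^ T * F.
  rewrite -[M in LHS](card_ord M) -[m in RHS](card_ord m) -!card_tuple.
  apply: etrans (etrans _ (card_pre predT)) _; first exact: eq_card.
  by congr (_ * _); apply: eq_card.
by rewrite card_pre total; lia.
Qed.

End FiberCounting.

Lemma draw_free_simulator P orc : coin_free P -> draw_free orc ->
  draw_free (simulator P orc).
Proof.
rewrite /coin_free /simulator /= => /negP cf dorc.
suff main j Q L : (has is_rand Q -> False) -> draw_free (dispatch L orc j Q) by apply: main.
elim: Q j => //= i Q IH j h; rewrite IH ?andbT; last by move=> hq; apply: h; rewrite hq orbT.
by case: i h => [? ?|? ? ? ?|? ?|? ?|?|? ? ?|? ? ?] h //=; [rewrite dorc | case: h].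
Qed.

Lemma draw_free_power y k : draw_free (power y k).
Proof. by elim: k => //= k ->. Qed.

Lemma draw_free_triangle_program P k : coin_free P -> draw_free (triangle_program P k).
Proof.
move=> cf; rewrite /triangle_program.
have := draw_free_simulator cf (isT : draw_free gadget_oracle).
by rewrite /= !draw_free_power /= => ->.
Qed.

Local Open Scope ring_scope.

(** * Transfer of running time and success probability *)

Section Reduction.
Variable R : realType.
Implicit Types (tau C : R).

(** The constant 3 comes from n + 2 <= 3 * n; the linear term is absorbed because tau' is at least
    1. *)
Lemma reduction_time tau tau' C (T n c1 c2 : nat) : (0 < n)%N ->
  T%:R <= C * n.+2%:R `^ tau -> tau <= tau' -> 1 <= tau' ->
  (T * c1 + n * 10 + c2)%:R <=
    (`|C| * 3%:R `^ tau' * c1%:R + 10%:R + c2%:R) * n%:R `^ tau'.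
Proof.
move=> n0 leT le_tau tau1.
have n1 : 1 <= n%:R :> R by rewrite ler1n.
have nn : n%:R <= n%:R `^ tau' :> R by apply: le1r_powR.
have leT' : T%:R <= `|C| * 3%:R `^ tau' * n%:R `^ tau'.
  apply: le_trans leT _; apply: (@le_trans _ _ (`|C| * n.+2%:R `^ tau')).
    apply: (@le_trans _ _ (`|C| * n.+2%:R `^ tau)).
      by rewrite ler_wpM2r ?powR_ge0 ?ler_norm.
    by rewrite ler_wpM2l // ler_powR // ler1n.
  rewrite -mulrA -powRM ?ler0n // ler_wpM2l // -natrM.
  apply: ge0_ler_powR; rewrite ?nnegrE ?ler0n ?ler_nat //; last by lia.
  exact: le_trans tau1.
rewrite !natrD !natrM 2!mulrDl; apply: lerD.
  apply: lerD.
    by rewrite mulrAC ler_wpM2r.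
  by rewrite mulrC ler_wpM2l.
rewrite -[leLHS]mulr1 ler_wpM2l //; exact: le_trans n1 nn.
Qed.

Lemma triangle_deterministic tau tau' : tau <= tau' -> 1 <= tau' ->
  det_decidable_in distributivity tau -> det_decidable_in triangle_detection tau'.
Proof.
move=> le_tau tau1 [P [k [C [cf solve]]]].
pose c1 := (size_cmd (dispatch P gadget_oracle 0 P) + 4)%N.
pose c2 := (size_cmd (power 3 k) + size_cmd (power 4 (k + 3)) + 60)%N.
exists (comp 0 (triangle_program P k)), (3 * (k + 6) + size P)%N.
exists (`|C| * 3%:R `^ tau' * c1%:R + 10%:R + c2%:R); split; first by rewrite coin_free_comp draw_free_triangle_program.
move=> n G n0; have [T leT [hT accT]] := solve n.+2 (gadget G) isT.
exists (T * c1 + n * 10 + c2)%N; first exact: reduction_time n0 leT le_tau tau1.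
have [ht [s [sE rE _]]] := tot_run (triangle_programP (u := [::]) n0 hT) (leqnn _).
by split=> //; rewrite /accepts rE sE accT gadget_answer negbK.
Qed.

Lemma triangle_randomized tau tau' : tau <= tau' -> 1 <= tau' ->
  rand_decidable_in distributivity tau -> rand_decidable_in triangle_detection tau'.
Proof.
(* The exponent must be nonnegative for the error bound at n + 2 points to imply the one at n
   vertices. *)
move=> le_tau tau1 solve c; have [P [k [C {}solve]]] := solve (Num.max c 0).
pose c1 := (size_cmd (dispatch P gadget_oracle 0 P) + 4)%N.
pose c2 := (size_cmd (power 3 k) + size_cmd (power 4 (k + 3)) + 60)%N.
exists (comp 0 (triangle_program P k)), (3 * (k + 6) + size P)%N.
exists (`|C| * 3%:R `^ tau' * c1%:R + 10%:R + c2%:R) => n G n0; have [T leT [hT succ]] := solve n.+2 (gadget G) isT.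
exists (T * c1 + n * 10 + c2)%N; first exact: reduction_time n0 leT le_tau tau1.
set U := (T * _ + _ + _)%N; set W := word_size _ n.
set w := word_size k n.+2 in hT succ.
have le_TU : (T <= U)%N.
  rewrite /U -addnA; apply: leq_trans (leq_addr _ _).
  by rewrite leq_pmulr // /c1 addnS.
have w0 : (0 < 2 ^ w)%N by rewrite expn_gt0.
have W0 : (0 < 2 ^ W)%N by rewrite expn_gt0.
have le_wW : (w <= W)%N.
  by have := trunc_log2_add2 n0; rewrite /w /W /word_size; nia.
have dvd : (2 ^ w %| 2 ^ W)%N by apply: dvdn_exp2l.
have run_u (u : U.-tuple 'I_(2 ^ W)) :
  let q := run W (comp 0 (triangle_program P k)) U
    (@encode triangle_detection _ G) [seq val i | i <- u] in
  halted (comp 0 (triangle_program P k)) q /\ accepts q = ~~ accepts (run w P T (@encode distributivity _ (gadget G))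
     [seq val i | i <- reduce w0 le_TU u]).
  have [pcE rE _] := run_take w P T (@encode distributivity _ (gadget G))
    [seq x %% 2 ^ w | x <- [seq val i | i <- u]]%N.
  have hq := hT (reduce w0 le_TU u); rewrite (reduceE _ W0) in hq.
  rewrite (reduceE _ W0); rewrite /halted -pcE in hq.
  have [ht [s [sE rE' _]]] := tot_run (triangle_programP n0 hq) (leqnn U).
  split; first exact: ht.
  by rewrite [LHS]/accepts rE' sE /accepts rE.
split=> [u|]; first exact: (run_u u).1.
(* Both the acceptance and the correct answer are negated, so success on u is success of the
   simulated run on the reduced coins. *)
have -> : success_prob R W (comp 0 (triangle_program P k)) U
    (@encode triangle_detection _ G) (@answer triangle_detection _ G) =
  success_prob R w P T (@encode distributivity _ (gadget G)) (@answer distributivity _ (gadget G)).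
  rewrite /success_prob !card_tuple !card_ord.
  have := card_reduce w0 dvd W0 le_TU [pred v : T.-tuple 'I_(2 ^ w) |
    accepts (run w P T (@encode distributivity _ (gadget G)) [seq val i | i <- v])
    == @answer distributivity _ (gadget G)].
  rewrite (eq_card (B := [pred u : U.-tuple 'I_(2 ^ W) | accepts (run W
     (comp 0 (triangle_program P k)) U (@encode triangle_detection _ G) [seq val i | i <- u])
     == @answer triangle_detection _ G])) => [E|u]; last first.
    rewrite !inE; have [_ ->] := run_u u.
    by rewrite gadget_answer; case: accepts; case: (@answer triangle_detection _ G).
  apply/eqP; rewrite eqr_div ?pnatr_eq0 -?lt0n ?expn_gt0 ?w0 ?W0 // -!natrM E.
  by [].
apply: le_trans succ; rewrite lerD2l lerN2.
have n1 : 1 <= n%:R :> R by rewrite ler1n.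
apply: (@le_trans _ _ (n%:R `^ (- Num.max c 0))); last first.
  by apply: ler_powR => //; rewrite lerN2 le_max lexx.
rewrite !powRN lef_pV2 ?posrE ?powR_gt0 ?ltr0n //.
apply: ge0_ler_powR; rewrite ?nnegrE ?ler0n ?ler_nat ?le_max ?lexx ?orbT //.
by lia.
Qed.

End Reduction.

Lemma triangle_of_distributivity (R : realType) (K : algorithm_kind) :
  (exists2 eps : R, 0 < eps & decidable_in K distributivity (omega R - eps)) ->
  ~ triangle_hypothesis R K.
Proof.
move=> [eps eps0 dec]; apply.
(* Capping the saving at 1 keeps the exponent at least 1, as [omega] is at least 2. *)
exists (Num.min eps 1); first by rewrite lt_min eps0 ltr01.
have le_tau : omega R - eps <= omega R - Num.min eps 1.
  by rewrite lerD2l lerN2 ge_min lexx.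
have tau1 : 1 <= omega R - Num.min eps 1.
  have := omega_ge2 R; have : Num.min eps 1 <= 1 by rewrite ge_min lexx orbT.
  by lra.
by case: K dec => /=; [apply: triangle_deterministic | apply: triangle_randomized].
Qed.

(** * Preparing the matrix product *)

Local Open Scope nat_scope.

Definition same_env (xs : seq nat) (s s' : config) : Prop :=
  forall x, x \notin xs -> env s' x = env s x.

Lemma same_env_assign xs s s' x v :
  x \in xs -> same_env xs s s' -> same_env xs s (assign s' x v).
Proof.
by move=> xin ag y ny; rewrite /= /upd; case: eqP ny => [->|_ ny]; [rewrite xin | apply: ag].
Qed.

Lemma same_env_trans xs s1 s2 s3 :
  same_env xs s1 s2 -> same_env xs s2 s3 -> same_env xs s1 s3.
Proof. by move=> ag1 ag2 x nx; rewrite ag2 ?ag1. Qed.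

Definition scatter (addr val : expr) : cmd :=
  For 11 10 (Sto addr (Bin Opadd (Deref addr) val)).

(** The push-forward of the weights [g] along [A]. *)
Definition scattered (n : nat) (A g : nat -> nat) (x : nat) : nat :=
  \sum_(i < n) (A i == x) * g i.

Lemma scattered0 n A g x : (forall i, i < n -> A i != x) -> scattered n A g x = 0.
Proof. by move=> miss; apply: big1 => i _; rewrite (negbTE (miss i _)). Qed.

(** The expressions need the right values only in states that agree with [s] outside the counter and
    the target cells, since the loop changes nothing else. Targets may coincide; contributions add
    up. *)
Lemma scatterP W N s addr val (A g : nat -> nat) : N < 2 ^ W ->
  env s 10 = N -> (forall a, heap s a < 2 ^ W) ->
  (forall i s', i < N -> env s' 11 = i -> same_env [:: 11] s s' ->
     (forall a, (forall j, j < N -> A j != a) -> heap s' a = heap s a) ->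
     ev W s' addr = A i /\ ev W s' val = g i) ->
  tot W (scatter addr val) s
    (N * (2 * size_expr addr + size_expr val + 12) + 6) (fun s' =>
    [/\ same_env [:: 11] s s', rnd s' = rnd s &
      forall x, heap s' x = (heap s x + scattered N A g x) %% 2 ^ W]).
Proof.
move=> lN e10 small addrP.
pose I k s' := [/\ same_env [:: 11] s s', rnd s' = rnd s &
  forall x, heap s' x = (heap s x + scattered k A g x) %% 2 ^ W].
apply: (@tot_weaken _ _ _ (N * (size_expr addr + (size_expr addr + 1 + size_expr val + 1) + 1 + 8) + 6)
  _ (fun s' => I N s' /\ env s' 11 = N)); last 2 first.
- by rewrite leq_add2r leq_mul2l; apply/orP; right; lia.
- by move=> s' [].
apply: tot_for => //=.
  split=> //= x; first by apply: same_env_assign.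
  by rewrite /scattered big_ord0 addn0 modn_small.
move=> i s' lt [ag rn hp] e11 _; apply: tot_effect => //=.
have [|aE vE] := addrP i s' lt e11 ag.
  move=> a miss; rewrite hp scattered0 ?addn0 ?modn_small // => j lj.
  by apply: miss; apply: ltn_trans lt.
split=> //=; first by rewrite /upd /= ag.
split=> //= x; first by apply: same_env_assign.
rewrite ev_bin /= vE [ev W s' (Deref _)]/ev -/(ev W s' addr) aE /upd /scattered big_ord_recr /=.
rewrite eq_sym; case: eqP => [->|_]; last by rewrite addn0 hp.
by rewrite mul1n hp modnDml addnA.
Qed.

Definition draw_coins : cmd :=
  For 11 13 (Seq (Rnd 12)
    (Sto (Bin Opadd (Var 14) (Var 11)) (Bin Opmod (Var 12) (Var 8)))).

Lemma draw_coinsP W N L q s : L + N < 2 ^ W ->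
  env s 13 = N -> env s 14 = L -> env s 8 = q ->
  tot W draw_coins s (N * 20 + 6) (fun s' =>
    [/\ same_env [:: 11; 12] s s',
      forall i, i < N -> heap s' (L + i) = nth 0 (rnd s) i %% q &
      forall a, (a < L) || (L + N <= a) -> heap s' a = heap s a]).
Proof.
move=> lN e13 e14 e8.
pose I k s' := [/\ same_env [:: 11; 12] s s', rnd s' = drop k (rnd s),
  forall i, i < k -> heap s' (L + i) = nth 0 (rnd s) i %% q &
  forall a, (a < L) || (L + k <= a) -> heap s' a = heap s a].
apply: (@tot_weaken _ _ _ (N * (8 + 8) + 6)
  _ (fun s' => I N s' /\ env s' 11 = N)); last 2 first.
- by lia.
- by move=> s' [[? ? ? ?] _].
apply: tot_for => //=; first by lia.
  by split=> //=; [apply: same_env_assign | rewrite drop0].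
move=> k s' lt [ag rn hp hf] e11 _; apply: tot_effect => //=.
have e13' : env s' 13 = N by rewrite ag.
have e14' : env s' 14 = L by rewrite ag.
have e8' : env s' 8 = q by rewrite ag.
rewrite !ev_nev //=; last by rewrite /upd /= e14' e11; split=> //; lia.
rewrite /upd /= e14' e8' e11; split=> //.
split=> /=.
- do 2!apply: same_env_assign => //.
- by rewrite rn -drop1 drop_drop.
- move=> i li; rewrite /upd eqn_add2l; case: eqP => [->|ne].
    by rewrite rn -nth0 nth_drop addn0.
  by apply: hp; lia.
- move=> a la; rewrite /upd; case: eqP => [|_]; first by lia.
  by apply: hf; lia.
Qed.

Lemma sum_flat n k (F : nat -> nat) :
  \sum_(i < k * n) F i = \sum_(a < k) \sum_(b < n) F (a * n + b).
Proof.
elim: k => [|k IH]; first by rewrite mul0n !big_ord0.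
by rewrite big_ord_recr /= -IH mulSnr big_split_ord.
Qed.

(** Change of variables for a push-forward. *)
Lemma sum_scattered n N (f g h : nat -> nat) : (forall i, i < N -> f i < n) ->
  \sum_(d < n) scattered N f g d * h d = \sum_(i < N) g i * h (f i).
Proof.
move=> lf; rewrite /scattered.
under eq_bigr do rewrite big_distrl.
rewrite exchange_big /=; apply: eq_bigr => i _.
rewrite (bigD1 (Ordinal (lf i (ltn_ord i)))) //= eqxx mul1n big1 ?addn0 // => d.
by rewrite -val_eqE /= eq_sym => /negbTE->.
Qed.

Lemma scattered_leq N A g b x : (forall i, i < N -> g i <= b) -> scattered N A g x <= N * b.
Proof.
move=> lg; rewrite -[N in N * b]card_ord -sum_nat_const; apply: leq_sum => i _.
by case: (_ == _) => //; rewrite mul1n lg.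
Qed.

Lemma scattered_shift N c A g x : scattered N (fun i => c + A i) g (c + x) = scattered N A g x.
Proof. by apply: eq_bigr => i _; rewrite eqn_add2l. Qed.

Lemma scattered_id N g x : x < N -> scattered N id g x = g x.
Proof.
move=> lx; rewrite /scattered (bigD1 (Ordinal lx)) //= eqxx mul1n big1 ?addn0 // => i.
by rewrite -val_eqE /= => /negbTE->.
Qed.

(** * The two sums of the random test *)

Section Checker.
Variables (n : nat) (f g y z r : nat -> nat).
Hypotheses (f_lt : forall i, i < n * n -> f i < n) (g_lt : forall i, i < n * n -> g i < n).

(* With y, z, r extended linearly to the free module on the n elements and f, *)
(* g the flat tables of the two operations, the vanishing of left_sum a -     *)
(* right_sum a is a random linear test of the law for this a and all b, c.    *)
(* The right-hand sums take one product of two n * n matrices.                *)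
Definition weight := scattered (n * n) f (fun i => y (i %/ n) * z (i %% n)).
Definition left_matrix a := scattered n (fun b => g (a * n + b)) y.
Definition right_matrix s t := r (f (s * n + t)).
Definition product_entry a t := \sum_(s < n) left_matrix a s * right_matrix s t.
Definition left_sum a := \sum_(d < n) weight d * r (g (a * n + d)).
Definition right_sum a := \sum_(c < n) z c * product_entry a (g (a * n + c)).

Lemma left_sumE a : left_sum a =
  \sum_(b < n) \sum_(c < n) y b * z c * r (g (a * n + f (b * n + c))).
Proof.
rewrite /left_sum (sum_scattered _ (fun d => r (g (a * n + d))) f_lt).
rewrite (sum_flat n n (fun i => y (i %/ n) * z (i %% n) * r (g (a * n + f i)))).
apply: eq_bigr => b _; apply: eq_bigr => c _.
by rewrite divnMDl ?divn_small ?addn0 ?modnMDl ?modn_small // (leq_ltn_trans _ (ltn_ord c)).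
Qed.

(** Exchange the sums; the push-forward in [left_matrix] turns the sum over s into one over b with s
    = a . b. *)
Lemma right_sumE a : a < n -> right_sum a =
  \sum_(b < n) \sum_(c < n) y b * z c * r (f (g (a * n + b) * n + g (a * n + c))).
Proof.
move=> la; have ga b : b < n -> g (a * n + b) < n.
  by move=> lb; apply: g_lt; rewrite mulnn flat_lt.
rewrite /right_sum exchange_big /=; apply: eq_bigr => c _.
rewrite /product_entry /left_matrix
  (sum_scattered _ (fun s => right_matrix s (g (a * n + c))) ga) big_distrr /=.
by apply: eq_bigr => b _; rewrite /right_matrix; lia.
Qed.

(** A single pass over all pairs fills the whole matrix: the address determines the row, so only
    pairs from row a contribute to it. *)
Lemma left_matrix_flat a s : a < n -> s < n ->
  scattered (n * n) (fun i => i %/ n * n + g i) (fun i => y (i %% n)) (a * n + s) =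
  left_matrix a s.
Proof.
move=> la ls; rewrite /scattered
  (sum_flat n n (fun i => (i %/ n * n + g i == a * n + s) * y (i %% n))).
have n0 : 0 < n by apply: leq_ltn_trans la.
rewrite (bigD1 (Ordinal la)) //= [X in _ + X]big1 ?addn0 => [|a' ne].
  apply: eq_bigr => b _; rewrite divnMDl // divn_small // addn0 modnMDl modn_small //.
  by rewrite eqn_add2l.
apply: big1 => b _; rewrite divnMDl // divn_small // addn0.
have lgb : g (a' * n + b) < n by apply: g_lt; rewrite mulnn flat_lt.
case: eqP => // /(congr1 (fun x => x %/ n)).
rewrite !divnMDl // !divn_small // !addn0 => e; case/eqP: ne; exact: val_inj.
Qed.

Variable q : nat.
Hypotheses (y_lt : forall i, i < n -> y i < q) (z_lt : forall i, i < n -> z i < q)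
  (r_lt : forall i, i < n -> r i < q).

Lemma weight_leq d : weight d <= n * n * (q * q).
Proof.
apply: scattered_leq => i li; apply: leq_mul; apply: ltnW; [apply: y_lt|apply: z_lt].
  by rewrite ltn_divLR //; case: (n) li.
by rewrite ltn_mod; case: (n) li.
Qed.

Lemma left_matrix_leq a s : left_matrix a s <= n * q.
Proof. by apply: scattered_leq => b /y_lt/ltnW. Qed.

Lemma right_matrix_leq s t : s < n -> t < n -> right_matrix s t <= q.
Proof. by move=> ls lt; apply/ltnW/r_lt/f_lt; rewrite mulnn flat_lt. Qed.

Lemma sum_leq_const N b (F : nat -> nat) : (forall i, i < N -> F i <= b) ->
  forall k, k <= N -> \sum_(i < k) F i <= N * b.
Proof.
move=> lF k lk; apply: (@leq_trans (k * b)); last by rewrite leq_mul2r lk orbT.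
rewrite -[k in k * b]card_ord -sum_nat_const; apply: leq_sum => i _.
by apply: lF; apply: leq_trans lk.
Qed.

Lemma product_entry_leq a t : t < n -> product_entry a t <= n * (n * q * q).
Proof.
move=> lt; apply: (sum_leq_const (F := fun s => left_matrix a s * right_matrix s t)) => // s ls.
by rewrite leq_mul ?left_matrix_leq ?right_matrix_leq.
Qed.

End Checker.

(* Variables 1, 9, 10 and 14 hold n, the base D of the matrix input, n * n    *)
(* and L = 1 + 2 * n * n; 11 is the loop counter. The cells from L on contain *)
(* the random vectors y, z, r and the weights, n cells each.                  *)
Definition row_var : expr := Bin Opdiv (Var 11) (Var 1).
Definition col_var : expr := Bin Opmod (Var 11) (Var 1).
Definition f_cell : expr := Deref (Bin Opadd (Cst 1) (Var 11)).
Definition g_cell : expr := Deref (Bin Opadd (Bin Opadd (Cst 1) (Var 10)) (Var 11)).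
Definition y_cell (e : expr) : expr := Deref (Bin Opadd (Var 14) e).
Definition z_cell (e : expr) : expr := Deref (Bin Opadd (Bin Opadd (Var 14) (Var 1)) e).
Definition r_cell (e : expr) : expr :=
  Deref (Bin Opadd (Bin Opadd (Var 14) (Bin Opmul (Cst 2) (Var 1))) e).

Definition weight_addr : expr :=
  Bin Opadd (Bin Opadd (Var 14) (Bin Opmul (Cst 3) (Var 1))) f_cell.
Definition weight_val : expr := Bin Opmul (y_cell row_var) (z_cell col_var).
Definition left_addr : expr :=
  Bin Opadd (Bin Opadd (Var 9) (Cst 1)) (Bin Opadd (Bin Opmul row_var (Var 1)) g_cell).
Definition left_val : expr := y_cell col_var.
Definition right_addr : expr :=
  Bin Opadd (Bin Opadd (Bin Opadd (Var 9) (Cst 1)) (Var 10)) (Var 11).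
Definition right_val : expr := r_cell f_cell.

(** Besides the weights, this lays out an input of matrix multiplication from address D on; the last
    store is its header n. *)
Definition prepare : cmd :=
  Seq (scatter weight_addr weight_val)
 (Seq (scatter left_addr left_val)
 (Seq (scatter right_addr right_val)
      (Sto (Var 9) (Var 1)))).

Section Prepare.
Variables (n W D q : nat) (f g y z r : nat -> nat) (s : config).
Let L := 1 + 2 * (n * n).
Definition tables (m : nat -> nat) : Prop :=
  [/\ forall i, i < n * n -> m (1 + i) = f i,
      forall i, i < n * n -> m (1 + n * n + i) = g i,
      forall i, i < n -> m (L + i) = y i,
      forall i, i < n -> m (L + n + i) = z i &
      forall i, i < n -> m (L + 2 * n + i) = r i].

Lemma tables_eq m m' : (forall x, x < L + 3 * n -> m' x = m x) -> tables m -> tables m'.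
Proof.
move=> eqm [mf mg my mz mr]; split=> i li; rewrite eqm;
  by first [exact: mf | exact: mg | exact: my | exact: mz | exact: mr | rewrite /L; lia].
Qed.

Hypotheses (n0 : 0 < n) (q0 : 0 < q) (LD : L + 4 * n <= D).
Hypotheses (DW : D + (1 + 3 * (n * n)) < 2 ^ W) (qW : n * n * (q * q) < 2 ^ W).
Hypotheses (f_lt : forall i, i < n * n -> f i < n) (g_lt : forall i, i < n * n -> g i < n).
Hypotheses (y_lt : forall i, i < n -> y i < q) (z_lt : forall i, i < n -> z i < q)
  (r_lt : forall i, i < n -> r i < q).
Hypotheses (e1 : env s 1 = n) (e9 : env s 9 = D) (e10 : env s 10 = n * n)
  (e14 : env s 14 = L) (small : forall a, heap s a < 2 ^ W).

Hypotheses (tab : tables (heap s)) (zero : forall x, L + 3 * n <= x -> heap s x = 0).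

(** The three passes and the last store write to disjoint ranges, all above the tables and the
    random vectors, so each finds its operands intact. *)
Lemma prepareP : tot W prepare s (n * n * 150 + 50) (fun s' =>
  [/\ same_env [:: 11] s s', tables (heap s'),
      forall d, d < n -> heap s' (L + 3 * n + d) = weight n f y z d &
      [/\ heap s' D = n,
          forall a t, a < n -> t < n -> heap s' (D + 1 + (a * n + t)) = left_matrix n g y a t,
          forall i, i < n * n -> heap s' (D + 1 + n * n + i) = r (f i) &
          forall x, D + 1 + 2 * (n * n) <= x -> heap s' x = 0]]).
Proof.
have LE : L = 1 + 2 * (n * n) by [].
have lNW : n * n < 2 ^ W by lia.
have nn : n <= n * n by rewrite leq_pmulr.
have row_lt i : i < n * n -> i %/ n < n by rewrite ltn_divLR.
have col_lt i : i %% n < n by rewrite ltn_mod.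
have nq : n * q <= n * n * (q * q) by rewrite leq_mul // leq_pmulr.
have flat_leq i : i < n * n -> i %/ n * n + n <= n * n.
  by move=> li; rewrite addnC -mulSn leq_mul2r row_lt ?orbT.
have keep s1 : same_env [:: 11] s s1 ->
    [/\ env s1 1 = n, env s1 9 = D, env s1 10 = n * n & env s1 14 = L].
  by move=> ag; rewrite !ag.
pose A1 i := L + 3 * n + f i; pose G1 i := y (i %/ n) * z (i %% n).
pose A2 i := D + 1 + (i %/ n * n + g i); pose G2 i := y (i %% n).
pose A3 i := D + 1 + n * n + i; pose G3 i := r (f i).
have A1_lt i : i < n * n -> L + 3 * n <= A1 i < D by move=> /f_lt; rewrite /A1; lia.
have A2_lt i : i < n * n -> D < A2 i <= D + n * n.
  by move=> li; have := flat_leq _ li; have := g_lt li; rewrite /A2; move: (i %/ n * n) => b; lia.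
have A3_lt i : i < n * n -> D + n * n < A3 i <= D + 2 * (n * n) by rewrite /A3; lia.
apply: (@tot_leq _ _ _ ((n * n * (2 * size_expr weight_addr + size_expr weight_val + 12) + 6) +
  ((n * n * (2 * size_expr left_addr + size_expr left_val + 12) + 6) +
  ((n * n * (2 * size_expr right_addr + size_expr right_val + 12) + 6) + 3)))); last by rewrite /=; lia.
apply: tot_seq.
  apply: (scatterP (A := A1) (g := G1) lNW e10 small) => i s' li e11 ag un.
  have [b1 b9 b10 b14] := keep _ ag.
  have [mf mg my mz mr] : tables (heap s').
    apply: tables_eq tab => x lx; apply: un => j /A1_lt; lia.
  have := row_lt _ li; have := col_lt i => lc lr.
  have fE : heap s' (1 + i) = f i by apply: mf.
  have yE : heap s' (L + i %/ n) = y (i %/ n) by apply: my.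
  have zE : heap s' (L + n + i %% n) = z (i %% n) by apply: mz.
  have lG : y (i %/ n) * z (i %% n) < 2 ^ W.
    apply: leq_ltn_trans qW; apply: (@leq_trans (q * q)); last by rewrite leq_pmull // muln_gt0 n0.
    by apply: leq_mul; apply: ltnW; auto.
  have lf := f_lt li.
  split; (rewrite ev_nev; first by rewrite /= ?b1 ?b14 ?e11 ?fE ?yE ?zE);
    rewrite /= ?b1 ?b14 ?e11 ?fE ?yE ?zE; move: lc lr lG; move: (i %/ n) (i %% n) => ii jj *;
    repeat split; lia.
have miss lo hi A g' m m' : (forall x, m' x = (m x + scattered (n * n) A g' x) %% 2 ^ W) ->
    (forall i, i < n * n -> lo <= A i < hi) -> (forall x, m x < 2 ^ W) ->
    (forall x, (x < lo) || (hi <= x) -> m' x = m x).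
  move=> mE lA sm x out; rewrite mE scattered0 ?addn0 ?modn_small // => i /lA.
  by move: out; lia.
move=> s1 [ag1 _ h1]; have [b1 b9 b10 b14] := keep _ ag1.
have low1 := miss _ _ _ _ _ _ h1 A1_lt small.
have small1 x : heap s1 x < 2 ^ W by rewrite h1 ltn_mod expn_gt0.
have weight1 d : d < n -> heap s1 (L + 3 * n + d) = weight n f y z d.
  move=> ld; rewrite h1 zero ?leq_addr // scattered_shift add0n modn_small //.
  by apply: leq_ltn_trans qW; apply: weight_leq.
apply: tot_seq.
  apply: (scatterP (A := A2) (g := G2) lNW b10 small1) => i s' li e11 ag un.
  have [c1 c9 c10 c14] := keep _ (same_env_trans ag1 ag).
  have [mf mg my mz mr] : tables (heap s').
    apply: (tables_eq _ tab) => x lx; rewrite un ?low1 ?lx // => j /A2_lt; lia.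
  have := row_lt _ li; have := col_lt i => lc lr.
  have gE : heap s' (1 + n * n + i) = g i by apply: mg.
  have yE : heap s' (L + i %% n) = y (i %% n) by apply: my.
  have lg := g_lt li; have fl := flat_leq _ li.
  split; (rewrite ev_nev; first by rewrite /= ?c1 ?c9 ?c10 ?c14 ?e11 ?gE ?yE);
    rewrite /= ?c1 ?c9 ?c10 ?c14 ?e11 ?gE ?yE; move: lc lr fl; move: (i %% n) => jj;
    move: (i %/ n * n) => ii *; repeat split; lia.
move=> s2 [ag2 _ h2]; have ag12 := same_env_trans ag1 ag2.
have [c1 c9 c10 c14] := keep _ ag12.
have A2_lt' i : i < n * n -> D.+1 <= A2 i < (D + n * n).+1 by move/A2_lt; lia.
have low2 := miss _ _ _ _ _ _ h2 A2_lt' small1.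
have eq2 x : x < L + 3 * n -> heap s2 x = heap s x.
  by move=> lx; rewrite low2 ?low1 ?lx //; lia.
have small2 x : heap s2 x < 2 ^ W by rewrite h2 ltn_mod expn_gt0.
apply: tot_seq.
  apply: (scatterP (A := A3) (g := G3) lNW c10 small2) => i s' li e11 ag un.
  have [d1 d9 d10 d14] := keep _ (same_env_trans ag12 ag).
  have [mf mg my mz mr] : tables (heap s').
    by apply: (tables_eq _ tab) => x lx; rewrite un ?eq2 // => j /A3_lt; lia.
  have fE : heap s' (1 + i) = f i by apply: mf.
  have rE : heap s' (L + 2 * n + f i) = r (f i) by apply: mr; apply: f_lt.
  have lf := f_lt li.
  split; (rewrite ev_nev; first by rewrite /= ?d1 ?d9 ?d10 ?d14 ?e11 ?fE ?rE);
    rewrite /= ?d1 ?d9 ?d10 ?d14 ?e11 ?fE ?rE; repeat split; lia.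
move=> s3 [ag3 _ h3]; have ag123 := same_env_trans ag12 ag3.
have [d1 d9 d10 d14] := keep _ ag123.
have A3_lt' i : i < n * n -> (D + n * n).+1 <= A3 i < (D + 2 * (n * n)).+1 by move/A3_lt; lia.
have low3 := miss _ _ _ _ _ _ h3 A3_lt' small2.
apply: tot_effect => //=; rewrite !ev_nev //= d9 d1.
have updE x : x != D -> upd (heap s3) D n x = heap s3 x by rewrite /upd => /negbTE->.
have low x : x < D -> upd (heap s3) D n x = heap s1 x.
  by move=> lx; rewrite updE ?low3 ?low2 //; lia.
split=> [//||d ld|].
- by apply: (tables_eq _ tab) => x lx; rewrite low ?low1 ?lx //; lia.
- by rewrite low ?weight1 //; lia.
split=> [|a t la lt|i li|x lx]; first by rewrite upd_eq.
- have fl : a * n + t < n * n by rewrite mulnn flat_lt.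
  rewrite updE; last by lia.
  rewrite low3; last by lia.
  rewrite h2 low1; last by lia.
  rewrite zero; last by lia.
  rewrite scattered_shift left_matrix_flat // add0n modn_small //.
  by apply: leq_ltn_trans (left_matrix_leq g y_lt a t) _; lia.
- rewrite updE; last by lia.
  rewrite h3 low2; last by lia.
  rewrite low1; last by lia.
  rewrite zero; last by lia.
  rewrite scattered_shift scattered_id // add0n modn_small //.
  by rewrite /G3; have := r_lt (f_lt li); have : q <= n * q by [rewrite leq_pmull]; lia.
- rewrite updE; last by lia.
  rewrite low3; last by lia.
  rewrite low2; last by lia.
  rewrite low1; last by lia.
  by rewrite zero //; lia.
Qed.

End Prepare.

(** * Comparing the two sums row by row *)

Definition entry_pos : expr :=
  Bin Opadd (Bin Opmul (Var 11) (Var 1)) (Var 15).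
Definition g_entry : expr := Deref (Bin Opadd (Bin Opadd (Cst 1) (Var 10)) entry_pos).
Definition weight_cell : expr :=
  Deref (Bin Opadd (Bin Opadd (Var 14) (Bin Opmul (Cst 3) (Var 1))) (Var 15)).

(** One loop serves both sums: variable 15 is d in [left_sum] (accumulated in 12) and c in
    [right_sum] (accumulated in 13). The command [look] reads cell number 6 of the simulated memory,
    a product entry, into variable 7. *)
Definition check_term (look : cmd) : cmd :=
  Seq (Asg 12 (Bin Opadd (Var 12) (Bin Opmul weight_cell (r_cell g_entry))))
 (Seq (Asg 6 (Bin Opadd (Bin Opadd (Cst 1) (Bin Opmul (Cst 2) (Var 10)))
               (Bin Opadd (Bin Opmul (Var 11) (Var 1)) g_entry)))
 (Seq look
      (Asg 13 (Bin Opadd (Var 13) (Bin Opmul (z_cell (Var 15)) (Var 7)))))).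

Definition check_row (look : cmd) : cmd :=
  Seq (Asg 12 (Cst 0))
 (Seq (Asg 13 (Cst 0))
 (Seq (For 15 1 (check_term look))
      (IfEq (Var 12) (Var 13) Skip (Asg 0 (Cst 0))))).

Definition check (look : cmd) : cmd :=
  Seq (Asg 0 (Cst 1)) (For 11 1 (check_row look)).

Section Check.
Variables (n W q : nat) (f g y z r : nat -> nat) (look : cmd) (s : config).
Let L := 1 + 2 * (n * n).
Let U a t := product_entry n f g y r a t.
Hypotheses (n0 : 0 < n) (q0 : 0 < q) (qW : n * (n * n * (q * q) * q) < 2 ^ W).
Hypotheses (LW : L + (n * n + 4 * n) < 2 ^ W).
Hypotheses (f_lt : forall i, i < n * n -> f i < n) (g_lt : forall i, i < n * n -> g i < n).
Hypotheses (y_lt : forall i, i < n -> y i < q) (z_lt : forall i, i < n -> z i < q)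
  (r_lt : forall i, i < n -> r i < q).
Hypotheses (e1 : env s 1 = n) (e10 : env s 10 = n * n) (e14 : env s 14 = L).
Hypotheses (tab : tables n f g y z r (heap s))
  (weights : forall d, d < n -> heap s (L + 3 * n + d) = weight n f y z d).
Hypothesis look_loop_free : loop_free look.
Hypothesis lookP : forall s' a t, a < n -> t < n -> heap s' = heap s ->
  same_env [:: 0; 6; 7; 11; 12; 13; 15] s s' ->
  env s' 6 = 1 + 2 * (n * n) + (a * n + t) ->
  env (effect W look s') 7 = U a t /\ modifies_only 7 s' (effect W look s').

Definition checked a s' :=
  [/\ heap s' = heap s, same_env [:: 0; 6; 7; 11; 12; 13; 15] s s' &
    (env s' 0 != 0) = all (fun a => left_sum n f g y z r a == right_sum n f g y z r a) (iota 0 a)].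

Lemma check_termP a d s' : a < n -> d < n -> heap s' = heap s ->
  same_env [:: 0; 6; 7; 11; 12; 13; 15] s s' ->
  env s' 11 = a -> env s' 15 = d ->
  env s' 12 + weight n f y z d * r (g (a * n + d)) < 2 ^ W ->
  env s' 13 + z d * U a (g (a * n + d)) < 2 ^ W ->
  let s1 := effect W (check_term look) s' in
  [/\ heap s1 = heap s, same_env [:: 6; 7; 12; 13] s' s1,
    env s1 12 = env s' 12 + weight n f y z d * r (g (a * n + d)) &
    env s1 13 = env s' 13 + z d * U a (g (a * n + d))].
Proof.
move=> la ld hs ag e11 e15 l12 l13.
have [mf mg my mz mr] := tab.
have b1 : env s' 1 = n by rewrite ag.
have b10 : env s' 10 = n * n by rewrite ag.
have b14 : env s' 14 = L by rewrite ag.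
have fl : a * n + n <= n * n by rewrite addnC -mulSn leq_mul2r la orbT.
have lad : a * n + d < n * n by lia.
have lg := g_lt lad.
have gE : heap s' (1 + n * n + (a * n + d)) = g (a * n + d) by rewrite hs mg.
have rE : heap s' (L + 2 * n + g (a * n + d)) = r (g (a * n + d)) by rewrite hs mr.
have wE : heap s' (L + 3 * n + d) = weight n f y z d by rewrite hs weights.
have LE : L = 1 + 2 * (n * n) by [].
rewrite /check_term !effect_seq.
have -> : effect W (Asg 12 (Bin Opadd (Var 12) (Bin Opmul weight_cell (r_cell g_entry)))) s' =
    assign s' 12 (env s' 12 + weight n f y z d * r (g (a * n + d))).
  rewrite effect_asg ev_nev /= ?b1 ?b10 ?b14 ?e11 ?e15 ?gE ?rE ?wE //.
  by repeat split; lia.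
set s1 := assign s' 12 _; set e6 := Bin Opadd (Bin Opadd (Cst 1) _) _.
have -> : effect W (Asg 6 e6) s1 = assign s1 6 (1 + 2 * (n * n) + (a * n + g (a * n + d))).
  rewrite effect_asg ev_nev /= /upd /= ?b1 ?b10 ?b14 ?e11 ?e15 ?gE //.
  by repeat split; lia.
set s2 := assign s1 6 _.
have ag2 : same_env [:: 6; 7; 12; 13] s' s2 by do 2!apply: same_env_assign => //.
have [|||v7 [k7 h3 _]] := @lookP s2 a (g (a * n + d)) la lg.
- by [].
- move=> x nx; rewrite ag2 ?ag //.
  by move: nx; rewrite !inE; lia.
- by rewrite /s2 /= upd_eq.
set s3 := effect W look s2 in v7 k7 h3 *.
have ag3 : same_env [:: 6; 7; 12; 13] s' s3.
  by move=> x nx; rewrite k7 ?ag2 //; move: nx; rewrite !inE; lia.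
have hs3 : heap s3 = heap s by rewrite h3.
have zE : heap s3 (L + n + d) = z d by rewrite hs3 mz.
have e13 : env s3 13 = env s' 13 by rewrite k7.
have -> : effect W (Asg 13 (Bin Opadd (Var 13) (Bin Opmul (z_cell (Var 15)) (Var 7)))) s3 =
    assign s3 13 (env s' 13 + z d * U a (g (a * n + d))).
  have c15 : env s3 15 = d by rewrite ag3.
  have c14 : env s3 14 = L by rewrite ag3.
  have c1 : env s3 1 = n by rewrite ag3.
  rewrite effect_asg ev_nev /= ?c1 ?c14 ?c15 ?zE ?v7 ?e13 //.
  by repeat split; lia.
split=> //=; first by apply: same_env_assign.
by rewrite /upd /= k7.
Qed.

Let LE : L = 1 + 2 * (n * n). Proof. by []. Qed.

Lemma check_rowP a s' : a < n -> checked a s' -> env s' 11 = a ->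
  tot W (check_row look) s' (n * (size_cmd look + 80) + 30) (fun s1 =>
    env s1 11 = a /\ checked a.+1 s1).
Proof.
move=> la [hs ag ok] e11.
have fl d : d < n -> a * n + d < n * n by move=> ld; rewrite mulnn flat_lt.
pose F d := weight n f y z d * r (g (a * n + d)).
pose G d := z d * U a (g (a * n + d)).
have lF d : d < n -> F d <= n * n * (q * q) * q.
  move=> ld; apply: leq_mul; first exact: weight_leq.
  by apply/ltnW/r_lt/g_lt/fl.
have lG d : d < n -> G d <= n * n * (q * q) * q.
  move=> ld; apply: (@leq_trans (q * (n * (n * q * q)))); last by lia.
  apply: leq_mul; first exact/ltnW/z_lt.
  by apply: product_entry_leq => //; apply/g_lt/fl.
have sF k : k <= n -> \sum_(d < k) F d < 2 ^ W.
  by move=> lk; apply: leq_ltn_trans qW; apply: sum_leq_const lF _ lk.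
have sG k : k <= n -> \sum_(d < k) G d < 2 ^ W.
  by move=> lk; apply: leq_ltn_trans qW; apply: sum_leq_const lG _ lk.
pose xs := [:: 6; 7; 12; 13; 15].
pose I k s1 := [/\ heap s1 = heap s, same_env xs s' s1,
  env s1 12 = \sum_(d < k) F d & env s1 13 = \sum_(d < k) G d].
have agI s1 : same_env xs s' s1 -> same_env [:: 0; 6; 7; 11; 12; 13; 15] s s1.
  by move=> ag1 x nx; rewrite ag1 ?ag //; move: nx; rewrite !inE; lia.
apply: (@tot_leq _ _ _ (2 + (2 + ((n * (size_cmd (check_term look) + 8) + 6) +
   size_cmd (IfEq (Var 12) (Var 13) Skip (Asg 0 (Cst 0))))))); last by rewrite /=; lia.
have W0 : 0 < 2 ^ W by rewrite expn_gt0.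
apply: (tot_seq (mid := fun s1 => s1 = assign s' 12 0)).
  by apply: tot_effect => //; rewrite effect_asg ev_nev.
move=> _ ->; apply: (tot_seq (mid := fun s1 => s1 = assign (assign s' 12 0) 13 0)).
  by apply: tot_effect => //; rewrite effect_asg ev_nev.
move=> _ ->; apply: (tot_seq (mid := I n)).
  apply: (@tot_weaken _ _ _ _ _ (fun s1 => I n s1 /\ env s1 15 = n) _ _ (leqnn _));
    last by move=> s1 [].
  apply: tot_for.
  - by lia.
  - split=> //; [|by rewrite big_ord0|by rewrite big_ord0].
    by do 3!apply: same_env_assign => //.
  - by rewrite /= /upd /= ag.
  move=> d s1 ld [h1 ag1 f12 f13] f15 f1; apply: tot_effect.
    by rewrite /= look_loop_free.
  have [|||h2 ag2 g12 g13] := check_termP la ld h1 (agI _ ag1) _ f15.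
  - by rewrite ag1.
  - by rewrite f12; have := sF _ ld; rewrite big_ord_recr.
  - by rewrite f13; have := sG _ ld; rewrite big_ord_recr.
  move: (effect W (check_term look) s1) h2 ag2 g12 g13 => s2 h2 ag2 g12 g13.
  split; [by rewrite ag2 | by rewrite /= /upd /= ag2 |].
  split=> //; [|by rewrite /= /upd /= g12 f12 big_ord_recr
               |by rewrite /= /upd /= g13 f13 big_ord_recr].
  apply: same_env_assign => // x nx; rewrite ag2 ?ag1 //.
  by move: nx; rewrite !inE; lia.
move=> s1 [h1 ag1 f12 f13]; apply: tot_effect => //.
have ok1 : all (fun a => left_sum n f g y z r a == right_sum n f g y z r a)
    (iota 0 a.+1) = (env s1 0 != 0) && (env s1 12 == env s1 13).
  by rewrite -addn1 iotaD all_cat -ok /= andbT add0n f12 f13 ag1.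
rewrite effect_ifeq !ev_nev //=; case: ifP => e; rewrite e in ok1.
  by split; [rewrite ag1 | split; [|apply: agI|rewrite ok1 andbT]].
rewrite [ev _ _ (Cst 0)]ev_nev //=; split; first by rewrite /= /upd /= ag1.
by split; [|apply: same_env_assign => //; apply: agI|rewrite ok1 andbF].
Qed.

Lemma checkP : tot W (check look) s (n * (n * (size_cmd look + 80) + 38) + 8) (fun s1 =>
  (env s1 0 != 0) = [forall a : 'I_n, left_sum n f g y z r a == right_sum n f g y z r a]).
Proof.
apply: (@tot_leq _ _ _ (2 + (n * (n * (size_cmd look + 80) + 30 + 8) + 6))); last lia.
apply: (tot_seq (mid := fun s1 => s1 = assign s 0 1)).
  by apply: tot_effect => //; rewrite effect_asg ev_nev //=; lia.
move=> _ ->; apply: (@tot_weaken _ _ _ _ _ (fun s1 => checked n s1 /\ env s1 11 = n) _ _ (leqnn _)).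
  apply: tot_for; first by lia.
  - by split=> //; do 2!apply: same_env_assign => //.
  - by rewrite /= /upd /=.
  move=> a s1 la ch e11 _; apply: tot_weaken (check_rowP la ch e11) (leqnn _) _.
  move=> s2 [f11 [hs ag ok]]; split=> //; first by rewrite /= /upd /= ag.
  by split=> //; apply: same_env_assign.
move=> s1 [[_ _ ->] _]; apply/allP/forallP => [al a|al a].
  by apply: al; rewrite mem_iota /= ltn_ord.
by rewrite mem_iota => la; apply: (al (Ordinal la)).
Qed.

End Check.

(** * The checking program *)

Definition input_oracle : cmd := Asg 7 (Deref (Bin Opadd (Var 9) (Var 6))).

Definition checker_setup (k c : nat) : cmd :=
  Seq (next_pow2 1)
 (Seq (power 3 k)
 (Seq (power 4 (k + 4))
 (Seq (power 8 c)
 (Seq (power 9 3)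
 (Seq (Asg 10 (Bin Opmul (Var 1) (Var 1)))
 (Seq (Asg 13 (Bin Opmul (Cst 3) (Var 1)))
      (Asg 14 (Bin Opadd (Cst 1) (Bin Opmul (Cst 2) (Var 10)))))))))).

Definition checker (P : program) (k c : nat) : cmd :=
  Seq (Asg 1 (Deref (Cst 0)))
      (IfLt (Var 1) (Cst 2) (Asg 0 (Cst 1))
        (Seq (checker_setup k c)
        (Seq draw_coins
        (Seq prepare
        (Seq (simulator P input_oracle) (check (fetch input_oracle))))))).

(** Position x is variable x: p, the simulated modulus, the base of the simulated memory, q, D, n *
    n, the number of coins, and L; the zeros are fillers. *)
Definition setup_value (n p k c x : nat) : nat :=
  nth 0 [:: 0; 0; p; p ^ k; p ^ (k + 4); 0; 0; 0; p ^ c; p ^ 3; n * n; 0; 0;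
            3 * n; 1 + 2 * (n * n)] x.

Lemma checker_setupP W n k c s (p := 2 ^ (trunc_log 2 n).+1) : 1 < n ->
  p ^ (k + c + 6) <= 2 ^ W -> env s 1 = n ->
  tot W (checker_setup k c) s (n * 10 + (10 + size_cmd (power 3 k) +
     size_cmd (power 4 (k + 4)) + size_cmd (power 8 c) + size_cmd (power 9 3) + 14)) (fun s' =>
    [/\ forall x, x \in [:: 2; 3; 4; 8; 9; 10; 13; 14] -> env s' x = setup_value n p k c x,
        same_env [:: 2; 3; 4; 8; 9; 10; 13; 14] s s', heap s' = heap s & rnd s' = rnd s]).
Proof.
move=> n1 big e1.
have ltnp : n < p by apply: trunc_log_ltn.
have p1 : 1 < p by lia.
have le_p i : i <= k + c + 6 -> p ^ i <= 2 ^ W.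
  by move=> le; apply: leq_trans big; rewrite leq_pexp2l //; lia.
have lt_p i : i < k + c + 6 -> p ^ i < 2 ^ W.
  by move=> lt; apply: leq_trans big; rewrite ltn_exp2l.
have p3 : 3 * (n * n) + 3 < 2 ^ W.
  apply: leq_ltn_trans (lt_p 4 _); last lia.
  have pp : n.+1 * n.+1 <= p * p by apply: leq_mul.
  have : 9 * (p * p) <= p ^ 4 by rewrite !expnS expn0; nia.
  lia.
have nn : n <= n * n by rewrite leq_pmulr; lia.
pose all := [:: 2; 3; 4; 8; 9; 10; 13; 14].
pose St (ys : seq nat) s' := [/\ forall x, x \in ys -> env s' x = setup_value n p k c x,
  same_env all s s', heap s' = heap s & rnd s' = rnd s].
have stepS (x : nat) ys s1 s2 : x \in all -> St ys s1 -> modifies_only x s1 s2 ->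
    env s2 x = setup_value n p k c x -> St (x :: ys) s2.
  move=> xin [val ag h rn] [mo h2 r2] vx; split; rewrite ?h2 ?r2 //.
    move=> y; rewrite inE; case: eqP => [-> //|/eqP ne] /= yin; by rewrite mo ?val.
  by move=> y ny; rewrite mo ?ag //; apply: contra ny => /eqP->.
have St1 ys s1 : St ys s1 -> env s1 1 = n by case=> _ ->.
have pow x j ys s1 : x \in all -> x != 2 -> St ys s1 -> 2 \in ys -> j < k + c + 6 ->
    setup_value n p k c x = p ^ j -> tot W (power x j) s1 (size_cmd (power x j)) (St (x :: ys)).
  move=> xin nx st two lj vx; apply: tot_effect; first exact: loop_free_power.
  have e2 : env s1 2 = p by case: st => /(_ 2 two).
  have [ex mo] := @powerP W x j p s1 nx e2 p1 (lt_p _ lj).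
  by apply: stepS st mo _; rewrite ?ex ?vx.
apply: (@tot_leq _ _ _ ((n * 10 + 10) + (size_cmd (power 3 k) + (size_cmd (power 4 (k + 4)) +
  (size_cmd (power 8 c) + (size_cmd (power 9 3) + (4 + (4 + 6)))))))); last lia.
apply: (tot_seq (mid := St [:: 2])).
  apply: (tot_weaken (next_pow2P (w := W) (x := 1) (N := n) isT e1 _ _)) => //.
  - by lia.
  - by rewrite -/p -[X in X < _]expn1; apply: lt_p; lia.
  - by move=> s1 [e2 mo]; apply: (stepS 2 [::] s) => //; rewrite e2.
move=> s1 st1; apply: tot_seq; first by apply: pow st1 _ _ _ => //; lia.
move=> s2 st2; apply: tot_seq; first by apply: pow st2 _ _ _ => //; lia.
move=> s3 st3; apply: tot_seq; first by apply: pow st3 _ _ _ => //; lia.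
move=> s4 st4; apply: tot_seq; first by apply: pow st4 _ _ _ => //; lia.
move=> s5 st5; have f5 := St1 _ _ st5.
apply: (tot_seq (mid := St [:: 10, 9, 8, 4, 3 & [:: 2]])).
  apply: tot_effect => //; apply: stepS st5 _ _ => //; first exact: modifies_only_assign.
  by rewrite effect_asg ev_nev /= f5 ?upd_eq //; split=> //; lia.
move=> s6 st6; have f6 := St1 _ _ st6.
apply: (tot_seq (mid := St [:: 13, 10, 9, 8, 4, 3 & [:: 2]])).
  apply: tot_effect => //; apply: stepS st6 _ _ => //; first exact: modifies_only_assign.
  by rewrite effect_asg ev_nev /= f6 ?upd_eq //; split=> //; lia.
move=> s7 st7; have f10 : env s7 10 = n * n by case: st7 => /(_ 10 isT).
apply: tot_effect => //.
have [val ag h rn] : St [:: 14, 13, 10, 9, 8, 4, 3 & [:: 2]] 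
   (effect W (Asg 14 (Bin Opadd (Cst 1) (Bin Opmul (Cst 2) (Var 10)))) s7).
  apply: stepS st7 _ _ => //; first exact: modifies_only_assign.
  by rewrite effect_asg ev_nev /= f10 ?upd_eq //; repeat split; lia.
by split=> // x xin; apply: val; move: xin; rewrite !inE; lia.
Qed.

(** * The randomized checker *)

Lemma cayley_lt n (h : 'I_n -> 'I_n -> 'I_n) i : i < n * n -> nth 0 (cayley_table h) i < n.
Proof.
move=> li; have n0 : 0 < n by case: (n) li.
have l1 : i %/ n < n by rewrite ltn_divLR.
have l2 : i %% n < n by rewrite ltn_mod.
by rewrite (divn_eq i n) (nth_table (fun a b => val (h a b)) 0 (Ordinal l1) (Ordinal l2)) ltn_ord.
Qed.

Section CheckerProgram.
Variables (n k c : nat) (P : program) (S : bimagma n) (u : seq nat) (T : nat).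
Let p := 2 ^ (trunc_log 2 n).+1.
Let W := word_size (k + 3 * c + 10 + size P) n.
Let w := word_size k n.
Let q := p ^ c.
Let f i := nth 0 (cayley_table (oplus S)) i.
Let g i := nth 0 (cayley_table (odot S)) i.
Let y i := nth 0 u i %% q.
Let z i := nth 0 u (n + i) %% q.
Let r i := nth 0 u (2 * n + i) %% q.
Let A : 'M[int]_n := (\matrix_(i, j) (left_matrix n g y i j)%:Z)%R.
Let B : 'M[int]_n := (\matrix_(i, j) (right_matrix n f r i j)%:Z)%R.
Let input := n :: encode_mx w A ++ encode_mx w B.
Let Q := run w P T input [::].
Hypotheses (n1 : 1 < n) (P_coin_free : coin_free P) (P_halted : halted P Q).
Hypothesis P_product : forall i j : 'I_n,
  int_of_word w (memory Q (1 + 2 * n ^ 2 + i * n + j)) = (A *m B)%R i j.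

Let m i := nth 0 (@encode distributivity _ S) i %% 2 ^ W.
Let L := 1 + 2 * (n * n).
Let D := p ^ 3.
Let lim := p ^ (k + 3).
Let base := p ^ (k + 4).

(** The entries are nonnegative, which rules out the negative reading of the word. *)
Lemma product_entryE (i j : 'I_n) :
  memory Q (1 + 2 * n ^ 2 + i * n + j) < 2 ^ w ->
  memory Q (1 + 2 * n ^ 2 + i * n + j) = product_entry n f g y r i j.
Proof.
move=> lt; have := P_product i j; rewrite mxE.
have -> : (\sum_j0 A i j0 * B j0 j = (product_entry n f g y r i j)%:Z)%R.
  rewrite /product_entry -natz natr_sum; apply: eq_bigr => s _.
  by rewrite !mxE natz PoszM.
rewrite /int_of_word; move: (memory _ _) (product_entry _ _ _ _ _ _ _) lt => x v lt.
by case: ifP => _; [case | move=> E; lia].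
Qed.

(** The memory holds the tables below L, then vectors and weights up to L + 4 * n, the matrix input
    from D = p ^ 3, and the simulated memory from p ^ (k + 4). The range [lim] covers both the w-bit
    addresses and the product cells that are read afterwards. The 3 * c in the word size is for
    products of three coins below q. *)
Lemma checkerP : tot W (checker P k c) (initial m u)
  (T * (size_cmd (dispatch P input_oracle 0 P) + 4) + n * n * (size_cmd (fetch input_oracle) + 500) +
   (size_cmd (power 3 k) + size_cmd (power 4 (k + 4)) + size_cmd (power 8 c) +
    size_cmd (power 9 3) + 500))
  (fun s => (env s 0 != 0) =
     [forall a : 'I_n, left_sum n f g y z r a == right_sum n f g y z r a]).
Proof.
have n0 : 0 < n by apply: ltnW.
have ltnp : n < p by apply: trunc_log_ltn.
have p3 : 3 <= p by lia.
have p4 : 4 <= p.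
  move: p3; rewrite /p expnS; have := expn_gt0 2 (trunc_log 2 n); lia.
have p1 : 1 < p by lia.
have p0 : 0 < p by lia.
have bigW : p ^ (k + 3 * c + 10) * 2 ^ size P <= 2 ^ W.
  rewrite exp2_word_size -/p [X in _ <= X]expnD leq_mul2l; apply/orP; right.
  by case: (size P) => // N; rewrite leq_exp2r.
have ltPW : size P < 2 ^ W.
  apply: leq_trans bigW; apply: leq_trans (ltn_expl _ (isT : 1 < 2)) _.
  by rewrite leq_pmull // expn_gt0 p0.
have pW : p ^ (k + 3 * c + 10) <= 2 ^ W by apply: leq_trans bigW; rewrite leq_pmulr // expn_gt0.
have le_p i j : i <= j -> p ^ i <= p ^ j by move=> le; rewrite leq_pexp2l.
have lt_p i j : i < j -> p ^ i < p ^ j by move=> lt; rewrite ltn_exp2l.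
have leW i : i <= k + 3 * c + 10 -> p ^ i <= 2 ^ W.
  by move=> le; apply: leq_trans pW; apply: le_p.
have wE : 2 ^ w = p ^ k by rewrite exp2_word_size.
have q0 : 0 < q by rewrite expn_gt0 p0.
have nn : n <= n * n by rewrite leq_pmulr.
have pp : n.+1 * n.+1 <= p * p by apply: leq_mul.
have D4 : 4 * (p * p) <= D by rewrite /D !expnS expn0 muln1 leq_mul2r p4 orbT.
have DD : 2 * D <= p ^ 4 by rewrite expnS leq_mul2r; apply/orP; right; lia.
have LD : L + 4 * n <= D by rewrite /L; lia.
have LD3 : 3 * (n * n) + 1 < D by lia.
have D4W : p ^ 4 <= 2 ^ W by apply: leW; lia.
have DW : D + (1 + 3 * (n * n)) < 2 ^ W by lia.
have q3 : n * (n * n * (q * q) * q) < 2 ^ W.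
  apply: (@leq_trans (p ^ (3 * c + 3))); last by apply: leW; lia.
  have -> : n * (n * n * (q * q) * q) = (n * n * n) * (q * q * q) by lia.
  have -> : p ^ (3 * c + 3) = (p * p * p) * (q * q * q).
    by rewrite expnD mulnC mulSn mul2n -addnn !expnD !expnS expn0 /q; lia.
  by rewrite ltn_mul2r !muln_gt0 q0 /=; nia.
have qW : n * n * (q * q) < 2 ^ W.
  by apply: leq_ltn_trans q3; rewrite -[X in X <= _]muln1 mulnC -mulnA leq_mul // leq_pmulr.
have y_lt i : i < n -> y i < q by rewrite ltn_mod.
have z_lt i : i < n -> z i < q by rewrite ltn_mod.
have r_lt i : i < n -> r i < q by rewrite ltn_mod.
have f_lt i : i < n * n -> f i < n by apply: cayley_lt.
have g_lt i : i < n * n -> g i < n by apply: cayley_lt.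
have nW : n < 2 ^ W by lia.
have m0 : m 0 = n by rewrite /m /= modn_small.
have mf i : i < n * n -> m (1 + i) = f i.
  move=> li; rewrite /m add1n /= nth_cat size_table -mulnn li modn_small //.
  exact: ltn_trans (f_lt i li) _.
have mg i : i < n * n -> m (1 + n * n + i) = g i.
  move=> li; rewrite /m -addnA add1n /= nth_cat size_table -mulnn ltnNge leq_addr /= addKn.
  by rewrite modn_small //; apply: ltn_trans (g_lt i li) _.
have mz x : L <= x -> m x = 0.
  by move=> le; rewrite /m nth_default ?mod0n //= size_cat !size_table -mulnn; rewrite /L in le; lia.
have m_lt x : m x < 2 ^ W by rewrite ltn_mod expn_gt0.
pose t5 := T * (size_cmd (dispatch P input_oracle 0 P) + 4) + 4.
pose t6 := n * (n * (size_cmd (fetch input_oracle) + 80) + 38) + 8.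
pose t2 := n * 10 + (10 + size_cmd (power 3 k) + size_cmd (power 4 (k + 4)) +
  size_cmd (power 8 c) + size_cmd (power 9 3) + 14).
apply: (@tot_leq _ _ _ (3 + (size_expr (Var 1) + size_expr (Cst 2) + 2 +
   (t2 + (3 * n * 20 + 6 + (n * n * 150 + 50 + (t5 + t6))))))); last first.
  rewrite /t2 /t5 /t6 /=; move: (size_cmd (power 3 k)) (size_cmd (power 4 (k + 4)))
    (size_cmd (power 8 c)) (size_cmd (dispatch _ _ _ _)) nn => *; lia.
apply: (tot_seq (mid := fun s => s = assign (initial m u) 1 n)).
  by apply: tot_effect => //; rewrite effect_asg ev_nev /= ?m0 ?expn_gt0.
move=> _ ->; set s0 := assign _ 1 n.
apply: tot_iflt => [|_].
  by rewrite !ev_nev /=; [rewrite upd_eq; lia|lia|].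
have pkc : p ^ (k + c + 6) <= 2 ^ W by apply: leW; lia.
apply: (tot_seq (checker_setupP n1 pkc (erefl : env s0 1 = n))).
move=> s1 [val ag1 h1 rn1]; rewrite -/p in val.
have f3 : env s1 3 = p ^ k by rewrite val.
have f4 : env s1 4 = base by rewrite val.
have f8 : env s1 8 = q by rewrite val.
have f9 : env s1 9 = D by rewrite val.
have f10 : env s1 10 = n * n by rewrite val.
have f13 : env s1 13 = 3 * n by rewrite val.
have f14 : env s1 14 = L by rewrite val.
have f1 : env s1 1 = n by rewrite ag1.
have vnotin rr (xs : seq nat) : all (fun x => x < 20) xs -> vreg rr \notin xs.
  by move=> /allP al; apply/negP => /al; rewrite vreg.unlock; lia.
have fv rr : env s1 (vreg rr) = 0.
  by rewrite ag1 ?vnotin // /s0 /= upd_low.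
have f5 : env s1 5 = 0 by rewrite ag1.
have L3W : L + 3 * n < 2 ^ W by lia.
apply: (tot_seq (draw_coinsP L3W f13 f14 f8)).
move=> s2 [ag2 hu2 hr2]; rewrite h1 rn1 /= in hu2 hr2.
have tab2 : tables n f g y z r (heap s2).
  split=> i li.
  - by rewrite hr2 ?mf // /L; lia.
  - by rewrite hr2 ?mg // /L; lia.
  - by rewrite hu2 //; lia.
  - by rewrite -addnA hu2 //; lia.
  - by rewrite -addnA hu2 //; lia.
have small2 a : heap s2 a < 2 ^ W.
  have [/andP[la ua]|out] := boolP ((L <= a) && (a < L + 3 * n)); last first.
    by rewrite hr2 ?m_lt //; lia.
  have -> : a = L + (a - L) by lia.
  rewrite hu2; last by lia.
  apply: (@leq_trans q); first by rewrite ltn_mod.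
  by apply: leW; lia.
have zero2 x : L + 3 * n <= x -> heap s2 x = 0.
  by move=> lx; rewrite hr2 ?mz //; lia.
have g1 : env s2 1 = n by rewrite ag2.
have g9 : env s2 9 = D by rewrite ag2.
have g10 : env s2 10 = n * n by rewrite ag2.
have g14 : env s2 14 = L by rewrite ag2.
apply: (tot_seq (prepareP n0 q0 LD DW qW f_lt g_lt y_lt z_lt r_lt g1 g9 g10 g14 small2 tab2 zero2)).
move=> s3 [ag3 tab3 wt3 [hD hA hB hz]].
have ag13 : same_env [:: 11; 12] s1 s3.
  by move=> x nx; rewrite ag3 ?ag2 //; move: nx; rewrite !inE; lia.
(* The prepared cells hold plain naturals instead of w-bit words; only residues modulo 2 ^ w matter,
   because a fetch reduces what the oracle returns. *)
have inputE a : nth 0 input a %% 2 ^ w = heap s3 (D + a) %% 2 ^ w.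
  have flat b : b < n * n -> exists i j : 'I_n, b = i * n + j.
    move=> lb; have l1 : b %/ n < n by rewrite ltn_divLR.
    have l2 : b %% n < n by rewrite ltn_mod.
    by exists (Ordinal l1), (Ordinal l2); rewrite /= -divn_eq.
  case: a => [|a]; first by rewrite addn0 hD.
  have [la|la] := ltnP a (n * n).
    have [i [j ->]] := flat a la.
    have -> : (i * n + j).+1 = 1 + i * n + j by lia.
    rewrite nth_input_left mxE word_of_nat modn_mod.
    by rewrite -(hA i j) ?ltn_ord //; congr (heap s3 _ %% _); lia.
  have [lb|lb] := ltnP a (2 * (n * n)).
    have ea : a = n * n + (a - n * n) by lia.
    have [i [j ij]] : exists i j : 'I_n, a - n * n = i * n + j by apply: flat; lia.
    have -> : a.+1 = 1 + n * n + i * n + j by lia.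
    rewrite nth_input_right mxE word_of_nat modn_mod /right_matrix -hB ?mulnn ?flat_lt //.
    by congr (heap s3 _ %% _); rewrite -mulnn; lia.
  by rewrite hz ?nth_input_over //; rewrite -?mulnn; lia.
pose inp a := heap s3 (D + a) %% 2 ^ w.
have W1 : 1 < 2 ^ W by lia.
have wW : w < W.
  by rewrite -(ltn_exp2l _ _ (isT : 1 < 2)) wE; apply: leq_trans (leW (k.+1) _); [exact: lt_p|lia].
have Dlim : D + lim <= base.
  have -> : base = p * p ^ (k + 3) by rewrite /base addnS expnS.
  rewrite /D /lim; apply: (@leq_trans (2 * p ^ (k + 3))).
    by rewrite mul2n -addnn leq_add2r le_p // leq_addl.
  by rewrite leq_mul2r; lia.
have baselim : base + lim <= 2 ^ W.
  apply: (@leq_trans (p ^ (k + 5))); last by apply: leW; lia.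
  have -> : p ^ (k + 5) = p * p ^ (k + 4) by rewrite addnS expnS.
  rewrite /lim /base; apply: (@leq_trans (2 * p ^ (k + 4))).
    by rewrite mul2n -addnn leq_add2l le_p //; lia.
  by rewrite leq_mul2r; lia.
have wlim : 2 ^ w <= lim by rewrite wE /lim; apply: le_p; apply: leq_addr.
have baseW : base < 2 ^ W by apply: leq_trans baselim; rewrite -addn1 leq_add2l expn_gt0 p0.
have oracle_ok env0 : env0 9 = D ->
  forall s', framed base env0 (heap s3) s' -> env s' 6 < lim ->
  let s'' := effect W input_oracle s' in
  [/\ env s'' 7 %% 2 ^ w = inp (env s' 6), forall x, x != 7 -> env s'' x = env s' x,
      heap s'' = heap s' & rnd s'' = rnd s'].
  move=> e09 s' [fe fm] l6 /=; have e9' : env s' 9 = D by rewrite fe.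
  rewrite ev_nev /= ?e9'; last by split=> //; lia.
  split=> // [|x /negbTE ne]; last by rewrite /upd ne.
  by rewrite upd_eq fm //; lia.
have k3 : env s3 3 = 2 ^ w by rewrite ag13 ?wE.
have k4 : env s3 4 = base by rewrite ag13.
have k9 : env s3 9 = D by rewrite ag13.
pose simq := simulates w P inp base lim (env s3) (heap s3).
apply: (tot_seq (mid := simq Q)).
  apply: (@simulatorP w W P input_oracle inp base lim (env s3) (heap s3) wW baselim
    k3 k4 (oracle_ok _ k9) wlim ltPW isT (init w input [::]) s3 T _ P_halted).
  split=> //=.
  - by rewrite min0n ag13.
  - by move=> rr; rewrite ag13 ?vnotin.
  - move=> a la; rewrite /cell hz ?eqxx ?inputE //.
    by apply: leq_trans (leq_addr _ _); apply: leq_trans Dlim; rewrite /D /lim; have := le_p 3 (k + 3) (leq_addl _ _); lia.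
  - by left.
  - by move=> rr; rewrite expn_gt0.
  - by move=> a; rewrite ltn_mod expn_gt0.
move=> s4 sim; have [fe fm] := sim_frame sim.
have low4 x : x < base -> heap s4 x = heap s3 x by apply: fm.
have env4 x : x < 20 -> x \notin [:: 5; 6; 7] -> env s4 x = env s3 x by apply: fe.
have Dbase : D <= base by apply: leq_trans Dlim; apply: leq_addr.
have LW : L + (n * n + 4 * n) < 2 ^ W by lia.
apply: (checkP n0 q0 q3 LW f_lt g_lt y_lt z_lt r_lt) => //.
- by rewrite env4 // ag13.
- by rewrite env4 // ag13.
- by rewrite env4 // ag13.
- by apply: (tables_eq _ tab3) => x lx; rewrite low4 //; lia.
- by move=> d ld; rewrite low4 ?wt3 //; lia.
move=> s' a t la lt hs ag e6.
have e3 : env s' 3 = 2 ^ w by rewrite ag // env4.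
have e4 : env s' 4 = base by rewrite ag // env4.
have e9 : env s' 9 = D by rewrite ag // env4.
have l6 : env s' 6 < lim.
  have : a * n + t < n * n by rewrite mulnn flat_lt.
  have : D <= lim by apply: le_p; apply: leq_addl.
  by rewrite e6; lia.
have fr : framed base (env s') (heap s3) s'.
  by split=> // x lx; rewrite hs low4.
have cell_small x : x < lim -> heap s' (base + x) <= 2 ^ w.
  move=> lx; have := sim_wmem sim x; rewrite -(sim_mem sim) // /cell hs.
  by case: eqP => [->|]; lia.
have [v7 k7 kh kr] := @fetchP w W input_oracle inp base lim (env s') (heap s3)
  wW baselim e3 e4 (oracle_ok _ e9) s' fr l6 cell_small.
split=> //; rewrite v7 hs (sim_mem sim) // e6.
have ij : 1 + 2 * (n * n) + (a * n + t) = 1 + 2 * n ^ 2 + Ordinal la * n + Ordinal lt.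
  by rewrite -mulnn !addnA.
by rewrite ij (product_entryE (sim_wmem sim _)).
Qed.

End CheckerProgram.

(** * Root counting *)

Section RootCounting.
Variables (N M : nat).
Hypothesis M0 : 0 < M.
Local Notation coins := (N.-tuple 'I_M).

Definition set_coin (v : coins) (i : 'I_N) (x : 'I_M) : coins :=
  [tuple if k == i then x else tnth v k | k < N].

Lemma tnth_set_coin v i x k :
  tnth (set_coin v i x) k = if k == i then x else tnth v k.
Proof. by rewrite tnth_mktuple. Qed.

Definition coin (v : coins) (i : nat) : nat := nth 0 [seq val x | x <- v] i.

Lemma coin_tnth v (i : 'I_N) : coin v i = tnth v i.
Proof.
rewrite /coin (nth_map (Ordinal M0)) ?size_tuple ?ltn_ord //.
by rewrite -(tnth_nth (Ordinal M0)).
Qed.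

Lemma coin_set_coin v (i : 'I_N) x j :
  coin (set_coin v i x) j = if j == i then val x else coin v j.
Proof.
have sz (u : coins) : size [seq val x | x <- u] = N by rewrite size_map size_tuple.
have [lt|le] := ltnP j N; last first.
  rewrite /coin !nth_default ?sz //.
  by case: eqP le (ltn_ord i) => // ->; lia.
by rewrite -[j]/(val (Ordinal lt)) !coin_tnth tnth_set_coin val_eqE; case: eqP.
Qed.

Lemma set_coinK v i : set_coin v i (tnth v i) = v.
Proof. by apply: eq_from_tnth => k; rewrite tnth_set_coin; case: eqP => [->|]. Qed.

Lemma set_coin_twice v i x x' : set_coin (set_coin v i x) i x' = set_coin v i x'.
Proof. by apply: eq_from_tnth => k; rewrite !tnth_set_coin; case: eqP. Qed.

Variable q : nat.
Hypothesis dvd_qM : q %| M.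

Local Open Scope ring_scope.

(* Along the residue of coin i, F is affine with slope G, so at most one      *)
(* residue in q is a root unless the slope vanishes.                          *)
Lemma card_roots_affine (F G : coins -> int) (i : 'I_N) :
  (forall v, exists h, forall x,
     F (set_coin v i x) = h + (x %% q)%N%:Z * G v /\ G (set_coin v i x) = G v) ->
  (#|[pred v | F v == 0]| * q <= #|[pred v | G v == 0]| * q + M ^ N)%N.
Proof.
move=> affine.
pose bad := [set v | (F v == 0) && (G v != 0)].
have shift_lt (x j : nat) : ((x + j) %% M < M)%N by rewrite ltn_mod.
pose shift (vj : coins * 'I_q) :=
  set_coin vj.1 i (Ordinal (shift_lt (tnth vj.1 i) vj.2)).
(* The shifted vector shows all coins but i, hence the slope and the residue of coin i at the root;
   this gives the shift j, and then coin i itself. *)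
have inj : {in [predX bad & 'I_q] &, injective shift}.
  move=> [v j] [v' j']; rewrite !inE /= !andbT.
  move=> /andP[/eqP Fv Gv] /andP[/eqP Fv' _] e.
  have [h aff] := affine v.
  have v'E : v' = set_coin v i (tnth v' i).
    by have := congr1 (fun u => set_coin u i (tnth v' i)) e;
      rewrite /shift /= !set_coin_twice set_coinK.
  have [F1 _] := aff (tnth v i); rewrite set_coinK Fv in F1.
  have [F2 _] := aff (tnth v' i); rewrite -v'E Fv' in F2.
  have eqq : (tnth v i = tnth v' i %[mod q])%N.
    apply/eqP; rewrite -eqz_nat; apply/eqP/(mulIf Gv)/(addrI h).
    by rewrite -F1 -F2.
  have eqM : (tnth v i + j = tnth v' i + j' %[mod M])%N.
    by have := congr1 (fun u => val (tnth u i)) e; rewrite /shift !tnth_set_coin eqxx.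
  have jj : j = j'.
    apply: val_inj; have : (tnth v i + j = tnth v i + j' %[mod q])%N.
      have := congr1 (modn^~ q) eqM; rewrite !modn_dvdm // => ->.
      by rewrite -modnDml -eqq modnDml.
    by move/eqP; rewrite eqn_modDl !modn_small // => /eqP.
  rewrite -jj in eqM *; congr (_, _); rewrite v'E; move/eqP: eqM.
  rewrite eqn_modDr !modn_small // => /eqP /val_inj <-.
  by rewrite set_coinK.
have card_bad : (#|bad| * q <= M ^ N)%N.
  have := leq_card_in _ _ inj; rewrite cardX card_ord.
  by rewrite card_tuple card_ord.
apply: (@leq_trans ((#|[pred v | G v == 0]| + #|bad|) * q)); last by rewrite mulnDl leq_add2l.
rewrite leq_mul2r; apply/orP; right.
rewrite -!sum1_card [X in (_ + X)%N]big_mkcond [X in (X + _)%N]big_mkcond.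
rewrite -big_split big_mkcond /=; apply: leq_sum => v _; rewrite !inE.
by case: (F v == 0); case: (G v == 0).
Qed.

End RootCounting.

(** * Error probability of the test *)

Section CheckerError.
Variables (n N M q : nat) (f g : nat -> nat).
Hypotheses (dvd_qM : q %| M) (M0 : 0 < M) (le_nN : 3 * n <= N).
Hypotheses (f_lt : forall i, i < n * n -> f i < n) (g_lt : forall i, i < n * n -> g i < n).
Local Notation coins := (N.-tuple 'I_M).

Let y (v : coins) i := coin v i %% q.
Let z (v : coins) i := coin v (n + i) %% q.
Let r (v : coins) i := coin v (2 * n + i) %% q.

Local Open Scope ring_scope.

(** A Schwartz-Zippel argument for a trilinear form: strip y b, then z c, then r at a . (b + c),
    each at the price of a fraction 1 / q of the draws, until the constant slope 1 remains. *)
Lemma card_unsound (a b c : nat) : (a < n)%N -> (b < n)%N -> (c < n)%N ->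
  g (a * n + f (b * n + c))%N <> f (g (a * n + b) * n + g (a * n + c))%N ->
  (#|[pred v : coins | left_sum n f g (y v) (z v) (r v) a ==
                       right_sum n f g (y v) (z v) (r v) a]| * q <= 3 * M ^ N)%N.
Proof.
move=> la lb lc ne.
have flat i j : (i < n -> j < n -> i * n + j < n * n)%N by move=> li lj; rewrite mulnn flat_lt.
pose left b c := g (a * n + f (b * n + c))%N.
pose right b c := f (g (a * n + b) * n + g (a * n + c))%N.
have left_lt i j : (i < n -> j < n -> left i j < n)%N.
  by move=> li lj; apply/g_lt/flat => //; apply/f_lt/flat.
have right_lt i j : (i < n -> j < n -> right i j < n)%N.
  by move=> li lj; apply/f_lt/flat; apply/g_lt/flat.
pose D v i j : int := (r v (left i j))%:Z - (r v (right i j))%:Z.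
pose E v i : int := \sum_(j < n) (z v j)%:Z * D v i j.
pose F v : int := \sum_(i < n) (y v i)%:Z * E v i.
have FE v : (left_sum n f g (y v) (z v) (r v) a ==
             right_sum n f g (y v) (z v) (r v) a)%N = (F v == 0).
  rewrite left_sumE // right_sumE // -eqz_nat -subr_eq0; congr (_ == _).
  rewrite -!natz !natr_sum -sumrB; apply: eq_bigr => i _.
  rewrite !natr_sum -sumrB /E big_distrr; apply: eq_bigr => j _.
  by rewrite /= !natz !PoszM /D; ring.
rewrite (eq_card (B := [pred v | F v == 0])); last by move=> v; rewrite !inE FE.
have lt1 : (b < N)%N by lia.
have lt2 : (n + c < N)%N by lia.
have lt3 : (2 * n + left b c < N)%N by have := left_lt b c lb lc; lia.
have sum_split (G H : nat -> int) i0 : (i0 < n)%N ->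
    \sum_(i < n) G i * H i = \sum_(i < n | i != i0 :> nat) G i * H i + G i0 * H i0.
  by move=> li; rewrite (bigD1 (Ordinal li)) //= addrC.
have roots1 : (#|[pred v | F v == 0]| * q <= #|[pred v | E v b == 0]| * q + M ^ N)%N.
  apply: (@card_roots_affine N M M0 q dvd_qM F (fun v => E v b) (Ordinal lt1)) => v.
  exists (\sum_(i < n | i != b :> nat) (y v i)%:Z * E v i) => x.
  set v' := set_coin _ _ _.
  have zE i : z v' i = z v i.
    by rewrite /z (coin_set_coin M0) //=; case: eqP => //; lia.
  have rE i : r v' i = r v i.
    by rewrite /r (coin_set_coin M0) //=; case: eqP => //; lia.
  have EE i : E v' i = E v i by rewrite /E /D; under eq_bigr do rewrite zE !rE.
  rewrite EE /F (sum_split (fun i => (y v' i)%:Z) (E v') b lb) EE /y (coin_set_coin M0) // eqxx.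
  split=> //; congr (_ + _); apply: eq_bigr => i ib.
  by rewrite EE (coin_set_coin M0) //= (negbTE ib).
have roots2 : (#|[pred v | E v b == 0]| * q <= #|[pred v | D v b c == 0]| * q + M ^ N)%N.
  apply: (@card_roots_affine N M M0 q dvd_qM (fun v => E v b) (fun v => D v b c) (Ordinal lt2)) => v.
  exists (\sum_(i < n | i != c :> nat) (z v i)%:Z * D v b i) => x.
  set v' := set_coin _ _ _.
  have rE i : r v' i = r v i.
    by rewrite /r (coin_set_coin M0) //=; case: eqP => //; lia.
  have DE i : D v' b i = D v b i by rewrite /D !rE.
  rewrite DE /E (sum_split (fun i => (z v' i)%:Z) (D v' b) c lc) DE /z (coin_set_coin M0) // eqxx.
  split=> //; congr (_ + _); apply: eq_bigr => i ic.
  by rewrite DE (coin_set_coin M0) //= eqn_add2l (negbTE ic).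
(* The slope is 1 because the two sides of the law differ, so the other value of r does not involve
   this coin. *)
have roots3 : (#|[pred v | D v b c == 0]| * q <= #|[pred v : coins | 1%:Z == 0]| * q + M ^ N)%N.
  apply: (@card_roots_affine N M M0 q dvd_qM (fun v => D v b c) (fun v => 1%:Z) (Ordinal lt3)) => v.
  exists (- (r v (right b c))%:Z) => x; split=> //.
  rewrite /D /r !(coin_set_coin M0) //= eqxx eqn_add2l.
  by case: eqP => [e|_]; [case: ne | rewrite mulr1 addrC].
have none : #|[pred v : coins | 1%:Z == 0]| = 0%N by apply: eq_card0.
apply: leq_trans roots1 _; rewrite mulSn addnC leq_add2l.
apply: leq_trans roots2 _; rewrite mulSn addnC leq_add2l.
by apply: leq_trans roots3 _; rewrite none mul0n mul1n.
Qed.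

End CheckerError.

(** * Time and success probability of the checker *)

Lemma checker_trivialP W P k c m u : 1 < W -> m 0 < 2 -> m 0 < 2 ^ W ->
  tot W (checker P k c) (initial m u) 9 (fun _ => True).
Proof.
move=> W1 m2 mW; have W2 : 2 < 2 ^ W by rewrite -[X in X < _]expn1 ltn_exp2l.
apply: (@tot_leq _ _ _ (3 + (size_expr (Var 1) + size_expr (Cst 2) + 2 + 2))) => //.
apply: (tot_seq (mid := fun s => env s 1 < 2)).
  by apply: tot_effect => //; rewrite effect_asg ev_nev /= ?expn_gt0 // upd_eq.
move=> s lt; apply: tot_iflt => [_|]; first exact: tot_effect.
by rewrite !ev_nev //=; lia.
Qed.

(** The error is one-sided: under the law the two sums agree term by term. *)
Lemma checker_answer n (S : bimagma n) (y z r : nat -> nat)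
    (f := fun i => nth 0 (cayley_table (oplus S)) i)
    (g := fun i => nth 0 (cayley_table (odot S)) i) :
  @answer distributivity _ S ->
  [forall a : 'I_n, left_sum n f g y z r a == right_sum n f g y z r a].
Proof.
have fE (i j : 'I_n) : f (i * n + j) = oplus S i j.
  exact: (nth_table (fun a b => val (oplus S a b))).
have gE (i j : 'I_n) : g (i * n + j) = odot S i j.
  exact: (nth_table (fun a b => val (odot S a b))).
move=> /= /forallP D; apply/forallP => a; have n1 : 0 < n by apply: leq_ltn_trans (ltn_ord a).
rewrite left_sumE ?right_sumE //; try by move=> i; apply: cayley_lt.
apply/eqP; apply: eq_bigr => b _; apply: eq_bigr => c _.
rewrite fE !gE fE; congr (_ * _ * r _).
by have /forallP/(_ b)/forallP/(_ c)/eqP -> := D a.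
Qed.

Local Open Scope ring_scope.

Section Randomized.
Variable R : realType.

Lemma success_prob_geq w P T input b (Bad : pred (T.-tuple 'I_(2 ^ w))) (err : R) :
  (forall u : T.-tuple 'I_(2 ^ w), ~~ Bad u ->
     accepts (run w P T input [seq val i | i <- u]) = b) ->
  #|Bad|%:R <= err * ((2 ^ w) ^ T)%N%:R ->
  1 - err <= success_prob R w P T input b.
Proof.
move=> good few; rewrite /success_prob card_tuple card_ord.
have tot0 : (0 : R) < ((2 ^ w) ^ T)%N%:R by rewrite ltr0n !expn_gt0.
rewrite ler_pdivlMr // mulrBl mul1r lerBlDr.
apply: le_trans (lerD (lexx _) few); rewrite -natrD ler_nat.
have <- : (#|[pred u | ~~ Bad u]| + #|Bad| = (2 ^ w) ^ T)%N.
  rewrite addnC; have := cardC Bad; rewrite card_tuple card_ord => <-.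
  by congr (_ + _)%N; apply: eq_card.
rewrite leq_add2r; apply/subset_leq_card/fintype.subsetP => u.
by rewrite !inE => /good ->.
Qed.

Lemma checker_time (tau C : R) (n c1 c2 c3 : nat) : (0 < n)%N -> 2 <= tau ->
  (Num.truncn (C * n%:R `^ tau) * c1 + n * n * c2 + c3)%:R <=
    (`|C| * c1%:R + c2%:R + c3%:R) * n%:R `^ tau.
Proof.
move=> n0 tau2; set T0 := Num.truncn _.
have n1R : 1 <= n%:R :> R by rewrite ler1n.
have npos : 0 <= n%:R `^ tau :> R by apply: powR_ge0.
have n2 : n%:R * n%:R <= n%:R `^ tau :> R.
  by rewrite -expr2 -powR_mulrn ?ler0n // ler_powR.
have one_le : 1 <= n%:R `^ tau :> R.
  by apply: le_trans n2; apply: mulr_ege1.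
have leT0 : T0%:R <= `|C| * n%:R `^ tau.
  have [Cn|Cn] := leP 0 (C * n%:R `^ tau).
    apply: (@le_trans _ _ (C * n%:R `^ tau)); first by rewrite truncn_le.
    by rewrite ler_wpM2r ?ler_norm.
  rewrite /T0; have -> : Num.truncn (C * n%:R `^ tau) = 0%N.
    by rewrite truncn_floor leNgt Cn.
  by rewrite mulr_ge0.
rewrite !natrD !natrM 2!mulrDl; apply: lerD; last by rewrite -[leLHS]mulr1 ler_wpM2l.
by apply: lerD; [rewrite mulrAC ler_wpM2r | rewrite mulrC ler_wpM2l].
Qed.

Lemma distributivity_randomized (tau : R) : 2 <= tau -> matmul_in tau ->
  rand_decidable_in distributivity tau.
Proof.
(* As c' exceeds |c| + 2, n ^ - c * q is at least n ^ 2, which beats 3 for n >= 2. *)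
move=> tau2 mm c; pose c' := (Num.truncn `|c|).+3.
(* The matrix entries are at most n * q, and q = p ^ c' with p <= n ^ 2. *)
have [P [k [C [cf {}mm]]]] := mm (2 * c' + 1)%N.
pose c1 := (size_cmd (dispatch P input_oracle 0 P) + 4)%N.
pose c2 := (size_cmd (fetch input_oracle) + 500)%N.
pose c3 := (size_cmd (power 3 k) + size_cmd (power 4 (k + 4)) + size_cmd (power 8 c') +
    size_cmd (power 9 3) + 500)%N.
exists (comp 0 (checker P k c')), (k + 3 * c' + 10 + size P)%N.
exists (`|C| * c1%:R + c2%:R + c3%:R) => n S n0.
(* The time of the matrix product depends on the matrices, hence on the coins; [T0] bounds it for
   all of them at once. *)
pose T0 := Num.truncn (C * n%:R `^ tau).
pose U := (T0 * c1 + n * n * c2 + c3)%N.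
exists U; first exact: checker_time.
set W := word_size _ n.
have [n1|n1] := leqP n 1.
  have en : n = 1%N by apply/eqP; rewrite eqn_leq n1.
  split=> [u|]; last first.
    (* For n = 1 the required probability is 0, so only halting has to be shown. *)
    have -> : n%:R `^ (- c) = 1 :> R by rewrite en powR1.
    by rewrite subrr divr_ge0 ?ler0n.
  have W1 : (1 < W)%N by rewrite /W /word_size; nia.
  have W2 : (2 < 2 ^ W)%N by rewrite -[X in (X < _)%N]expn1 ltn_exp2l.
  have m0 : (nth 0 (@encode distributivity _ S) 0 %% 2 ^ W = n)%N.
    by rewrite /= modn_small //; lia.
  have le9 : (9 <= U)%N by rewrite /U /c3; lia.
  pose m i := (nth 0 (@encode distributivity _ S) i %% 2 ^ W)%N.
  have [||ht _] := tot_run (@checker_trivialP W P k c' m [seq val i | i <- u] W1 _ _) le9.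
  - by rewrite /m m0; lia.
  - by rewrite /m m0; lia.
  - exact: ht.
have n2R : 2 <= n%:R :> R by rewrite ler_nat.
have n1R : 1 <= n%:R :> R by rewrite ler1n.
pose p := (2 ^ (trunc_log 2 n).+1)%N; pose q := (p ^ c')%N; pose w := word_size k n.
pose f i := nth 0%N (cayley_table (oplus S)) i.
pose g i := nth 0%N (cayley_table (odot S)) i.
have ltnp : (n < p)%N by apply: trunc_log_ltn.
have lep : (p <= n ^ 2)%N.
  rewrite /p expnS; apply: (@leq_trans (2 * n)).
    by rewrite leq_mul2l /= trunc_logP.
  by rewrite expnS expn1 leq_mul2r n1 orbT.
have q0 : (0 < q)%N by rewrite expn_gt0; lia.
have leq_qn : (n * q <= n ^ (2 * c' + 1))%N.
  by rewrite addn1 expnS leq_mul2l expnM leq_exp2r ?lep ?orbT.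
have f_lt i : (i < n * n)%N -> (f i < n)%N by apply: cayley_lt.
have g_lt i : (i < n * n)%N -> (g i < n)%N by apply: cayley_lt.
have runP (v : seq nat) (y := fun i => (nth 0 v i %% q)%N)
    (z := fun i => (nth 0 v (n + i) %% q)%N) (r := fun i => (nth 0 v (2 * n + i) %% q)%N) :
  let s := run W (comp 0 (checker P k c')) U (@encode distributivity _ S) v in
  halted (comp 0 (checker P k c')) s /\
  accepts s = [forall a : 'I_n, left_sum n f g y z r a == right_sum n f g y z r a].
  have res_lt i : (nth 0 v i %% q < q)%N by rewrite ltn_mod.
  pose A : 'M[int]_n := \matrix_(i, j) (left_matrix n g y i j)%:Z.
  pose B : 'M[int]_n := \matrix_(i, j) (right_matrix n f r i j)%:Z.
  have leA i j : `|A i j| <= (n ^ (2 * c' + 1))%N%:Z.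
    rewrite mxE ger0_norm // lez_nat; apply: leq_trans leq_qn.
    by apply: left_matrix_leq => b _; apply: res_lt.
  have leB i j : `|B i j| <= (n ^ (2 * c' + 1))%N%:Z.
    rewrite mxE ger0_norm // lez_nat; apply: leq_trans leq_qn.
    by apply: leq_trans (leq_pmull q n0); apply: right_matrix_leq => // b _; apply: res_lt.
  have [T leT [hT prod]] := mm n A B n0 leA leB.
  have leTT0 : (T <= T0)%N.
    by rewrite truncn_ge_nat //; apply: le_trans leT; rewrite ler0n.
  rewrite -/w in hT prod; set input := n :: _ in hT prod.
  have runT : run w P T0 input [::] = run w P T input [::].
    by rewrite /run -(subnKC leTT0) iter_plus halted_iter.
  rewrite -runT in hT prod.
  have [ht [s [sE rE _]]] := tot_run (checkerP n1 cf hT prod) (leqnn U).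
  by split; [exact: ht | rewrite /accepts rE sE].
split=> [u|]; first exact: (runP _).1.
pose y (v : U.-tuple 'I_(2 ^ W)) i := (coin v i %% q)%N.
pose z (v : U.-tuple 'I_(2 ^ W)) i := (coin v (n + i) %% q)%N.
pose r (v : U.-tuple 'I_(2 ^ W)) i := (coin v (2 * n + i) %% q)%N.
have acc (v : U.-tuple 'I_(2 ^ W)) : accepts (run W (comp 0 (checker P k c')) U
    (@encode distributivity _ S) [seq val i | i <- v]) =
    [forall a : 'I_n, left_sum n f g (y v) (z v) (r v) a == right_sum n f g (y v) (z v) (r v) a].
  exact: (runP [seq val i | i <- v]).2.
have [yes|no] := boolP (@answer distributivity _ S).
  apply: (@success_prob_geq _ _ _ _ _ pred0) => [v _|].
    by rewrite acc checker_answer.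
  by rewrite card0 mulr_ge0 ?powR_ge0 ?ler0n.
have fE (i j : 'I_n) : f (i * n + j)%N = oplus S i j.
  exact: (nth_table (fun a b => val (oplus S a b))).
have gE (i j : 'I_n) : g (i * n + j)%N = odot S i j.
  exact: (nth_table (fun a b => val (odot S a b))).
have [a [b [d ne]]] : exists a b d : 'I_n,
    g (a * n + f (b * n + d))%N <> f (g (a * n + b) * n + g (a * n + d))%N.
  move: no; rewrite negb_forall => /existsP[a].
  rewrite negb_forall => /existsP[b]; rewrite negb_forall => /existsP[d ne].
  exists a, b, d; rewrite fE !gE fE => /val_inj e; case/negP: ne; exact/eqP.
have n_lt_U : (3 * n <= U)%N.
  by rewrite /U /c2; nia.
have M0 : (0 < 2 ^ W)%N by rewrite expn_gt0.
have dvd_qM : (q %| 2 ^ W)%N.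
  by rewrite /q /p -expnM dvdn_exp2l // /W /word_size; nia.
have unsound := @card_unsound n U (2 ^ W) q f g dvd_qM M0 n_lt_U f_lt g_lt a b d
  (ltn_ord a) (ltn_ord b) (ltn_ord d) ne.
set Bad := [pred v | _] in unsound.
apply: (@success_prob_geq _ _ _ _ _ Bad) => [v nb|].
  rewrite acc; apply/negbTE; rewrite negb_forall; apply/existsP; exists a; exact: nb.
have qR : 0 < q%:R :> R by rewrite ltr0n.
have err : 3%:R <= n%:R `^ (- c) * q%:R.
  apply: (@le_trans _ _ (n%:R `^ (- c) * (n ^ c')%N%:R)); last first.
    by rewrite ler_wpM2l ?powR_ge0 // ler_nat leq_exp2r // ltnW.
  rewrite natrX -powR_mulrn ?ler0n // -powRD; last first.
    by rewrite pnatr_eq0 -lt0n n0 implybT.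
  apply: (@le_trans _ _ (n%:R `^ 2%:R)).
    by rewrite powR_mulrn ?ler0n // -natrX ler_nat; nia.
  apply: ler_powR => //.
  have := truncnS_gt `|c|; have := ler_norm c.
  by rewrite /c' -addn3 natrD -natr1; lra.
rewrite -(ler_pM2r qR) -natrM; apply: (@le_trans _ _ (3 * (2 ^ W) ^ U)%N%:R).
  by rewrite ler_nat.
by rewrite natrM mulrAC ler_wpM2r.
Qed.

End Randomized.

Theorem theorem1p1 (R : realType) :
  [/\ forall delta : R, 0 < delta ->
        decidable_in Randomized distributivity (omega R + delta),
      matmul_in (omega R) ->
        decidable_in Randomized distributivity (omega R)
    & forall K : algorithm_kind,
        (exists2 eps : R, 0 < eps &
           decidable_in K distributivity (omega R - eps)) ->
        ~ triangle_hypothesis R K].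
Proof.
split=> [delta delta0|mm|K]; last exact: triangle_of_distributivity.
  (* The infimum need not be attained, but some exponent of matrix multiplication lies below omega +
     delta. *)
  have [tau mm lt_tau] := inf_adherent delta0 (has_inf_matmul_in R).
  move=> c; have [P [k [C solve]]] := distributivity_randomized (matmul_in_ge2 mm) mm c.
  exists P, k, `|C| => n S n0; have [T leT ok] := solve n S n0; exists T => //.
  apply: le_trans leT _; apply: (@le_trans _ _ (`|C| * n%:R `^ tau)).
    by rewrite ler_wpM2r ?powR_ge0 ?ler_norm.
  by rewrite ler_wpM2l // ler_powR ?ler1n // ltW.
exact: distributivity_randomized (omega_ge2 R) mm.
Qed.
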